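(* Let $\alpha>1$, $c>0$ and $\mathcal{D}_\alpha\in\{\mathcal{F}_\alpha,\mathcal{P}_\alpha\}$ (Fréchet or Pareto with shape $\alpha$). In the adversarial $m$-set semi-bandit problem with $d$ base-arms, the policy FTPL with perturbation distribution $\mathcal{D}_\alpha$, with loss estimation by geometric resampling (GR) or by conditional geometric resampling (CGR), and with learning rate $$\eta_t=\frac{c}{\sqrt t}\,m^{\frac12-\frac1\alpha}d^{\frac1\alpha-\frac12}$$ satisfies $\mathcal{R}(T)\le O(\sqrt{mdT})$; that is, there is a constant $C$ depending only on $\alpha$, $c$ and the choice of distribution family such that $\mathcal{R}(T)\le C\sqrt{mdT}$ for all $1\le m\le d$, all $T\ge1$ and all adversaries.
   Context: **Problem.** $d\in\mathbb{N}$, $m\in[d]=\{1,\dots,d\}$, action set $\mathcal{A}=\{a\in\{0,1\}^d:\|a\|_1=m\}$. At each round $t=1,\dots,T$ the environment determines $\ell_t\in[0,1]^d$, the learner selects $a_t\in\mathcal{A}$, incurs $\langle \ell_t,a_t\rangle$ and observes only $\ell_{t,i}$ for $i$ with $a_{t,i}=1$. Adversarial setting: $\ell_t$ is arbitrary and may depend on the past $\{(\ell_s,a_s)\}_{s<t}$. Pseudo-regret: $\mathcal{R}(T)=\mathbb{E}[\sum_{t=1}^T\langle \ell_t,a_t-a^*\rangle]$ with $a^*\in\arg\min_{a\in\mathcal{A}}\mathbb{E}[\sum_{t=1}^T\langle \ell_t,a\rangle]$. **Distributions.** Fréchet $\mathcal{F}_\alpha$: CDF $F(x)=e^{-1/x^\alpha}$,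 $x\ge0$. Pareto $\mathcal{P}_\alpha$: CDF $F(x)=1-x^{-\alpha}$, $x\ge1$. **FTPL.** $\hat L_1=\mathbf 0$. At round $t$, sample $r_t=(r_{t,1},\dots,r_{t,d})$ with i.i.d. components from $\mathcal{D}_\alpha$, play $a_t=\arg\min_{a\in\mathcal{A}}a^\top(\eta_t\hat L_t-r_t)$ (i.e. the $m$ largest entries of $r_t-\eta_t\hat L_t$). Let $w_{t,i}=\mathbb{P}[a_{t,i}=1\mid\hat L_t]$. Compute estimators $\widehat{w_{t,i}^{-1}}$ of $w_{t,i}^{-1}$ for $i$ with $a_{t,i}=1$, set $\hat\ell_{t,i}=\mathbb{1}[a_{t,i}=1]\,\ell_{t,i}\,\widehat{w_{t,i}^{-1}}$ and $\hat L_{t+1}=\hat L_t+\hat\ell_t$. **GR.** Draw fresh independent vectors $r'^{(1)},r'^{(2)},\dots$ with i.i.d. components from $\mathcal{D}_\alpha$; $\widehat{w_{t,i}^{-1}}=M_{t,i}$ is the first $s$ such that $i$ is among the indices of the $m$ largest entries of $r'^{(s)}-\eta_t\hat L_t$. **CGR.** Let $\sigma_i$ be the rank of $\hat L_{t,i}$ among $\hat L_{t,1},\dots,\hat L_{t,d}$ in increasing order (ties broken by a fixed rule). Draw fresh independent vectors $r'^{(1)},r'^{(2)},\dots$ with i.i.d. components from $\mathcal{D}_\alpha$. For $i$ with $\sigma_i\le m$: $\widehat{w_{t,i}^{-1}}=M_{t,i}$ is the first $s$ such that $i$ is among the indices of the $m$ largest entries of $r'^{(s)}-\eta_t\hat L_t$.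 For $i$ with $\sigma_i>m$: at resampling step $s$, with the drawn vector $r'^{(s)}$ and with $\theta^{(s)}$ uniform on $[m]$ (independent), let $i'$ be the index of the $\theta^{(s)}$-th largest value in $\{r'^{(s)}_j:\sigma_j\le\sigma_i\}$ and let $r''^{(s)}$ be $r'^{(s)}$ with entries $i$ and $i'$ swapped; $M_{t,i}$ is the first $s$ such that $i$ is among the indices of the $m$ largest entries of $r''^{(s)}-\eta_t\hat L_t$, and $\widehat{w_{t,i}^{-1}}=(\sigma_i/m)M_{t,i}$. *)

(* Defs.v *)
(* MathComp / MathComp-Analysis *)
From HB Require Import structures.
From mathcomp Require Import all_boot all_order all_algebra perm.
From mathcomp Require Import all_classical all_reals all_analysis.
Set Implicit Arguments.
Unset Strict Implicit.
Unset Printing Implicit Defensive.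
Import Order.TTheory GRing.Theory Num.Theory.
Import numFieldNormedType.Exports.
Local Open Scope classical_set_scope.
Local Open Scope ring_scope.

(** Conventions.  Rounds, resampling steps and coordinates are numbered from 0:
    the index [t] stands for round [t + 1] of the game, the index [s] for
    resampling step [s + 1].  An action [a] in [{0,1}^d] with [|a|_1 = m] is
    represented by its support, a set [a : {set 'I_d}] with [#|a| = m]. *)

Inductive law_family := Frechet | Pareto.

(* At 0 the Frechet CDF is 0, the limit of [exp (- 1 / x ^ alpha)]. *)
Definition family_cdf (R : realType) (D : law_family) (alpha x : R) : R :=
  match D with
  | Frechet => if 0 < x then expR (- (x `^ alpha)^-1) else 0
  | Pareto => if 1 <= x then 1 - x `^ (- alpha) else 0
  end.

Definition has_law (R : realType) (disp : measure_display)
    (W : measurableType disp) (P : probability W R) (D : law_family) (alpha : R)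
    (X : {RV P >-> R}) : Prop :=
  forall x : R, cdf X x = (family_cdf D alpha x)%:E.

Definition dot (R : realType) (d : nat) (l : 'I_d -> R) (a : {set 'I_d}) : R :=
  \sum_(i in a) l i.

(* The default value [[set i | i < m]] of [arg min] is an action if [m <= d]. *)
Definition argmin_action (R : realType) (d m : nat) (v : 'I_d -> R) :
    {set 'I_d} :=
  [arg min_(a < [set i : 'I_d | (i < m)%N]%SET | #|a| == m) dot v a]%O.

(** Order statistics of a vector.  Equal entries are ordered by index; for the
    perturbed vectors below ties have probability 0. *)

Definition beats (R : realType) (d : nat) (v : 'I_d -> R) (j i : 'I_d) : bool :=
  (v i < v j) || ((v j == v i) && (j < i)%N).

Definition among_largest (R : realType) (d m : nat) (v : 'I_d -> R)
    (i : 'I_d) : bool :=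
  (#|[set j | beats v j i]%SET| < m)%N.

(* Index of the [k]-th largest value ([k >= 1]) in [{v j | j \in S}]. *)
Definition kth_largest (R : realType) (d : nat) (S : {set 'I_d})
    (v : 'I_d -> R) (k : nat) : option 'I_d :=
  [pick j in S | #|[set l in S | beats v l j]%SET|.+1 == k].

(* Rank, from 1 to [d], of [L i] in increasing order; the permutation [tie] is
   the rule by which equal entries are ordered. *)
Definition rank (R : realType) (d : nat) (tie : 'S_d) (L : 'I_d -> R)
    (i : 'I_d) : nat :=
  #|[set j | (L j < L i) || ((L j == L i) && (tie j <= tie i)%N)]%SET|.

(** Loss estimation *)

Inductive estimation (d : nat) : Type := GR | CGR of 'S_d.

Arguments GR {d}.

(* The vector whose [m] largest perturbed entries are inspected when [M_{t,i}]
   is computed: [r'] itself, or [r'] with the entries [i] and [i'] swapped.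
   When [rank tie L i > m] and [1 <= k <= m], the index [i'] exists. *)
Definition resampled (R : realType) (d m : nat) (est : estimation d)
    (L r' : 'I_d -> R) (k : nat) (i : 'I_d) : 'I_d -> R :=
  match est with
  | GR => r'
  | CGR tie =>
      if (rank tie L i <= m)%N then r' else
      let i' := odflt i
        (kth_largest [set j | (rank tie L j <= rank tie L i)%N]%SET r' k) in
      fun j => r' (tperm i i' j)
  end.

Definition correction (R : realType) (d m : nat) (est : estimation d)
    (L : 'I_d -> R) (i : 'I_d) : R :=
  match est with
  | GR => 1
  | CGR tie =>
      if (rank tie L i <= m)%N then 1 else (rank tie L i)%:R / m%:R
  end.

(* The number of trials up to and including the first success; 0 if there is
   no success, which for resampling has probability 0. *)
Definition first_success (p : pred nat) : nat :=
  match pselect (exists s, p s) with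
  | left ex => (ex_minn ex).+1
  | right _ => 0
  end.

Definition inv_prob_estimate (R : realType) (d m : nat) (est : estimation d)
    (eta : R) (L : 'I_d -> R) (r' : nat -> 'I_d -> R) (k : nat -> nat)
    (i : 'I_d) : R :=
  correction m est L i *
  (first_success (fun s =>
     among_largest m
       (fun j => resampled m est L (r' s) (k s) i j - eta * L j) i))%:R.

Definition learning_rate (R : realType) (alpha c : R) (d m t : nat) : R :=
  c / Num.sqrt t.+1%:R * m%:R `^ (2^-1 - alpha^-1) * d%:R `^ (alpha^-1 - 2^-1).

(** The randomness of the game: a private random element of the environment,
    the perturbations [r_{t,i}], the resampled perturbations [r'^(s)_i] of round
    [t], and the ranks [theta^(s)] of round [t] (only used by CGR). *)
Record noise (R : realType) (disp : measure_display) (W : measurableType disp)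
    (P : probability W R) (disp' : measure_display) (E : measurableType disp')
    (d : nat) := Noise {
  seed : {RV P >-> E};
  perturb : nat -> 'I_d -> {RV P >-> R};
  resample : nat -> nat -> 'I_d -> {RV P >-> R};
  theta : nat -> nat -> {RV P >-> nat}
}.

Inductive source (d : nat) : Type :=
  | Seed
  | Perturb of nat & 'I_d
  | Resample of nat & nat & 'I_d
  | Theta of nat & nat.

Definition used (d : nat) (est : estimation d) (x : source d) : Prop :=
  match x, est with
  | Theta _ _, GR => False
  | _, _ => True
  end.

(* The sigma-algebra generated by one source of randomness *)
Definition source_events (R : realType) (disp : measure_display)
    (W : measurableType disp) (P : probability W R) (disp' : measure_display)
    (E : measurableType disp') (d : nat) (N : noise P E d) (x : source d) :
    set (set W) :=
  match x with
  | Seed => preimage_set_system setT (seed N) measurable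
  | Perturb t i => preimage_set_system setT (perturb N t i) measurable
  | Resample t s i => preimage_set_system setT (resample N t s i) measurable
  | Theta t s => preimage_set_system setT (theta N t s) measurable
  end.

(* Mutual independence of the families of events [F x], for [x] in [D] *)
Definition mutually_independent (R : realType) (disp : measure_display)
    (W : measurableType disp) (P : probability W R) (I : Type)
    (D : I -> Prop) (F : I -> set (set W)) : Prop :=
  forall (n : nat) (f : 'I_n -> I) (A : 'I_n -> set W),
    injective f -> (forall k, D (f k)) -> (forall k, F (f k) (A k)) ->
    P (\bigcap_k A k) = (\prod_(k < n) P (A k))%E.

Definition noise_law (R : realType) (disp : measure_display)
    (W : measurableType disp) (P : probability W R) (disp' : measure_display)
    (E : measurableType disp') (d m : nat) (D : law_family) (alpha : R)
    (est : estimation d) (N : noise P E d) : Prop :=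
  [/\ mutually_independent P (used est) (source_events N),
      forall t i, has_law D alpha (perturb N t i),
      forall t s i, has_law D alpha (resample N t s i) &
      (exists tie, est = CGR tie) -> forall t s k, (1 <= k <= m)%N ->
        P (theta N t s @^-1` [set k]) = (m%:R^-1)%:E].

(** The FTPL policy, run against the losses [loss t w i] (round, outcome,
    coordinate) *)

Definition ftpl_choice (R : realType) (disp : measure_display)
    (W : measurableType disp) (P : probability W R) (disp' : measure_display)
    (E : measurableType disp') (d m : nat) (eta : nat -> R) (N : noise P E d)
    (t : nat) (w : W) (L : 'I_d -> R) : {set 'I_d} :=
  argmin_action m (fun i => eta t * L i - perturb N t i w).

Fixpoint ftpl_Lhat (R : realType) (disp : measure_display)
    (W : measurableType disp) (P : probability W R) (disp' : measure_display)
    (E : measurableType disp') (d m : nat) (eta : nat -> R)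
    (est : estimation d) (N : noise P E d) (loss : nat -> W -> 'I_d -> R)
    (t : nat) (w : W) : 'I_d -> R :=
  match t with
  | 0 => fun=> 0
  | t'.+1 => fun i =>
      let L := ftpl_Lhat m eta est N loss t' w in
      L i + (i \in ftpl_choice m eta N t' w L)%:R * loss t' w i *
            inv_prob_estimate m est (eta t') L
              (fun s j => resample N t' s j w) (fun s => theta N t' s w) i
  end.

Definition ftpl_action (R : realType) (disp : measure_display)
    (W : measurableType disp) (P : probability W R) (disp' : measure_display)
    (E : measurableType disp') (d m : nat) (eta : nat -> R)
    (est : estimation d) (N : noise P E d) (loss : nat -> W -> 'I_d -> R)
    (t : nat) (w : W) : {set 'I_d} :=
  ftpl_choice m eta N t w (ftpl_Lhat m eta est N loss t w).

(** Adversaries and regret *)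

(* The sigma-algebra generated by the private randomness of the environment and
   by the pairs [(loss s, act s)] for [s < t]. *)
Definition past_events (R : realType) (disp : measure_display)
    (W : measurableType disp) (d : nat) (S : set (set W))
    (loss : nat -> W -> 'I_d -> R) (act : nat -> W -> {set 'I_d}) (t : nat) :
    set (set W) :=
  <<s [set A | [\/ S A,
        exists s i, (s < t)%N /\
          preimage_set_system setT (fun w => loss s w i) measurable A |
        exists s a, (s < t)%N /\ A = [set w | act s w = a]]] >>.

Definition adversarial (R : realType) (disp : measure_display)
    (W : measurableType disp) (d : nat) (S : set (set W))
    (loss : nat -> W -> 'I_d -> R) (act : nat -> W -> {set 'I_d}) : Prop :=
  (forall t w i, 0 <= loss t w i <= 1) /\
  (forall t i, preimage_set_system setT (fun w => loss t w i) measurable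
     `<=` past_events S loss act t).

Definition best_action (R : realType) (disp : measure_display)
    (W : measurableType disp) (P : probability W R) (d m T : nat)
    (loss : nat -> W -> 'I_d -> R) (astar : {set 'I_d}) : Prop :=
  #|astar| = m /\
  forall a : {set 'I_d}, #|a| = m ->
    ('E_P[fun w => (\sum_(t < T) dot (loss t w) astar)%R] <=
     'E_P[fun w => (\sum_(t < T) dot (loss t w) a)%R])%E.

Definition pseudo_regret (R : realType) (disp : measure_display)
    (W : measurableType disp) (P : probability W R) (d T : nat)
    (loss : nat -> W -> 'I_d -> R) (act : nat -> W -> {set 'I_d})
    (astar : {set 'I_d}) : \bar R :=
  'E_P[fun w => (\sum_(t < T) (dot (loss t w) (act t w) -
                               dot (loss t w) astar))%R]%E.

(* Main.v *)
(** Write [phi_i(l)] for the probability that [i] is among the [m] largest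
    entries of [r - l].  A geometric number of trials with success probability
    [w] has mean [1 / w] and second moment at most [2 / w ^ 2]; under CGR,
    exchangeability makes the success probability [w] times [m / sigma_i].  In
    both cases the loss estimates are unbiased, with second moment at most
    [2 / w].

    The regret is then bounded by a penalty plus a stability term.  Running
    be-the-leader with one fresh perturbation [v], for each fixed value of [v],
    gives the penalty [E (max_a <v, a>) / eta_T <= K m^(1 - 1/alpha)
    d^(1/alpha) / eta_T].  The stability term comes from the bound
    [phi_i(l) - phi_i(l + h e_i) <= 3 C h (m / sigma_i)^(1/alpha) phi_i(l)]:
    its factor [phi_i] cancels the [1 / w] of the second moment, and
    [sum_i (m / sigma_i)^(1/alpha)] is at most a constant times
    [m^(1/alpha) d^(1 - 1/alpha)].

    For this bound, let [Q] be the conditional probability, given the other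
    perturbations, that [i] is selected: [Q = 1 - F(y)] for a random threshold
    [y].  From [F(y + h) - F(y) <= C h (1 - F(y))^(1 + 1/alpha)] the decrease of
    [phi_i] is at most [C h E (Q^(1 + 1/alpha))], and since [phi_i = E Q] it is
    enough, by concavity of the power, that [E (Q^2) <= 2 (m / sigma_i) E Q] when
    [sigma_i > m].  Now [E (Q^2) / 2] is at most [E (G(r_i) (1 - F(r_i)))], where
    [G(x)] is the probability that fewer than [m] other arms beat [i] when
    [r_i = x].  Giving the [sigma_i - 1] arms ahead of [i] the loss of [i], and
    discarding the others, changes [G] by a monotone factor: [F] is log-concave,
    and so are the coefficients of products of linear polynomials with
    nonnegative coefficients.  By Chebyshev's association inequality it can only
    increase the ratio of [E (G(r_i) (1 - F(r_i)))] to [E (G(r_i))].  The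
    [sigma_i] arms are then i.i.d. and the two means are Beta integrals. *)

Require Import Defs.
From HB Require Import structures.
From mathcomp Require Import all_boot all_order all_algebra perm.
From mathcomp Require Import all_classical all_reals all_analysis.
From mathcomp Require Import measurable_realfun ring lra zify.
Set Implicit Arguments.
Unset Strict Implicit.
Unset Printing Implicit Defensive.
Import Order.TTheory GRing.Theory Num.Theory.
Import numFieldNormedType.Exports.
Local Open Scope classical_set_scope.
Local Open Scope ring_scope.

(** * Order statistics and be-the-leader *)

(** The adversary is adaptive, so the estimated losses are random and entangled with the true ones.
    Time is separated by sigma-algebras: what is known before round [t] depends on the sources of
    smaller index, the noise of round [t] is independent of it, and a conditional expectation
    becomes an integral over the current noise with the past frozen. The selection probability is
    therefore a deterministic function [phi] of the scaled losses, defined with the perturbation of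
    round 0 as a reference copy. The same copy is the fresh perturbation of be-the-leader: it is
    integrated with the outcome of the game held fixed. A one-arm stability bound is enough because,
    over a round, the increases of the other losses can only help arm [i]. The rank factor brings
    the stability sum down from order [d] to order [m^(1/alpha) d^(1 - 1/alpha)]; the learning rate
    turns this and the penalty into [sqrt (m d T)]. [F] vanishes near 0 and with it the ratios to be
    compared, so likelihood ratios appear in cross-multiplied form, along with plain inequalities
    that keep them transitive. *)

Section Selection.
Context {R : realType} {d : nat}.
Implicit Types (v x y L : 'I_d -> R) (i j k : 'I_d) (m : nat).

Lemma beatsxx v i : beats v i i = false.
Proof. by rewrite /beats ltxx eqxx ltnn. Qed.

Lemma beats_trans v : transitive (beats v).
Proof.
move=> j i k; rewrite /beats => /orP[ij|/andP[/eqP ij lij]] /orP[jk|/andP[/eqP jk ljk]].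
- by rewrite (lt_trans jk ij).
- by rewrite -jk ij.
- by rewrite ij jk.
- by rewrite ij jk eqxx (ltn_trans lij ljk) orbT.
Qed.

Lemma beats_total v i j : i != j -> beats v i j || beats v j i.
Proof.
rewrite /beats => ij; case: (ltgtP (v i) (v j)) => //= _.
by rewrite -neq_ltn.
Qed.

Lemma beats_ge v i j : beats v i j -> v j <= v i.
Proof. by move=> /orP[/ltW//|/andP[/eqP ->]]. Qed.

Definition nbeat v i := #|[set j | beats v j i]%SET|.

Lemma nbeat_lt v i j : beats v j i -> (nbeat v j < nbeat v i)%N.
Proof.
move=> ji; apply: proper_card; apply/properP; split.
  by apply/fintype.subsetP => k; rewrite !inE => /beats_trans; apply.
by exists j; rewrite inE ?ji// beatsxx.
Qed.

Lemma nbeat_inj v : injective (nbeat v).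
Proof.
move=> i j ij; apply/eqP/negPn/negP => /(beats_total v)/orP[]/nbeat_lt;
by rewrite ij ltnn.
Qed.

Lemma nbeat_ltd v i : (nbeat v i < d)%N.
Proof.
rewrite -[X in (_ < X)%N]card_ord; apply: proper_card; apply/properP; split.
  by apply/fintype.subsetP => k.
by exists i; rewrite // inE beatsxx.
Qed.

Lemma beats_nbeat v i j : beats v i j = (nbeat v i < nbeat v j)%N.
Proof.
apply/idP/idP => [|ij]; first exact: nbeat_lt.
have : i != j by apply: contraTneq ij => ->; rewrite ltnn.
move=> /(beats_total v)/orP[//|/nbeat_lt ji].
by have := ltn_trans ij ji; rewrite ltnn.
Qed.

Definition topset m v : {set 'I_d} := [set i | among_largest m v i]%SET.

Lemma card_lt_inj (n : nat) (f : 'I_d -> nat) : injective f ->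
  (forall i, (f i < d)%N) -> (n <= d)%N -> #|[set i | (f i < n)%N]%SET| = n.
Proof.
move=> finj fd nd.
pose g i : 'I_d := Ordinal (fd i).
have ginj : injective g by move=> i j /(congr1 val)/= /finj.
have -> : [set i | (f i < n)%N]%SET = (g @^-1: [set k : 'I_d | (k < n)%N])%SET.
  by apply/setP => i; rewrite !inE.
rewrite on_card_preimset; last exact/onW_bij/injF_bij.
rewrite -sum1_card (eq_bigl (fun k : 'I_d => (k < n)%N)); last by move=> k; rewrite inE.
by rewrite -(big_ord_widen d (fun=> 1%N))// sum1_card card_ord.
Qed.

Lemma card_topset m v : (m <= d)%N -> #|topset m v| = m.
Proof.
move=> md; apply: card_lt_inj => //; [exact: nbeat_inj|exact: nbeat_ltd].
Qed.

Lemma topset_beats m v i j :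
  i \in topset m v -> j \notin topset m v -> beats v i j.
Proof.
rewrite !inE /among_largest -!/(nbeat _ _) -leqNgt beats_nbeat => im.
exact: leq_trans.
Qed.

Lemma ler_sum_sep v (A B : {set 'I_d}) : #|A| = #|B| ->
  (forall i j, i \in A -> j \in B -> v j <= v i) -> dot v B <= dot v A.
Proof.
move=> AB vAB; have [A0|[i0 i0A]] := set_0Vmem A.
  move: AB; rewrite A0 cards0 => /esym/eqP; rewrite cards_eq0 => /eqP ->.
  by rewrite /dot big_set0.
case: (arg_minP v i0A) => i iA imin.
rewrite /dot (@le_trans _ _ (\sum_(j in B) v i))//.
  by apply: ler_sum => j; apply: vAB.
by rewrite sumr_const -AB -sumr_const; apply: ler_sum => j /imin.
Qed.

Lemma ltr_sum_sep v (A B : {set 'I_d}) : #|A| = #|B| -> A != finset.set0 ->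
  (forall i j, i \in A -> j \in B -> v j < v i) -> dot v B < dot v A.
Proof.
move=> AB /set0Pn[i0 i0A] vAB.
case: (arg_minP v i0A) => i iA imin.
rewrite /dot (@lt_le_trans _ _ (\sum_(j in B) v i))//; last first.
  by rewrite sumr_const -AB -sumr_const; apply: ler_sum => j /imin.
apply: ltr_sum => [|j]; last exact: vAB.
have : (0 < #|B|)%N by rewrite -AB; apply/card_gt0P; exists i0.
by move=> /card_gt0P[j jB]; apply/hasP; exists j; rewrite ?mem_index_enum.
Qed.

Lemma dot_setID v (A B : {set 'I_d}) :
  dot v A = dot v (A :&: B) + dot v (A :\: B).
Proof. by rewrite /dot (big_setID B). Qed.

Lemma cards_setD_eq (A B : {set 'I_d}) : #|A| = #|B| -> #|A :\: B| = #|B :\: A|.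
Proof. by move=> AB; rewrite !cardsD AB finset.setIC. Qed.

Lemma dot_topset m v (b : {set 'I_d}) : (m <= d)%N -> #|b| = m ->
  dot v b <= dot v (topset m v).
Proof.
move=> md bm; have tb : #|topset m v| = #|b| by rewrite card_topset.
rewrite (dot_setID v b (topset m v)) (dot_setID v (topset m v) b) finset.setIC.
rewrite lerD2l; apply: ler_sum_sep => [|i j]; first exact: cards_setD_eq.
by rewrite !finset.in_setD => /andP[_ it] /andP[jt _]; apply/beats_ge/(topset_beats it).
Qed.

Lemma dot_topset_lt m v (b : {set 'I_d}) : (m <= d)%N -> #|b| = m ->
  injective v -> b != topset m v -> dot v b < dot v (topset m v).
Proof.
move=> md bm vinj bt; have tb : #|topset m v| = #|b| by rewrite card_topset.
rewrite (dot_setID v b (topset m v)) (dot_setID v (topset m v) b) finset.setIC.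
rewrite ltrD2l; apply: ltr_sum_sep => [||i j]; first exact: cards_setD_eq.
  apply: contraNneq bt => /eqP; rewrite finset.setD_eq0 => tb'.
  by rewrite eq_sym eqEcard tb' tb leqnn.
rewrite !finset.in_setD => /andP[_ it] /andP[jt _].
rewrite lt_neqAle (beats_ge (topset_beats it jt)) andbT.
by apply: contraNneq jt => /vinj ->.
Qed.

(** Distinct entries make the top set the unique minimiser, so the choice that [arg min] makes among
    equals does not matter. *)
Lemma argmin_actionE m u x : (m <= d)%N -> (forall i, u i = - x i) ->
  injective x -> argmin_action m u = topset m x.
Proof.
move=> md ux xinj; rewrite /argmin_action.
have dotN a : dot u a = - dot x a.
  by rewrite /dot -sumrN; apply: eq_bigr => i _; rewrite ux.
case: arg_minP => [|a /eqP am amin].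
  by apply/eqP; apply: card_lt_inj => //; exact: val_inj.
apply/eqP/negPn/negP => /(dot_topset_lt md am xinj).
have := amin _ (introT eqP (card_topset x md)).
by rewrite !dotN lerN2 => /le_lt_trans /[apply]; rewrite ltxx.
Qed.

Lemma among_largest_mono m x y i : y i = x i -> (forall j, j != i -> y j <= x j) ->
  among_largest m x i -> among_largest m y i.
Proof.
move=> yi yx; apply: leq_trans; rewrite ltnS; apply/subset_leq_card/fintype.subsetP => j.
rewrite !inE /beats yi => /orP[yj|/andP[/eqP yj ji]].
  have [ji|ji] := eqVneq j i; first by move: yj; rewrite ji yi ltxx.
  by rewrite (lt_le_trans yj (yx _ ji)).
have [eji|nji] := eqVneq j i; first by move: ji; rewrite eji ltnn.
have := yx _ nji; rewrite yj le_eqVlt => /orP[/eqP <-|->//].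
by rewrite eqxx ji orbT.
Qed.

Lemma among_largest_up m x y i : x i <= y i -> (forall j, j != i -> y j = x j) ->
  among_largest m x i -> among_largest m y i.
Proof.
move=> xyi yx; apply: leq_trans; rewrite ltnS; apply/subset_leq_card/fintype.subsetP => j.
rewrite !inE; have [->|ji] := eqVneq j i; first by rewrite beatsxx.
rewrite /beats (yx j)// => /orP[yj|/andP[/eqP yj lji]].
  by rewrite (le_lt_trans xyi yj).
by have := xyi; rewrite -yj le_eqVlt => /orP[/eqP ->|->//]; rewrite eqxx lji orbT.
Qed.

(** * Ranks of the losses and order statistics inside a subset *)

Section Rank.
Variables (tie : 'S_d) (L : 'I_d -> R).

Definition rank_le i j := (L i < L j) || ((L i == L j) && (tie i <= tie j)%N).

Lemma rank_lexx i : rank_le i i.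
Proof. by rewrite /rank_le eqxx leqnn orbT. Qed.

Lemma rank_le_trans : transitive rank_le.
Proof.
move=> j i k; rewrite /rank_le => /orP[ij|/andP[/eqP ij lij]] /orP[jk|/andP[/eqP jk ljk]].
- by rewrite (lt_trans ij jk).
- by rewrite -jk ij.
- by rewrite ij jk.
- by rewrite ij jk eqxx (leq_trans lij ljk) orbT.
Qed.

Lemma rank_le_total i j : rank_le i j || rank_le j i.
Proof. by rewrite /rank_le; case: (ltgtP (L i) (L j)) => //= _; exact: leq_total. Qed.

Lemma rank_le_anti i j : rank_le i j -> rank_le j i -> i = j.
Proof.
rewrite /rank_le; case: (ltgtP (L i) (L j)) => //= _ ij ji.
by apply: (@perm_inj _ tie); apply: val_inj; apply: anti_leq; rewrite ij.
Qed.

Lemma rankE i j : (rank tie L i <= rank tie L j)%N = rank_le i j.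
Proof.
have rle k l : rank_le k l -> (rank tie L k <= rank tie L l)%N.
  move=> kl; apply/subset_leq_card/fintype.subsetP => n; rewrite !inE.
  by move=> /rank_le_trans; apply.
apply/idP/idP => [|]; last exact: rle.
apply: contraTT => nij; have ji : rank_le j i by have := rank_le_total i j; rewrite (negbTE nij).
rewrite -ltnNge; apply: proper_card; apply/properP; split.
  by apply/fintype.subsetP => n; rewrite !inE => /rank_le_trans; apply.
by exists i; rewrite inE; [exact: rank_lexx|exact: nij].
Qed.

Lemma rank_inj : injective (rank tie L).
Proof. by move=> i j ij; apply: rank_le_anti; rewrite -rankE ij. Qed.

Definition lower_arms i := [set j | (rank tie L j <= rank tie L i)%N]%SET.

Lemma lower_armsE i j : (j \in lower_arms i) = rank_le j i.
Proof. by rewrite inE rankE. Qed.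

Lemma lower_armsxx i : i \in lower_arms i.
Proof. by rewrite inE. Qed.

Lemma lower_arms_le i j : j \in lower_arms i -> L j <= L i.
Proof. by rewrite lower_armsE => /orP[/ltW|/andP[/eqP->]]. Qed.

Lemma card_lower_arms i : #|lower_arms i| = rank tie L i.
Proof. by apply: eq_card => j; rewrite lower_armsE inE. Qed.

Lemma rank_gt0 i : (0 < rank tie L i)%N.
Proof. by rewrite -card_lower_arms; apply/card_gt0P; exists i; exact: lower_armsxx. Qed.

Lemma rank_led i : (rank tie L i <= d)%N.
Proof. by rewrite -card_lower_arms -[X in (_ <= X)%N]card_ord max_card. Qed.

End Rank.

Section KthLargest.
Variable S : {set 'I_d}.

Definition nbeat_in v i := #|[set l in S | beats v l i]%SET|.

Lemma nbeat_in_lt v i j : j \in S -> beats v j i -> (nbeat_in v j < nbeat_in v i)%N.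
Proof.
move=> jS ji; apply: proper_card; apply/properP; split.
  by apply/fintype.subsetP => k; rewrite !inE => /andP[->]/= /beats_trans; apply.
by exists j; rewrite inE ?jS ?ji// beatsxx andbF.
Qed.

Lemma nbeat_in_inj v i j : i \in S -> j \in S -> nbeat_in v i = nbeat_in v j -> i = j.
Proof.
move=> iS jS ij; apply/eqP/negPn/negP => /(beats_total v)/orP[]/nbeat_in_lt;
by rewrite ij ltnn => H; have := H ltac:(assumption).
Qed.

Lemma kth_largestP v n i : kth_largest S v n = Some i <->
  i \in S /\ (nbeat_in v i).+1 = n.
Proof.
rewrite /kth_largest; case: pickP => [j /andP[jS /eqP jn]|none]; split.
- by move=> [<-]; split.
- move=> [iS Hn]; congr Some; apply: (@nbeat_in_inj v) => //.
  by apply: succn_inj; rewrite Hn.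
- by [].
- by rewrite /nbeat_in => -[iS Hn]; have := none i; rewrite iS Hn eqxx.
Qed.

Lemma nbeat_in_ltS v i : i \in S -> (nbeat_in v i < #|S|)%N.
Proof.
move=> iS; apply: proper_card; apply/properP; split.
  by apply/fintype.subsetP => j; rewrite inE => /andP[].
by exists i; rewrite // inE beatsxx andbF.
Qed.

Lemma kth_largest_ex v n : (0 < n <= #|S|)%N -> exists2 i, i \in S & kth_largest S v n = Some i.
Proof.
move=> /andP[n0 nS].
have [i iS Hi] : exists2 i, i \in S & nbeat_in v i = n.-1.
  (* Counting beaters injects [S] into ['I_#|S|]; by cardinality the map is onto, so every position
     is attained. *)
  pose f (x : {i | i \in S}) : 'I_#|S| := Ordinal (nbeat_in_ltS v (valP x)).
  have finj : injective f.
    move=> [a aS] [b bS] /(congr1 val)/= /(nbeat_in_inj aS bS) ab.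
    exact: val_inj.
  have nlt : (n.-1 < #|S|)%N by rewrite prednK.
  have cardE : #|{: {i | i \in S}}| = #|'I_#|S| |.
    by rewrite card_ord card_sig; apply: eq_card => i; rewrite !inE.
  have [g fg gf] := inj_card_bij finj (eq_leq (esym cardE)).
  exists (val (g (Ordinal nlt))); first exact: (valP (g _)).
  by have /(congr1 val) := gf (Ordinal nlt).
by exists i => //; apply/kth_largestP; split; rewrite // Hi prednK.
Qed.

End KthLargest.

(** A transposition inside [S] carries positions along. Injectivity excludes ties, whose resolution
    by index is not invariant under permutations. *)
Lemma nbeat_in_tperm (S : {set 'I_d}) v i j : injective v -> i \in S -> j \in S ->
  nbeat_in S (fun l => v (tperm i j l)) j = nbeat_in S v i.
Proof.
move=> vinj iS jS; rewrite /nbeat_in.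
rewrite -(card_imset _ (@perm_inj _ (tperm i j))); apply: eq_card => l.
have beatsE (w : 'I_d -> R) (a b : 'I_d) : injective w -> beats w a b = (w b < w a).
  move=> winj; rewrite /beats; case: (ltgtP (w b) (w a)) => //= /winj ->.
  by rewrite ltnn.
have inS a : (tperm i j a \in S) = (a \in S) by case: tpermP => // ->; rewrite iS jS.
rewrite -[l in LHS](tpermK i j) mem_imset; last exact: perm_inj.
rewrite !inE inS beatsE; last by move=> a b /vinj /perm_inj.
by rewrite beatsE// tpermR tpermK.
Qed.

Lemma dotD v x (a : {set 'I_d}) : dot (fun i => v i + x i) a = dot v a + dot x a.
Proof. exact: big_split. Qed.

Lemma dotB v x (a : {set 'I_d}) : dot (fun i => v i - x i) a = dot v a - dot x a.
Proof. by rewrite /dot sumrB. Qed.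

Lemma dotZ (c : R) v (a : {set 'I_d}) : dot (fun i => c * v i) a = c * dot v a.
Proof. by rewrite /dot mulr_sumr. Qed.

Lemma dot0 (a : {set 'I_d}) : dot (fun=> 0 : R) a = 0.
Proof. exact: big1. Qed.

(* The leader at the end of each round is played with one and the same
   perturbation [v], which only has to be paid for once, at the last rate. *)
Lemma be_the_leader m (L lh : nat -> 'I_d -> R) (eta : nat -> R) v (B : R)
    (T : nat) (a : {set 'I_d}) :
  (m <= d)%N -> (forall t i, L t.+1 i = L t i + lh t i) -> L 0%N = (fun=> 0) ->
  (forall t, 0 < eta t) -> (forall t, eta t.+1 <= eta t) ->
  (forall b : {set 'I_d}, #|b| = m -> dot v b <= B) -> #|a| = m ->
  \sum_(t < T.+1) dot (lh t) (topset m (fun i => v i - eta t * L t.+1 i)) <=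
  \sum_(t < T.+1) dot (lh t) a + (B - dot v a) / eta T.
Proof.
move=> md LS L0 eta0 etaS vB am.
pose y t := topset m (fun i => v i - eta t * L t.+1 i).
have dotLS t b : dot (L t.+1) b = dot (L t) b + dot (lh t) b.
  by rewrite -dotD; apply: eq_bigr => i _.
have -> : \sum_(t < T.+1) dot (lh t) a = dot (L T.+1) a.
  elim: T => [|n IH]; last by rewrite big_ord_recr/= IH -dotLS.
  by rewrite big_ord1 dotLS L0 dot0 add0r.
(* Optimality of the top set for [v - eta t * L t.+1], divided by [eta t]; the constant [B] makes
   the perturbation part nonnegative. *)
have leader t (b : {set 'I_d}) : #|b| = m ->
    dot (L t.+1) (y t) + (B - dot v (y t)) / eta t <=
    dot (L t.+1) b + (B - dot v b) / eta t.
  move=> bm; have := dot_topset (fun i => v i - eta t * L t.+1 i) md bm.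
  rewrite !dotB !dotZ -/(y t) => H.
  rewrite -(ler_pM2l (eta0 t)) !mulrDr !mulrA !(mulrAC _ _ (eta t)^-1).
  by rewrite !divff ?gt_eqF// !mul1r; lra.
rewrite -/(y _); elim: T a am => [|n IH] a am.
  rewrite big_ord1 -/(y 0%N) (le_trans _ (leader 0%N a am))//.
  rewrite dotLS L0 dot0 add0r lerDl divr_ge0// ?subr_ge0 ?vB ?card_topset//.
  exact: ltW.
rewrite big_ord_recr/= -/(y n.+1) (le_trans _ (leader n.+1 a am))//.
have ym : #|y n.+1| = m by rewrite card_topset.
rewrite (le_trans (lerD (IH _ ym) (lexx _)))// (dotLS n.+1) addrAC.
(* The induction hypothesis was used with [y n.+1] as comparator; its nonnegative perturbation part
   only grows when the rate [eta n] is replaced by the smaller [eta n.+1]. *)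
rewrite lerD2l ler_wpM2l// ?subr_ge0 ?vB//.
by rewrite lef_pV2 ?posrE.
Qed.

(** Truncation at [tau]: each of the [m] entries of [b] costs at most [tau] plus its excess over
    [tau], and those of [a] at most their negative parts. The bound is free of [a] and [b], and its
    mean is computed arm by arm. *)
Lemma dot_le_excess v m (tau : R) (a b : {set 'I_d}) : 0 <= tau -> #|b| = m ->
  dot v b - dot v a <=
  m%:R * tau + \sum_i Num.max (v i - tau) 0 + \sum_i Num.max (- v i) 0.
Proof.
move=> tau0 bm; apply: lerD.
  rewrite /dot mulr_natl -bm -sumr_const.
  rewrite (@le_trans _ _ (\sum_(i in b) (tau + Num.max (v i - tau) 0)))//.
    by apply: ler_sum => i _; rewrite addrC -lerBlDr le_max lexx.
  rewrite big_split/= lerD2l big_mkcond/=; apply: ler_sum => i _.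
  by case: ifP => // _; rewrite le_max lexx orbT.
rewrite /dot -sumrN big_mkcond/=; apply: ler_sum => i _.
by case: ifP => _; rewrite le_max lexx ?orbT.
Qed.

End Selection.

(** * Likelihood ratios of Poisson binomial coefficients *)

Section LikelihoodRatio.
Context {R : realType}.
Implicit Types (f g : {poly R}) (a b c e : nat).

(* For [f' = f] this is log-concavity of the coefficients; with [a <= b = c]
   it says that the ratio of the coefficients of [f'] and [f] is
   nonincreasing. *)
Definition lr_le f' f := forall a b c e, (a + b = c + e)%N -> (a <= c)%N ->
  (b <= c)%N -> f'`_c * f`_e <= f'`_a * f`_b.

Definition nonneg_coefs f := forall k, 0 <= f`_k.

Lemma coef_linM (H p : R) f k :
  ((H%:P + p *: 'X) * f)`_k = H * f`_k + p * (if k is k'.+1 then f`_k' else 0).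
Proof.
rewrite mulrDl coefD mul_polyC coefZ -scalerAl coefZ -commr_polyX coefMX.
by case: k.
Qed.

Lemma nonneg_linM (H p : R) f : 0 <= H -> 0 <= p -> nonneg_coefs f ->
  nonneg_coefs ((H%:P + p *: 'X) * f).
Proof.
by move=> H0 p0 f0 k; rewrite coef_linM addr_ge0// mulr_ge0//; case: k.
Qed.

(** The hypothesis [H * p' <= H' * p] compares the odds of the two new factors. In the expanded
    difference, the terms weighted by [H' * H], [p' * p] and the surplus [H' * p - H * p'] are
    signed one by one; the two mixed differences weighted by [H * p'] are treated together. *)
Lemma lr_le_linM (H p H' p' : R) f f' :
  0 <= H -> 0 <= p -> 0 <= H' -> 0 <= p' -> H * p' <= H' * p ->
  nonneg_coefs f -> nonneg_coefs f' -> lr_le f' f ->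
  lr_le ((H'%:P + p' *: 'X) * f') ((H%:P + p *: 'X) * f).
Proof.
move=> H0 p0 H'0 p'0 HH' f0 f'0 ff' a b c e abce ac bc.
rewrite !coef_linM.
(* The coefficient of index [k - 1], null for [k = 0]. *)
pose F (g : {poly R}) (k : nat) := if k is k'.+1 then g`_k' else 0.
have Fge0 g : nonneg_coefs g -> forall k, 0 <= F g k by move=> g0 [].
have FS x y z w : (x + y = z + w)%N -> (x <= z)%N -> (y <= z)%N ->
    F f' z * F f w <= F f' x * F f y.
  case: z => [|z]; first by case: x => //; case: y => //= _ _ _; rewrite mul0r.
  case: w => [|w] Hs; first by rewrite mulr0 mulr_ge0 ?Fge0.
  case: x Hs => [|x] Hs; first by lia.
  case: y Hs => [|y] Hs; first by lia.
  by move=> xz yz; apply: ff'; lia.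
have Fl x y z w : (x + y = z + w)%N -> (x < z)%N -> (y < z)%N ->
    F f' z * f`_w <= F f' x * f`_y.
  move=> Hs; case: z Hs => // z Hs xz yz.
  case: x Hs xz => [|x] Hs xz; first by lia.
  by apply: ff'; lia.
have Fr x y z w : (x + y = z + w)%N -> (x <= z)%N -> (y <= z.+1)%N ->
    f'`_z * F f w <= f'`_x * F f y.
  move=> Hs; case: w Hs => [|w] Hs; first by rewrite mulr0 mulr_ge0 ?Fge0.
  case: y Hs => [|y] Hs; first by lia.
  by move=> xz yz; apply: ff'; lia.
rewrite -!/(F _ _) -subr_ge0.
have -> : (H' * f'`_a + p' * F f' a) * (H * f`_b + p * F f b) -
   (H' * f'`_c + p' * F f' c) * (H * f`_e + p * F f e) =
   H' * H * (f'`_a * f`_b - f'`_c * f`_e) +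
   p' * p * (F f' a * F f b - F f' c * F f e) +
   (H' * p - H * p') * (f'`_a * F f b - f'`_c * F f e) +
   H * p' * ((f'`_a * F f b - F f' c * f`_e) + (F f' a * f`_b - f'`_c * F f e)).
  by ring.
rewrite !addr_ge0// ?mulr_ge0 ?subr_ge0 ?ff' ?FS ?Fr//; try by lia.
(* For [a = c] the two mixed differences cancel; for [b = c] each is nonnegative as paired here;
   otherwise they are nonnegative in the pairing that exchanges the subtracted terms. *)
have [ac'|ac'] := eqVneq a c.
  have be : b = e by lia.
  by subst; lra.
have [bc'|bc'] := eqVneq b c.
  have ae : a = e by lia.
  subst; rewrite addr_ge0 ?subr_ge0//.
    case: c {FS Fr abce bc} Fl ac ac' => [|c] Fl ac ac' /=; first by lia.
    by apply: ff'; lia.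
  case: e ac' ac {abce} => [|e] ac' ac; first by rewrite mul0r mulr0.
  by rewrite /=; apply: ff'; lia.
have := Fl a b c e abce; have := Fr a b c e abce.
by rewrite !ltn_neqAle ac' bc' ac bc (leq_trans bc (leqnSn c)) => /(_ isT isT) ? /(_ isT isT) ?; lra.
Qed.

Lemma lr_le1 : lr_le 1 1.
Proof.
move=> a b c e abce ac bc; rewrite !coef1.
have [c0|c0] := eqVneq c 0%N; last by rewrite mul0r mulr_ge0 ?ler0n.
have [-> -> ->] : [/\ a = 0%N, b = 0%N & e = 0%N] by split; lia.
by rewrite eqxx mulr1.
Qed.

(** Generating polynomial of a number of successes. The weights [p j] are kept apart from [1 - H j]
    so that all odds can be rescaled by a common factor. *)
Definition trials (I : finType) (J : {set I}) (H p : I -> R) : {poly R} :=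
  \prod_(j in J) ((H j)%:P + p j *: 'X).

Lemma trials_setU1 (I : finType) (J : {set I}) (H p : I -> R) i : i \notin J ->
  trials (i |: J) H p = ((H i)%:P + p i *: 'X) * trials J H p.
Proof. by move=> iJ; rewrite /trials big_setU1. Qed.

Section Trials.
Context {I : finType}.
Implicit Types (J S A : {set I}) (H p : I -> R).

Lemma trials_ge0 J H p : (forall j, j \in J -> 0 <= H j) ->
  (forall j, j \in J -> 0 <= p j) -> nonneg_coefs (trials J H p).
Proof.
move=> H0 p0; rewrite /trials; elim/big_ind: _ => //.
- by move=> k; rewrite coef1 ler0n.
- by move=> f g f0 g0 k; rewrite coefM sumr_ge0// => j _; rewrite mulr_ge0.
- move=> j jJ; have -> : (H j)%:P + p j *: 'X = ((H j)%:P + p j *: 'X) * 1 by rewrite mulr1.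
  by apply: nonneg_linM; rewrite ?H0 ?p0// => k; rewrite coef1 ler0n.
Qed.

Lemma trials_lr_le J H p H' p' :
  (forall j, j \in J -> [/\ 0 <= H j, 0 <= p j, 0 <= H' j, 0 <= p' j &
     H j * p' j <= H' j * p j]) ->
  lr_le (trials J H' p') (trials J H p).
Proof.
move: {2}_.+1 (ltnSn #|J|) => n; elim: n J => // n IH J Jn HJ.
have [->|[i iJ]] := set_0Vmem J.
  by rewrite /trials !big_set0; exact: lr_le1.
have [H0 p0 H'0 p'0 Hp] := HJ i iJ.
rewrite -(finset.setD1K iJ) !trials_setU1 ?finset.setD11//.
have HJ' j : j \in (J :\ i)%SET -> j \in J by rewrite !inE => /andP[].
apply: lr_le_linM => //.
- by apply: trials_ge0 => j /HJ'/HJ[].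
- by apply: trials_ge0 => j /HJ'/HJ[].
- apply: IH => [|j /HJ' /HJ//].
  by move: Jn; rewrite (cardsD1 i) iJ.
Qed.

Lemma trials_scale J H p (k : R) n :
  (trials J H (fun j => k * p j))`_n = k ^+ n * (trials J H p)`_n.
Proof.
have -> : trials J H (fun j => k * p j) = trials J H p \Po (k *: 'X).
  rewrite /trials -[RHS]/(comp_poly _ _) rmorph_prod/=.
  apply: eq_bigr => j _.
  by rewrite comp_polyD comp_polyC comp_polyZ comp_polyX scalerA mulrC.
rewrite -[trials J H p in LHS]coefK poly_def raddf_sum/= coef_sum.
have -> : \sum_(i < size (trials J H p))
   (((trials J H p)`_i *: 'X^i) \Po (k *: 'X))`_n =
   \sum_(i < size (trials J H p)) if n == i then k ^+ n * (trials J H p)`_n else 0.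
  apply: eq_bigr => i _; rewrite comp_polyZ comp_Xn_poly exprZn !coefZ coefXn.
  case: eqVneq => [->|_]; first by rewrite mulr1 mulrC.
  by rewrite !mulr0.
have [nlt|nge] := ltnP n (size (trials J H p)).
  rewrite (bigD1 (Ordinal nlt))//= eqxx big1 ?addr0// => i.
  by rewrite -val_eqE/= eq_sym => /negbTE ->.
rewrite [(trials J H p)`_n]nth_default// mulr0 big1// => i _.
by case: eqP.
Qed.

(* The [k]-th coefficient of [trials J H p] is the probability of [k] successes
   among independent trials that fail with probability [H j]. *)
Definition few m J H p := \sum_(k < m) (trials J H p)`_k.

Lemma few_setU1 m J H p i : i \notin J ->
  few m.+1 (i |: J) H p = H i * few m.+1 J H p + p i * few m J H p.
Proof.
move=> iJ; rewrite /few trials_setU1// !mulr_sumr.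
rewrite big_ord_recl [in RHS]big_ord_recl -addrA -big_split/=.
rewrite coef_linM mulr0 addr0; congr (_ + _).
by apply: eq_bigr => k _; rewrite coef_linM.
Qed.

Lemma few_ge0 m J H p : (forall j, j \in J -> 0 <= H j) ->
  (forall j, j \in J -> 0 <= p j) -> 0 <= few m J H p.
Proof. by move=> H0 p0; apply: sumr_ge0 => k _; apply: trials_ge0. Qed.

(* If every odds [p j / H j] decreases by a factor [kap >= 1], then so does
   the ratio of [P(N = m)] to [P(N < m)]. *)
Lemma few_ratio m J H p H' p' (kap : R) : 1 <= kap ->
  (forall j, j \in J -> [/\ 0 <= H j, 0 <= p j, 0 <= H' j, 0 <= p' j &
     kap * (H j * p' j) <= H' j * p j]) ->
  kap * (few m J H p * (trials J H' p')`_m) <=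
  few m J H' p' * (trials J H p)`_m.
Proof.
move=> kap1 HJ; have kap0 : 0 < kap by apply: lt_le_trans kap1.
have lr : lr_le (trials J H' (fun j => kap * p' j)) (trials J H p).
  apply: trials_lr_le => j /HJ[? ? ? ? H5]; split => //.
    by rewrite mulr_ge0// ltW.
  by rewrite mulrCA.
have f0 : nonneg_coefs (trials J H p) by apply: trials_ge0 => j /HJ[].
have f'0 : nonneg_coefs (trials J H' p') by apply: trials_ge0 => j /HJ[].
rewrite /few !mulr_suml mulr_sumr; apply: ler_sum => -[k/= km] _.
(* The rescaled polynomial contributes [kap ^+ m] on one side and [kap ^+ k] on the other; since
   [k < m], at least one factor [kap] survives. *)
have := lr k m m k (addnC _ _) (ltnW km) (leqnn m).
rewrite !trials_scale => H1.
rewrite -(ler_pM2l (exprn_gt0 k kap0)) mulrA -exprSr [leRHS]mulrA.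
apply: le_trans H1; rewrite -mulrA [X in _ * X <= _]mulrC ler_wpM2r//.
  by rewrite mulr_ge0.
by rewrite ler_weXn2l.
Qed.

Definition fewH m J H := few m J H (fun j => 1 - H j).

Let prob01 J H := forall j, j \in J -> 0 <= H j <= 1.

Lemma fewH_ge0 m J H : prob01 J H -> 0 <= fewH m J H.
Proof. by move=> H01; apply: few_ge0 => j /H01/andP[]; rewrite ?subr_ge0. Qed.

(** At most [m] successes in all: fewer than [m] outside [i], or exactly [m] outside [i] and a
    failure of [i]. The failure probability of one arm thus enters affinely. *)
Lemma fewH_setU1 m J H i : i \notin J -> fewH m.+1 (i |: J) H =
  fewH m J H + H i * (trials J H (fun j => 1 - H j))`_m.
Proof. by move=> iJ; rewrite /fewH few_setU1// /few big_ord_recr/=; ring. Qed.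

Lemma eq_fewH m J H H' : (forall j, j \in J -> H j = H' j) -> fewH m J H = fewH m J H'.
Proof.
move=> HH'; rewrite /fewH /few.
suff -> : trials J H (fun j => 1 - H j) = trials J H' (fun j => 1 - H' j) by [].
by apply: eq_bigr => j jJ; rewrite HH'.
Qed.

(** Transitivity of a comparison of ratios in crossed form. It would break at [y = 0], where
    [x <= y] forces [x = 0]; this is why the lemmas below carry a plain inequality next to the
    crossed one. *)
Lemma cross_trans (x x' y y' z z' : R) : 0 <= x -> x <= y -> 0 <= x' -> 0 <= z ->
  0 <= z' -> x * y' <= x' * y -> y * z' <= y' * z -> x * z' <= x' * z.
Proof.
move=> x0 xy x'0 z0 z'0 H1 H2; have [y0|y0] := eqVneq y 0.
  have -> : x = 0 by apply/eqP; rewrite eq_le x0 -{1}y0 xy.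
  by rewrite mul0r mulr_ge0.
have yp : 0 < y by rewrite lt_neqAle eq_sym y0 (le_trans x0).
rewrite -(ler_pM2l yp) mulrCA (le_trans (ler_wpM2l x0 H2))//.
by rewrite !mulrA [y * x']mulrC ler_wpM2r.
Qed.

(** [X] is affine in the failure probability of arm [i]. The crossed difference, multiplied by [K],
    splits into a part signed by [few_ratio] with factor [K' / K] and a part signed by
    [K' * H i <= K * H' i]. *)
Lemma fewH_swap1 m J H H' i (K K' : R) : i \notin J ->
  prob01 (i |: J) H -> prob01 (i |: J) H' ->
  0 < K -> K <= K' ->
  (forall j, j \in (i |: J)%SET -> H j <= H' j /\ K' * H j <= K * H' j) ->
  H i <= K ->
  let X h k := fewH m J h + k * (trials J h (fun j => 1 - h j))`_m in
  X H (H i) <= X H K /\ X H (H i) * X H' K' <= X H' (H' i) * X H K.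
Proof.
move=> iJ H01 H'01 K0 KK' HH' HK X.
have JU j : j \in J -> j \in (i |: J)%SET by move=> jJ; rewrite !inE jJ orbT.
have t0 h : prob01 (i |: J) h -> 0 <= (trials J h (fun j => 1 - h j))`_m.
  by move=> h01; apply: trials_ge0 => j /JU/h01/andP[]; rewrite ?subr_ge0.
have b0 h : prob01 (i |: J) h -> 0 <= fewH m J h.
  by move=> h01; apply: fewH_ge0 => j /JU/h01.
have kap1 : 1 <= K' / K by rewrite ler_pdivlMr// mul1r.
have := @few_ratio m J H (fun j => 1 - H j) H' (fun j => 1 - H' j) (K' / K) kap1.
rewrite -!/(fewH _ _ _) => ratio.
have iU : i \in (i |: J)%SET by rewrite !inE eqxx.
have /andP[Hi0 Hi1] := H01 i iU; have /andP[H'i0 H'i1] := H'01 i iU.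
have {}ratio : K' * (fewH m J H * (trials J H' (fun j => 1 - H' j))`_m) <=
   K * (fewH m J H' * (trials J H (fun j => 1 - H j))`_m).
  rewrite -ler_pdivrMl// mulrA [_ * K']mulrC; apply: ratio => j /JU jU.
  have /andP[? ?] := H01 j jU; have /andP[? ?] := H'01 j jU.
  have [? HK'] := HH' j jU; split; rewrite ?subr_ge0// mulrA.
  apply: ler_pM; rewrite ?subr_ge0 ?lerB//.
    by rewrite mulr_ge0// (le_trans ler01).
  by rewrite mulrAC ler_pdivrMr// [H' j * _]mulrC.
have [HHi HKi] := HH' i iU.
move: ratio (t0 _ H01) (t0 _ H'01) (b0 _ H01) (b0 _ H'01); rewrite /X {X}.
set D' := _`_m; set D := _`_m; set b := fewH m J H; set b' := fewH m J H'.
move=> ratio D0 D'0 b0' b'0; split; first by rewrite lerD2l ler_wpM2r.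
rewrite -subr_ge0 -(pmulr_rge0 _ K0).
have -> : K * ((b' + H' i * D') * (b + K * D) - (b + H i * D) * (b' + K' * D')) =
  (K - H i) * (K * (b' * D) - K' * (b * D')) +
  (b * D' + K * (D * D')) * (K * H' i - K' * H i) by ring.
have K0' := ltW K0.
by rewrite addr_ge0// mulr_ge0 ?subr_ge0// addr_ge0 ?mulr_ge0.
Qed.

(** Discarding an arm amounts to letting it fail surely: [fewH_swap1] with [K = K' = 1]. *)
Lemma fewH_drop1 m J H H' i : i \notin J ->
  prob01 (i |: J) H -> prob01 (i |: J) H' ->
  (forall j, j \in (i |: J)%SET -> H j <= H' j) ->
  fewH m.+1 (i |: J) H <= fewH m.+1 J H /\
  fewH m.+1 (i |: J) H * fewH m.+1 J H' <= fewH m.+1 (i |: J) H' * fewH m.+1 J H.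
Proof.
move=> iJ H01 H'01 HH'.
have fewS h : fewH m.+1 J h = fewH m J h + 1 * (trials J h (fun j => 1 - h j))`_m.
  by rewrite mul1r /fewH /few big_ord_recr.
rewrite !fewH_setU1// !fewS; apply: fewH_swap1 => // [j jU|].
  by rewrite !mul1r; split; exact: HH'.
by case/andP: (H01 i (setU11 _ _)).
Qed.

Lemma fewH_drop m J S H H' : S \subset J -> prob01 J H -> prob01 J H' ->
  (forall j, j \in J -> H j <= H' j) ->
  fewH m.+1 J H <= fewH m.+1 S H /\
  fewH m.+1 J H * fewH m.+1 S H' <= fewH m.+1 J H' * fewH m.+1 S H.
Proof.
move: {2}_.+1 (ltnSn #|J :\: S|) => n; elim: n J => // n IH J Jn SJ H01 H'01 HH'.
have [JS|[i]] := set_0Vmem (J :\: S).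
  have -> : J = S by apply/eqP; rewrite finset.eqEsubset SJ -finset.setD_eq0 JS eqxx.
  by rewrite mulrC.
rewrite !inE => /andP[iS iJ].
have HJ' j : j \in (J :\ i)%SET -> j \in J by rewrite !inE => /andP[].
have SJi : S \subset J :\ i by rewrite subsetD1 SJ.
have [] := IH (J :\ i) _ SJi.
- rewrite ltnS in Jn; apply: leq_trans Jn; apply: proper_card; apply/properP; split.
    by apply: finset.setSD; exact: finset.subD1set.
  by exists i; rewrite !inE ?eqxx ?andbF ?iS.
- by move=> j /HJ'/H01.
- by move=> j /HJ'/H'01.
- by move=> j /HJ'/HH'.
move=> le1 cr1.
have iJi : i \notin (J :\ i)%SET by rewrite !inE eqxx.
have [|||le2 cr2] := @fewH_drop1 m (J :\ i) H H' i iJi; rewrite ?finset.setD1K//.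
rewrite finset.setD1K// in le2 cr2.
split; first exact: le_trans le1.
apply: (cross_trans _ le2 _ _ _ cr2 cr1); apply: fewH_ge0 => j.
- exact: H01.
- exact: H'01.
- by move=> /(fintype.subsetP SJ)/H01.
- by move=> /(fintype.subsetP SJ)/H'01.
Qed.

Lemma fewH_swap m S H H' (K K' : R) : prob01 S H -> prob01 S H' ->
  0 < K -> K <= K' -> K' <= 1 ->
  (forall j, j \in S -> [/\ H j <= H' j, K' * H j <= K * H' j & H j <= K]) ->
  fewH m.+1 S H <= fewH m.+1 S (fun=> K) /\
  fewH m.+1 S H * fewH m.+1 S (fun=> K') <= fewH m.+1 S H' * fewH m.+1 S (fun=> K).
Proof.
move=> H01 H'01 K0 KK' K'1 HH'.
(* The arms are exchanged one at a time; those of [A] already have the common value. *)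
pose mix (A : {set I}) (h : I -> R) (k : R) j := if j \in A then k else h j.
suff key (A : {set I}) : A \subset S -> fewH m.+1 S H <= fewH m.+1 S (mix A H K) /\
  fewH m.+1 S H * fewH m.+1 S (mix A H' K') <= fewH m.+1 S H' * fewH m.+1 S (mix A H K).
  have [] := key S (subxx _).
  rewrite (@eq_fewH _ S (mix S H K) (fun=> K)); last by move=> j jS; rewrite /mix jS.
  by rewrite (@eq_fewH _ S (mix S H' K') (fun=> K')); last by move=> j jS; rewrite /mix jS.
have mix01 B h k : prob01 S h -> 0 <= k <= 1 -> prob01 S (mix B h k).
  by move=> h01 k01 j jS; rewrite /mix; case: ifP => // _; exact: h01.
have K01 : 0 <= K <= 1 by rewrite (ltW K0) (le_trans KK').
have K'01 : 0 <= K' <= 1 by rewrite K'1 (le_trans _ KK')// ltW.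
move: {2}_.+1 (ltnSn #|A|) => n; elim: n A => // n IH A An AS.
have [->|[i iA]] := set_0Vmem A.
  rewrite (@eq_fewH _ S (mix _ H K) H); last by move=> j jS; rewrite /mix inE.
  rewrite (@eq_fewH _ S (mix _ H' K') H'); last by move=> j jS; rewrite /mix inE.
  by rewrite mulrC.
have iS := fintype.subsetP AS _ iA.
have [||le1 cr1] := IH (A :\ i).
- by move: An; rewrite (cardsD1 i) iA.
- exact: fintype.subset_trans (finset.subD1set _ _) AS.
set B := A :\ i in le1 cr1.
have iB : i \notin B by rewrite finset.setD11.
have SU : S = (i |: (S :\ i))%SET by rewrite finset.setD1K.
have iSi : i \notin (S :\ i)%SET by rewrite !inE eqxx.
have := @fewH_swap1 m (S :\ i) (mix B H K) (mix B H' K') i K K' iSi.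
rewrite -SU => /(_ (mix01 _ _ _ H01 K01) (mix01 _ _ _ H'01 K'01) K0 KK').
have -> : mix B H K i = H i by rewrite /mix (negbTE iB).
have -> : mix B H' K' i = H' i by rewrite /mix (negbTE iB).
have mixE h k : fewH m.+1 S (mix A h k) = fewH m (S :\ i) (mix B h k) +
    k * (trials (S :\ i) (mix B h k) (fun j => 1 - mix B h k j))`_m.
  have mixAB j : j \in (S :\ i)%SET -> mix A h k j = mix B h k j.
    by rewrite /mix !inE => /andP[-> _].
  have mixi : mix A h k i = k by rewrite /mix iA.
  rewrite {1}SU fewH_setU1 // mixi (eq_fewH _ mixAB).
  suff -> : trials (S :\ i) (mix A h k) (fun j => 1 - mix A h k j) =
    trials (S :\ i) (mix B h k) (fun j => 1 - mix B h k j) by [].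
  by apply: eq_bigr => j jS; rewrite mixAB.
have mixE' h k : fewH m.+1 S (mix B h k) = fewH m (S :\ i) (mix B h k) +
    h i * (trials (S :\ i) (mix B h k) (fun j => 1 - mix B h k j))`_m.
  have mixi : mix B h k i = h i by rewrite /mix (negbTE iB).
  by rewrite {1}SU fewH_setU1// mixi.
move=> /=; rewrite -!mixE -!mixE' => sw.
have [||le2 cr2] := sw.
- move=> j jS; have [? ? ?] := HH' j jS; rewrite /mix; case: ifP => // _.
  by split; rewrite // mulrC.
- by have [] := HH' i iS.
split; first exact: le_trans le2.
apply: (cross_trans _ le1 _ _ _ cr1 cr2); apply: fewH_ge0 => //; exact: mix01.
Qed.

(** The arms outside [S] are dropped, then those of [S] receive a common failure probability;
    [cross_trans] glues the two comparisons. The intended values are [H j = F (x - lam i + lam j)]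
    and [K = F x], with [H'] and [K'] their analogues at a larger [y]. *)
Lemma fewH_cross m J S H H' (K K' : R) : S \subset J ->
  prob01 J H -> prob01 J H' -> (forall j, j \in J -> H j <= H' j) ->
  0 < K -> K <= K' -> K' <= 1 ->
  (forall j, j \in S -> K' * H j <= K * H' j /\ H j <= K) ->
  fewH m.+1 J H * fewH m.+1 S (fun=> K') <= fewH m.+1 J H' * fewH m.+1 S (fun=> K).
Proof.
move=> SJ H01 H'01 HH' K0 KK' K'1 HS.
have SinJ j : j \in S -> j \in J by move/(fintype.subsetP SJ).
have [le1 cr1] := fewH_drop m SJ H01 H'01 HH'.
have [||||||le2 cr2] := @fewH_swap m S H H' K K' => //.
- by move=> j /SinJ/H01.
- by move=> j /SinJ/H'01.
- by move=> j jS; have [? ?] := HS j jS; split => //; exact/HH'/SinJ.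
apply: (cross_trans _ le1 _ _ _ cr1 cr2); apply: fewH_ge0 => j jJ.
- exact: H01.
- exact: H'01.
- by rewrite (ltW K0) (le_trans KK').
- by rewrite K'1 (le_trans _ KK')// ltW.
Qed.

End Trials.

End LikelihoodRatio.

(** * The Frechet and Pareto distributions *)

Section PowerInequalities.
Context {R : realType}.
Implicit Types (a x y h u v : R).

Lemma expRN_le_inv u : 0 < u -> expR (- u) <= u^-1.
Proof.
move=> u0; rewrite expRN lef_pV2 ?posrE ?expR_gt0//.
by rewrite (le_trans _ (expR_ge1Dx u))// lerDr.
Qed.

Lemma expRN_le_inv1 u : 0 <= u -> expR (- u) <= (1 + u)^-1.
Proof.
by move=> u0; rewrite expRN lef_pV2 ?posrE ?expR_gt0 ?expR_ge1Dx// ltr_wpDr.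
Qed.

Lemma expRN_le_inv2 u : 0 < u -> expR (- u) <= 4 / u ^+ 2.
Proof.
move=> u0; rewrite expRN -[leRHS]invrK lef_pV2 ?posrE ?expR_gt0 ?invr_gt0 ?divr_gt0 ?exprn_gt0//.
have -> : (4 / u ^+ 2)^-1 = (u / 2) ^+ 2 by rewrite invf_div expr_div_n; congr (_ / _); ring.
have -> : expR u = expR (u / 2) ^+ 2 by rewrite expr2 -expRD; congr expR; lra.
rewrite ler_pXn2r ?nnegrE ?expR_ge0 ?divr_ge0 ?ltW//.
by rewrite (lt_le_trans _ (expR_ge1Dx _))// ltrDr.
Qed.

Lemma one_powR a : 1 `^ a = 1.
Proof. by rewrite powR1. Qed.

Lemma powR_ge1 a x : 0 <= a -> 1 <= x -> 1 <= x `^ a.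
Proof.
move=> a0 x1; rewrite -[leLHS](one_powR a) ge0_ler_powR// nnegrE//.
exact: le_trans x1.
Qed.

Lemma le0_ger_powR a x y : 0 <= a -> 0 < x -> x <= y -> y `^ (- a) <= x `^ (- a).
Proof.
move=> a0 x0 xy; have y0 : 0 < y by exact: lt_le_trans xy.
by rewrite !powRN lef_pV2 ?posrE ?powR_gt0// ge0_ler_powR// nnegrE ltW.
Qed.

Lemma onem_powRN_le a h : 0 <= a -> 0 <= h -> 1 - (1 + h) `^ (- a) <= a * h.
Proof.
move=> a0 h0; have h1 : 0 < 1 + h by rewrite ltr_wpDr.
rewrite /powR gt_eqF// lerBlDr -lerBlDl (le_trans _ (expR_ge1Dx _))//.
by rewrite lerD2l mulNr lerN2 ler_wpM2l// le_ln1Dx// (lt_le_trans _ h0)// ltrN10.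
Qed.

Lemma powRN_subE a x h : 0 < x -> 0 <= h ->
  x `^ (- a) - (x + h) `^ (- a) = x `^ (- a) * (1 - (1 + h / x) `^ (- a)).
Proof.
move=> x0 h0; rewrite mulrBr mulr1 -powRM ?mulrDr ?mulr1 ?(ltW x0)//.
  by rewrite mulrCA divff ?mulr1// gt_eqF.
by rewrite addr_ge0// divr_ge0// ltW.
Qed.

Lemma powRN_sub_le a x h : 0 <= a -> 0 < x -> 0 <= h ->
  x `^ (- a) - (x + h) `^ (- a) <= a * h * (x `^ (- a) / x).
Proof.
move=> a0 x0 h0; rewrite powRN_subE// mulrCA ler_wpM2l ?powR_ge0//.
by rewrite -mulrA onem_powRN_le// divr_ge0// ltW.
Qed.

(** Convexity of the negative power: both factors in [powRN_subE] decrease with the base. *)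
Lemma powRN_sub_mono a x y h : 0 <= a -> 0 < x -> x <= y -> 0 <= h ->
  y `^ (- a) - (y + h) `^ (- a) <= x `^ (- a) - (x + h) `^ (- a).
Proof.
move=> a0 x0 xy h0; have y0 : 0 < y by exact: lt_le_trans xy.
rewrite !powRN_subE// ler_pM ?powR_ge0 ?le0_ger_powR//.
  have yh : 1 <= 1 + h / y by rewrite lerDl divr_ge0// ltW.
  by rewrite subr_ge0 powRN invf_le1 ?powR_ge1 ?powR_gt0 ?(lt_le_trans ltr01 yh).
have xp : 0 < 1 + h / y by rewrite ltr_wpDr// divr_ge0// ltW.
rewrite lerD2l lerN2 le0_ger_powR// lerD2l ler_wpM2l// lef_pV2 ?posrE//.
Qed.

Lemma powR_le_1D a u : 0 <= a <= 1 -> 0 <= u -> u `^ a <= 1 + u.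
Proof.
move=> /andP[a0 a1] u0; have [u1|u1] := leP u 1.
  rewrite (@le_trans _ _ 1)// ?lerDl//.
  by rewrite -[leRHS](one_powR a) ge0_ler_powR ?nnegrE.
by rewrite (le_trans (ler1_powR (ltW u1) a1))// lerDr.
Qed.

(* Convexity of [exp] between [0] and [ln y]. *)
Lemma powR_le_line b y : 0 <= b <= 1 -> 0 <= y -> y `^ b <= 1 + b * (y - 1).
Proof.
move=> /andP[b0 b1]; rewrite le_eqVlt => /predU1P[<-|y0].
  have [->|bn0] := eqVneq b 0; first by rewrite powRr0 mul0r addr0.
  by rewrite powR0// sub0r mulrN1 subr_ge0.
rewrite {1}/powR gt_eqF//.
have t01 : Itv.spec (@Itv.num_sem R) (Itv.Real `[0%Z, 1%Z]) b.
  by apply/and3P; split; rewrite ?num_real//= in_itv/= b0.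
have := convex_expR (Itv.mk t01) (ln y) 0.
rewrite !convRE /= mulr0 addr0 expR0 lnK ?posrE// mulr1 => /le_trans -> //.
by rewrite /unstable.onem; lra.
Qed.

(** The tangent bound [powR_le_line] at [n / (n + 1)] gives [n^b + b (n + 1)^(b - 1) <= (n + 1)^b],
    which is the induction step. *)
Lemma sum_powRN_le b n : 0 < b <= 1 ->
  \sum_(k < n) k.+1%:R `^ (b - 1) <= n%:R `^ b / b :> R.
Proof.
move=> /andP[b0 b1]; elim: n => [|n IH].
  by rewrite big_ord0 divr_ge0 ?powR_ge0 ?ltW.
rewrite big_ord_recr/= (le_trans (lerD IH (lexx _)))// -(ler_pM2r b0).
rewrite mulrDl !divfK ?gt_eqF//.
have n1 : (0 : R) < n.+1%:R by [].
have -> : (n%:R : R) = n.+1%:R * (n%:R / n.+1%:R) by rewrite mulrCA divff ?mulr1// gt_eqF.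
have -> : n.+1%:R `^ (b - 1) = n.+1%:R `^ b / n.+1%:R :> R.
  by rewrite powRB ?(gt_eqF n1) ?implybT// powRr1.
rewrite powRM ?divr_ge0//.
rewrite (@le_trans _ _ (n.+1%:R `^ b * (1 + b * (n%:R / n.+1%:R - 1)) + n.+1%:R `^ b / n.+1%:R * b))//.
  by rewrite lerD2r ler_wpM2l ?powR_ge0// powR_le_line ?divr_ge0// (ltW b0).
have -> : (n%:R / n.+1%:R - 1 : R) = - n.+1%:R^-1.
  by rewrite -[X in _ - X](@divff _ n.+1%:R) ?gt_eqF// -mulrBl -natr1 opprD addrA subrr sub0r mulN1r.
by rewrite le_eqVlt; apply/orP; left; apply/eqP; ring.
Qed.

End PowerInequalities.

Section Family.
Context {R : realType} (D : law_family) (alpha : R) (halpha : 1 < alpha).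
Local Notation F := (family_cdf D alpha).
Implicit Types (x y h u : R).

Let alpha0 : 0 < alpha. Proof. exact: lt_trans halpha. Qed.
Let alphan0 : alpha != 0. Proof. by rewrite gt_eqF. Qed.

Lemma frechetE x : 0 < x -> family_cdf Frechet alpha x = expR (- x `^ (- alpha)).
Proof. by rewrite /= powRN => ->. Qed.

Lemma paretoE x : 1 <= x -> family_cdf Pareto alpha x = 1 - x `^ (- alpha).
Proof. by rewrite /= => ->. Qed.

Lemma pareto0 x : x < 1 -> family_cdf Pareto alpha x = 0.
Proof. by rewrite /= ltNge => /negbTE ->. Qed.

Lemma family_cdf_le0 x : x <= 0 -> F x = 0.
Proof.
case: D => x0; last by rewrite pareto0// (le_lt_trans x0).
by rewrite /= ltNge x0.
Qed.

Lemma pow_tail_le1 x : 1 <= x -> 0 <= x `^ (- alpha) <= 1.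
Proof.
move=> x1; rewrite powR_ge0 -[leRHS](one_powR (- alpha)).
by rewrite le0_ger_powR// ltW.
Qed.

Lemma family_cdf01 x : 0 <= F x <= 1.
Proof.
case: D.
  have [x0|x0] := leP x 0; first by rewrite /= ltNge x0 lexx ler01.
  by rewrite frechetE// expR_ge0 expR_le1 lerNl oppr0 powR_ge0.
have [x1|x1] := leP 1 x; last by rewrite pareto0// lexx ler01.
by rewrite paretoE//; have := pow_tail_le1 x1; lra.
Qed.

Lemma family_cdf_mono x y : x <= y -> F x <= F y.
Proof.
have := family_cdf01 y; case: D => /andP[Fy0 _] xy.
  have [x0|x0] := leP x 0; first by rewrite [leLHS]/= ltNge x0.
  rewrite !frechetE ?(lt_le_trans x0 xy)// ler_expR lerN2.
  by rewrite le0_ger_powR ?(ltW alpha0).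
have [x1|x1] := leP 1 x; last by rewrite pareto0.
rewrite !paretoE ?(le_trans x1 xy)// lerD2l lerN2.
by rewrite le0_ger_powR ?(ltW alpha0) ?(lt_le_trans ltr01).
Qed.

Lemma family_tail_le x : 0 < x -> 1 - F x <= x `^ (- alpha).
Proof.
move=> x0; case: D.
  by rewrite frechetE// lerBlDr -lerBlDl (le_trans _ (expR_ge1Dx _)).
have [x1|x1] := leP 1 x; first by rewrite paretoE// opprD addrA subrr sub0r opprK.
by rewrite pareto0// subr0 -[leLHS](one_powR (- alpha)) le0_ger_powR ?ltW.
Qed.

(** Log-concavity stated by products, so that it makes sense where [F] is 0. Both families inherit
    it from the convexity of [x^(-alpha)], called [conv] below; for Pareto an algebraic identity
    replaces the logarithm. *)
Lemma family_cdf_logconcave x y h : h <= 0 -> x <= y ->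
  F y * F (x + h) <= F x * F (y + h).
Proof.
move=> h0 xy.
have xhx : x + h <= x by rewrite gerDl.
have yhy : y + h <= y by rewrite gerDl.
have xhyh : x + h <= y + h by rewrite lerD2r.
have Fpos : 0 <= F x * F (y + h).
  by have /andP[? _] := family_cdf01 x; have /andP[? _] := family_cdf01 (y + h); rewrite mulr_ge0.
have conv : 0 < x + h -> x `^ (- alpha) + (y + h) `^ (- alpha) <=
    (x + h) `^ (- alpha) + y `^ (- alpha).
  move=> z0; have := @powRN_sub_mono _ alpha (x + h) (y + h) (- h) (ltW alpha0) z0 xhyh.
  by rewrite oppr_ge0 !addrK => /(_ h0); lra.
move: Fpos; case: D => Fpos.
  have [xh0|xh0] := leP (x + h) 0; first by rewrite [X in _ * X]/= ltNge xh0 mulr0.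
  have x0 := lt_le_trans xh0 xhx.
  rewrite !frechetE ?(lt_le_trans x0 xy) ?(lt_le_trans xh0 xhyh)//.
  by rewrite -!expRD ler_expR -!opprD lerN2 [leRHS]addrC conv.
have [xh1|xh1] := leP 1 (x + h); last by rewrite (pareto0 xh1) mulr0.
have x1 := le_trans xh1 xhx.
have xh0 := lt_le_trans ltr01 xh1.
have c := conv xh0.
rewrite !paretoE ?(le_trans x1 xy) ?(le_trans xh1 xhyh)//.
have /andP[_ Y1] := pow_tail_le1 (le_trans x1 xy).
have XY : y `^ (- alpha) <= x `^ (- alpha).
  by rewrite le0_ger_powR ?(ltW alpha0)// (lt_le_trans ltr01).
have YY : y `^ (- alpha) <= (y + h) `^ (- alpha).
  by rewrite le0_ger_powR ?(ltW alpha0)// (lt_le_trans ltr01)// (le_trans xh1).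
move: c Y1 XY YY; set X := x `^ _; set Y := y `^ _.
set X' := (x + h) `^ _; set Y' := (y + h) `^ _ => c Y1 XY YY.
rewrite -subr_ge0.
have -> : (1 - X) * (1 - Y') - (1 - Y) * (1 - X') =
  (X' + Y - (X + Y')) * (1 - Y) + (X - Y) * (Y' - Y) by ring.
by rewrite addr_ge0 ?mulr_ge0// subr_ge0.
Qed.

Let p := 1 + alpha^-1.

Let p0 : 0 <= p. Proof. by rewrite addr_ge0// invr_ge0 ltW. Qed.

(** The origin of the exponent [p]: it turns the tail [y^(-alpha)] into [y^(-alpha - 1)], which is
    the Pareto density up to the factor [alpha]. *)
Lemma pow_tailE y : 0 < y -> (y `^ (- alpha)) `^ p = y `^ (- alpha) / y.
Proof.
move=> y0; rewrite -powRrM /p mulrDr mulr1 mulNr mulfV// powRB; last by rewrite (gt_eqF y0) implybT.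
by rewrite powRr1// ltW.
Qed.

(** As [alpha > 1], the exponent [p] is at most 2, and halving the base costs at most a factor 4. *)
Lemma half_powR u v : 0 <= u -> u / 2 <= v -> u `^ p / 4 <= v `^ p.
Proof.
move=> u0 uv; rewrite (@le_trans _ _ ((u / 2) `^ p))//; last first.
  by rewrite ge0_ler_powR// nnegrE ?(le_trans _ uv)// divr_ge0.
rewrite powRM// ler_wpM2l ?powR_ge0//.
have -> : (4^-1 : R) = 2^-1 `^ 2%:R by rewrite powR_mulrn//; lra.
rewrite ger_powR//; first by rewrite invr_gt0 ltr0n /= invf_le1// ler1n.
have : alpha^-1 <= 1 by rewrite invf_le1// ltW.
by rewrite /p; lra.
Qed.

Lemma expRB_le u v : expR (- u) - expR (- v) <= expR (- u) * (v - u).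
Proof.
have -> : expR (- v) = expR (- u) * expR (- (v - u)) by rewrite -expRD; congr expR; ring.
rewrite -{1}[expR (- u)]mulr1 -mulrBr ler_wpM2l ?expR_ge0//.
by rewrite lerBlDr -lerBlDl (le_trans _ (expR_ge1Dx _)).
Qed.

Lemma frechet_le x : 0 <= x -> family_cdf Frechet alpha x <= x.
Proof.
rewrite le_eqVlt => /predU1P[<-|x0]; first by rewrite /= ltxx.
rewrite frechetE//; have [x1|x1] := leP 1 x.
  by rewrite (le_trans _ x1)// expR_le1 lerNl oppr0 powR_ge0.
rewrite (le_trans (expRN_le_inv _)) ?powR_gt0// powRN invrK.
by rewrite ge1r_powR ?x0 ?ltW.
Qed.

Lemma pareto_lipschitz y h : 0 <= h ->
  family_cdf Pareto alpha (y + h) - family_cdf Pareto alpha y <=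
  alpha * h * (1 - family_cdf Pareto alpha y) `^ p.
Proof.
move=> h0; have [y1|y1] := leP 1 y.
  rewrite !paretoE ?ler_wpDr// !opprD !opprK !addrA subrr add0r.
  have y0 := lt_le_trans ltr01 y1.
  rewrite pow_tailE// (le_trans _ (powRN_sub_le (ltW alpha0) y0 h0))//; lra.
rewrite (pareto0 y1) !subr0 one_powR mulr1.
have [yh1|yh1] := leP 1 (y + h); last by rewrite pareto0// mulr_ge0// ltW.
rewrite paretoE// (@le_trans _ _ (alpha * (y + h - 1)))//.
  have {1}-> : y + h = 1 + (y + h - 1) by ring.
  by rewrite onem_powRN_le ?(ltW alpha0) ?subr_ge0//; lra.
by rewrite ler_wpM2l ?(ltW alpha0)//; lra.
Qed.

Lemma frechet_lipschitz : exists2 C : R, 0 <= C & forall y h, 0 <= h ->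
  family_cdf Frechet alpha (y + h) - family_cdf Frechet alpha y <=
  C * h * (1 - family_cdf Frechet alpha y) `^ p.
Proof.
pose k := (2 : R) `^ (- alpha).
have k0 : 0 < k by rewrite powR_gt0.
(* The summand 2 serves [0 < y < 1] with [y <= h], the middle one [0 < y < 1] with [h < y], and
   [alpha] serves [y >= 1]. The additional factor 4 is that of [half_powR]. *)
pose C := 2 + 4 / k ^+ 2 * alpha + alpha.
have c0 : 0 <= 4 / k ^+ 2 * alpha by rewrite mulr_ge0 ?divr_ge0 ?exprn_ge0 ?ltW.
have C0 : 0 <= C by rewrite /C !addr_ge0// ltW.
exists (4 * C) => [|y h h0]; first by rewrite mulr_ge0.
have Fh0 z : 0 <= family_cdf Frechet alpha z by rewrite /=; case: ifP => // _; exact: expR_ge0.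
have [y0|y0] := leP y 0.
  have -> : family_cdf Frechet alpha y = 0 by rewrite /= ltNge y0.
  rewrite !subr0 one_powR mulr1.
  have [yh0|yh0] := leP (y + h) 0.
    by rewrite [leLHS]/= ltNge yh0 !mulr_ge0.
  rewrite (le_trans (frechet_le (ltW yh0)))// (@le_trans _ _ h)//; first by rewrite gerDr.
  by rewrite -[X in X <= _]mul1r ler_wpM2r// /C; have := ltW alpha0; lra.
have yh0 : 0 < y + h by rewrite ltr_wpDr.
set u := y `^ (- alpha); have u0 : 0 < u by rewrite powR_gt0.
have Fy : family_cdf Frechet alpha y = expR (- u) by rewrite frechetE.
have uu : u - (y + h) `^ (- alpha) <= alpha * h * (u / y) by rewrite powRN_sub_le ?(ltW alpha0).
have uu0 : 0 <= u - (y + h) `^ (- alpha).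
  by rewrite subr_ge0 le0_ger_powR ?(ltW alpha0)// lerDl.
have [y1|y1] := leP 1 y.
  have /andP[_ u1] : 0 <= u <= 1 := pow_tail_le1 y1.
  have qu : u / 2 <= 1 - family_cdf Frechet alpha y.
    rewrite Fy lerBrDl -lerBrDr (le_trans (expRN_le_inv1 (ltW u0)))//.
    rewrite -(ler_pM2l (_ : 0 < 1 + u)) ?addr_gt0// divff ?gt_eqF ?addr_gt0//; nra.
  have := half_powR (ltW u0) qu; rewrite pow_tailE// -/u => Hq.
  rewrite frechetE// Fy (le_trans (expRB_le _ _))//.
  rewrite (@le_trans _ _ (alpha * h * (u / y)))//.
    rewrite (le_trans _ uu)// -[leRHS]mul1r ler_wpM2r// expR_le1 lerNl oppr0.
    exact: powR_ge0.
  rewrite -Fy; set Z := (_ `^ p) in Hq *.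
  have uy0 : 0 <= u / y by rewrite divr_ge0 ?ltW.
  rewrite (@le_trans _ _ (C * h * (u / y)))//.
    by rewrite ler_wpM2r// ler_wpM2r// /C; lra.
  have -> : 4 * C * h * Z = C * h * (4 * Z) by ring.
  by rewrite ler_wpM2l ?mulr_ge0//; lra.
have u1 : 1 <= u by rewrite /u powRN invf_ge1 ?powR_gt0// -[leRHS](one_powR alpha) ge0_ler_powR ?nnegrE ?(ltW alpha0)// ltW.
have qu : 1 / 2 <= 1 - family_cdf Frechet alpha y.
  rewrite Fy lerBrDl -lerBrDr (le_trans (expRN_le_inv1 (ltW u0)))//.
  by rewrite (_ : 1 - 1 / 2 = 2^-1); [rewrite lef_pV2 ?posrE; lra|lra].
have := half_powR ler01 qu; rewrite one_powR => Hq.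
set Z := (_ `^ p) in Hq *.
rewrite (@le_trans _ _ (C * h))//; last first.
  have -> : 4 * C * h * Z = C * h * (4 * Z) by ring.
  by rewrite ler_peMr ?mulr_ge0//; lra.
have [yh|hy] := leP y h.
  rewrite (@le_trans _ _ (y + h))//.
    by rewrite (le_trans _ (frechet_le (ltW yh0)))// gerBl.
  by rewrite /C; have := mulr_ge0 c0 h0; have := mulr_ge0 (ltW alpha0) h0; lra.
rewrite frechetE// Fy (le_trans (expRB_le _ _))//.
set u' := (y + h) `^ (- alpha) in uu uu0 *.
(* Here [h < y], so [y + h <= 2 * y] and the power has shrunk at most by the factor [k]. *)
have ku : k * u <= u'.
  have -> : k * u = (2 * y) `^ (- alpha) by rewrite powRM ?ltW.
  by rewrite le0_ger_powR ?(ltW alpha0)//; lra.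
have u'0 : 0 < u' by rewrite powR_gt0.
rewrite (@le_trans _ _ (4 / k ^+ 2 * alpha * h))//; last first.
  by rewrite ler_wpM2r// /C; have := ltW alpha0; lra.
(* For [0 < y < 1] and [alpha > 1] one has [1 / y <= u], so the exponent changes by at most
   [alpha h u^2]; the bound [4 / u'^2] on the exponential absorbs the square. *)
rewrite (@le_trans _ _ (4 / (k * u) ^+ 2 * (alpha * h * u ^+ 2)))//; last first.
  rewrite exprMn invfM le_eqVlt; apply/orP; left; apply/eqP.
  by field; rewrite !gt_eqF.
apply: ler_pM; rewrite ?expR_ge0//.
  rewrite (le_trans (expRN_le_inv2 u'0))// ler_wpM2l// lef_pV2 ?posrE ?exprn_gt0 ?mulr_gt0//.
  by rewrite ler_pXn2r ?nnegrE ?mulr_ge0 ?(ltW k0) ?(ltW u0) ?(ltW u'0).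
rewrite (le_trans uu)// expr2 ler_wpM2l ?mulr_ge0 ?(ltW alpha0)// ler_wpM2l ?(ltW u0)//.
rewrite /u -[leLHS]powR_inv1 ?(ltW y0)// ger_powR ?y0 ?(ltW y1)//.
by rewrite lerN2 ltW.
Qed.

Lemma family_cdf_lipschitz : exists2 C : R, 0 <= C & forall y h, 0 <= h ->
  F (y + h) - F y <= C * h * (1 - F y) `^ (1 + alpha^-1).
Proof.
case: D; first exact: frechet_lipschitz.
by exists alpha => [|y h]; [exact: ltW|exact: pareto_lipschitz].
Qed.

Lemma powRN_invK x : 0 < x -> (x `^ (- alpha^-1)) `^ (- alpha) = x.
Proof. by move=> x0; rewrite -powRrM mulrNN mulVf// powRr1// ltW. Qed.

Lemma powRN_ltr x y : 0 < x -> x < y -> y `^ (- alpha) < x `^ (- alpha).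
Proof.
move=> x0 xy; have y0 := lt_trans x0 xy.
by rewrite !powRN ltf_pV2 ?posrE ?powR_gt0// gt0_ltr_powR ?nnegrE ?ltW.
Qed.

(** [F] is strictly larger than [u] to the right of the quantile, so that the event [F (X w) <= u]
    is a ray for [X]. *)
Lemma family_quantile u : 0 < u < 1 -> exists x, F x = u /\ forall y, (F y <= u) = (y <= x).
Proof.
move=> /andP[u0 u1].
suff [x [Fx Hx]] : exists x, F x = u /\ forall y, x < y -> u < F y.
  exists x; split => // y; apply/idP/idP => [|yx].
    by apply: contraTT; rewrite -!ltNge => /Hx.
  by rewrite -Fx family_cdf_mono.
case: D.
  have l0 : 0 < - ln u by rewrite oppr_gt0 ln_lt0 ?u0.
  exists ((- ln u) `^ (- alpha^-1)); split => [|y xy].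
    by rewrite frechetE ?powR_gt0// powRN_invK// opprK lnK.
  rewrite frechetE; last by rewrite (lt_trans _ xy)// powR_gt0.
  rewrite -{1}[u]lnK ?posrE// ltr_expR ltrNr -[X in _ < X](powRN_invK l0).
  by rewrite powRN_ltr ?powR_gt0.
have v0 : 0 < 1 - u by lra.
have x1 : 1 <= (1 - u) `^ (- alpha^-1).
  rewrite powRN invf_ge1 ?powR_gt0// -[leRHS](one_powR alpha^-1).
  by rewrite ge0_ler_powR ?nnegrE ?invr_ge0 ?(ltW alpha0)//; lra.
exists ((1 - u) `^ (- alpha^-1)); split => [|y xy].
  by rewrite paretoE// powRN_invK//; ring.
rewrite paretoE ?(le_trans x1 (ltW xy))//.
suff : y `^ (- alpha) < 1 - u by lra.
by rewrite -[ltRHS](powRN_invK v0) powRN_ltr// powR_gt0.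
Qed.

End Family.

(** * Independence *)

Section Decoupling.
Context {R : realType} {d0 : measure_display} {W : measurableType d0}
  (P : probability W R).

(** Independence on rectangles identifies the law of the pair with the product law, and Tonelli
    gives both orders. Writing the result with two copies of the outcome space makes conditioning a
    matter of freezing one copy. *)
Lemma integral_indep d1 d2 (T1 : measurableType d1) (T2 : measurableType d2)
    (X : W -> T1) (Y : W -> T2) (g : (T1 * T2)%type -> \bar R) :
  measurable_fun setT X -> measurable_fun setT Y ->
  (forall A B, measurable A -> measurable B ->
    P (X @^-1` A `&` Y @^-1` B) = P (X @^-1` A) * P (Y @^-1` B))%E ->
  measurable_fun [set: (T1 * T2)%type] g -> (forall z, 0 <= g z)%E ->
  (\int[P]_w g (X w, Y w) = \int[P]_w1 \int[P]_w2 g (X w1, Y w2))%E /\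
  (\int[P]_w g (X w, Y w) = \int[P]_w2 \int[P]_w1 g (X w1, Y w2))%E.
Proof.
move=> mX mY indXY mg g0.
pose X' : {mfun W >-> T1} := HB.pack X (isMeasurableFun.Build _ _ _ _ X mX).
pose Y' : {mfun W >-> T2} := HB.pack Y (isMeasurableFun.Build _ _ _ _ Y mY).
have mXY : measurable_fun setT (fun w => (X w, Y w)) by exact: measurable_fun_pair.
pose XY : {mfun W >-> (T1 * T2)%type} :=
  HB.pack (fun w => (X w, Y w)) (isMeasurableFun.Build _ _ _ _ _ mXY).
have XYE A : measurable A -> (distribution P X' \x distribution P Y')%E A = distribution P XY A.
  by apply: product_measure_unique => B C mB mC; rewrite -indXY.
have -> : (\int[P]_w g (X w, Y w) = \int[distribution P X' \x distribution P Y']_z g z)%E.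
  transitivity (\int[distribution P XY]_z g z)%E.
    by rewrite ge0_integral_distribution.
  by apply: eq_measure_integral => A mA _; apply/esym/XYE.
split.
  rewrite fubini_tonelli1// /fubini_F ge0_integral_distribution//; last 2 first.
    exact: measurable_fun_fubini_tonelli_F.
    by move=> x; apply: integral_ge0.
  apply: eq_integral => w1 _ /=; rewrite ge0_integral_distribution//.
  exact: measurableT_comp.
rewrite fubini_tonelli2// /fubini_G ge0_integral_distribution//; last 2 first.
  exact: measurable_fun_fubini_tonelli_G.
  by move=> x; apply: integral_ge0.
apply: eq_integral => w1 _ /=; rewrite ge0_integral_distribution//.
exact: measurableT_comp.
Qed.

End Decoupling.

Section Independence.
Context {R : realType} {d0 : measure_display} {W : measurableType d0}
  (P : probability W R).

Definition indep_events (A B : set W) := (P (A `&` B) = P A * P B)%E.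

Lemma indep_events_sym A B : indep_events A B -> indep_events B A.
Proof. by rewrite /indep_events setIC muleC. Qed.

(** The restriction of [P] to [B] and [P] scaled by [P B] are finite measures that agree on the
    pi-system [G], hence on the sigma-algebra it generates. *)
Lemma indep_sigma (G : set (set W)) (B : set W) :
  setI_closed G -> G setT -> G `<=` measurable -> measurable B ->
  (forall A, G A -> indep_events A B) -> forall A, <<s G >> A -> indep_events A B.
Proof.
move=> GI GT Gm mB indG A sA; rewrite /indep_events.
have PB : (fine (P B))%:E = P B by rewrite fineK// fin_num_measure.
pose r : {nonneg R} := NngNum (fine_ge0 (measure_ge0 P B)).
have -> : (P A * P B = mscale r P A)%E by rewrite /mscale/= PB muleC.
rewrite -[LHS]/(mrestr P mB A).
apply: (@g_sigma_algebra_measure_unique _ _ _ G Gm (fun=> setT)) => //.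
- by rewrite bigcup_const//; exists 0%N.
- by move=> C GC; rewrite /= /mrestr /mscale/= PB muleC; exact: indG.
- by move=> _; rewrite /= /mrestr setTI ltey_eq fin_num_measure.
Qed.

Context {I : choiceType} (F : I -> set (set W)) (D : I -> Prop).
Hypothesis FT : forall x, F x setT.
Hypothesis FI : forall x, setI_closed (F x).
Hypothesis F_meas : forall x, F x `<=` measurable.
Hypothesis indF : mutually_independent P D F.

Definition gen (E : I -> Prop) : set (set W) := \bigcup_(x in [set x | E x]) F x.

Lemma gen_sub (E E' : I -> Prop) : (forall x, E x -> E' x) -> <<s gen E >> `<=` <<s gen E' >>.
Proof. by move=> EE'; apply: sub_sigma_algebra2 => A [x Ex FA]; exists x => //; exact: EE'. Qed.

Lemma gen_measurable E : <<s gen E >> `<=` measurable.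
Proof.
apply: smallest_sub; first exact: sigma_algebra_measurable.
by move=> A [x _]; exact: F_meas.
Qed.

Lemma prob_bigcap_seq (s : seq I) (B : I -> set W) : uniq s ->
  (forall x, x \in s -> D x) -> (forall x, x \in s -> F x (B x)) ->
  (P (\bigcap_(x in [set` s]) B x) = \prod_(x <- s) P (B x))%E.
Proof.
move=> us sD sF; pose f (k : 'I_(size s)) := tnth (in_tuple s) k.
have fs k : f k \in s by rewrite mem_tnth.
have := indF (f := f) (A := fun k => B (f k)).
move=> H; rewrite [RHS]big_tnth -H//.
- congr (P _); apply/seteqP; split => [w sw k _|w sw x /= xs]; first exact/sw/fs.
  have [k ->] := tnthP (in_tuple s) x xs; exact: sw.
- move=> j k; rewrite /f !(tnth_nth (f j))/= => /eqP.
  by rewrite nth_uniq// => /eqP/val_inj.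
- by move=> k; exact: sD.
- by move=> k; exact: sF.
Qed.

Let cyl (E : I -> Prop) : set (set W) := [set A | exists s (B : I -> set W),
  [/\ uniq s, forall x, x \in s -> E x, forall x, F x (B x) &
      A = \bigcap_(x in [set` s]) B x]].

Let cylI E : setI_closed (cyl E).
Proof.
move=> _ _ [s [B [us sE FB ->]]] [s' [B' [us' sE' FB' ->]]].
(* Both cylinders are extended to the union of their index sets by the full event. *)
exists (undup (s ++ s')), (fun x => (if x \in s then B x else setT) `&`
  (if x \in s' then B' x else setT)); split.
- exact: undup_uniq.
- by move=> x; rewrite mem_undup mem_cat => /orP[/sE|/sE'].
- by move=> x; apply: FI; case: ifP => // _; exact: FT.
apply/seteqP; split => w /=.
  by move=> [sB sB'] x _; split; case: ifPn => //; [exact: sB|exact: sB'].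
move=> H; split => x /= xs; have [] := H x.
- by rewrite /= mem_undup mem_cat xs.
- by rewrite xs.
- by rewrite /= mem_undup mem_cat xs orbT.
- by rewrite xs.
Qed.

Let cylT E : cyl E setT.
Proof.
exists [::], (fun=> setT); split => //.
by apply/seteqP; split.
Qed.

Let cyl_sigma E : E `<=` D -> cyl E `<=` <<s gen E >>.
Proof.
move=> _ _ [s [B [us sE FB ->]]].
have -> : \bigcap_(x in [set` s]) B x = \big[setI/setT]_(x <- s) B x.
  by rewrite -bigcap_seq.
rewrite big_seq; apply: (@big_ind _ (<<s gen E >>)).
- exact: (@measurableT _ (g_sigma_algebraType (gen E))).
- by move=> A C; exact: (@measurableI _ (g_sigma_algebraType (gen E))).
- by move=> x /sE Ex; apply: sub_sigma_algebra; exists x.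
Qed.

(** Finite cylinders form a pi-system generating each block, and cylinders over disjoint blocks are
    independent by the product formula; [indep_sigma] is then applied once on each side. *)
Lemma gen_indep (E E' : I -> Prop) : E `<=` D -> E' `<=` D ->
  (forall x, E x -> ~ E' x) -> forall A A', <<s gen E >> A -> <<s gen E' >> A' ->
  indep_events A A'.
Proof.
move=> ED ED' disj.
have genS E0 : E0 `<=` D -> <<s gen E0 >> `<=` <<s cyl E0 >>.
  move=> ED0; apply: sub_sigma_algebra2 => A [x Ex FA].
  exists [:: x], (fun y => if y == x then A else setT); split => //.
  - by move=> y; rewrite inE => /eqP ->.
  - by move=> y; case: eqP => [->//|_]; exact: FT.
  apply/seteqP; split => w /=; first by move=> Aw y /=; rewrite inE => /eqP ->; rewrite eqxx.
  by move=> /(_ x) /=; rewrite eqxx inE eqxx; apply.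
have cylm E0 : E0 `<=` D -> cyl E0 `<=` measurable.
  by move=> ED0 A /(cyl_sigma ED0)/gen_measurable.
suff key A A' : cyl E A -> cyl E' A' -> indep_events A A'.
  move=> A A' /(genS _ ED) sA /(genS _ ED') sA'.
  have mA' : measurable A'.
    move: sA'; apply: smallest_sub; last exact: cylm.
    exact: sigma_algebra_measurable.
  apply: (indep_sigma (G := cyl E)) => // B cB; first exact: cylm cB.
  have mB : measurable B by exact: cylm cB.
  apply: indep_events_sym; apply: (indep_sigma (G := cyl E')) => // C cC.
  - exact: cylm cC.
  - by apply: indep_events_sym; exact: key.
move=> [s [B [us sE FB ->]]] [s' [B' [us' sE' FB' ->]]].
have disj_s x : x \in s' -> (x \in s) = false.
  by move=> /sE' E'x; apply/negP => /sE /disj.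
pose B'' x := if x \in s then B x else B' x.
rewrite /indep_events (_ : _ `&` _ = \bigcap_(x in [set` s ++ s']) B'' x); last first.
  apply/seteqP; split => w.
    move=> [sB sB'] x /=; rewrite mem_cat /B''; case: ifPn => /= [xs _|_ xs'];
      [exact: sB|exact: sB'].
  move=> H; split => x /= xs; have := H x; rewrite /B'' /= mem_cat xs ?orbT => /(_ isT)//.
  by rewrite disj_s.
rewrite prob_bigcap_seq; last 3 first.
- rewrite cat_uniq us us' andbT; apply/hasPn => x xs'.
  by rewrite disj_s.
- by move=> x; rewrite mem_cat => /orP[/sE/ED|/sE'/ED'].
- by move=> x _; rewrite /B''; case: ifP.
rewrite big_cat/= !prob_bigcap_seq//.
- congr (_ * _)%E; apply: eq_big_seq => x xs; rewrite /B'' ?xs//.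
  by rewrite disj_s.
- by move=> x /sE'/ED'.
- by move=> x /sE/ED.
Qed.

End Independence.

(** * Uniqueness of laws on the line and of random vectors *)

Section RealLaw.
Context {R : realType}.

Lemma measure_unique_rays (m1 m2 : {measure set R -> \bar R}) :
  (forall x, m1 `]-oo, x] = m2 `]-oo, x])%classic ->
  (forall x, m1 `]-oo, x] < +oo)%classic%E ->
  forall A, measurable A -> m1 A = m2 A.
Proof.
move=> m12 m1oo A mA.
pose G : set (set R) := [set B | exists x, B = `]-oo, x]%classic].
apply: (@measure_unique _ _ _ G (fun n => `]-oo, n%:R]%classic)) => //.
- transitivity ((@RGenOInfty.G R).-sigma.-measurable); first exact: RGenOInfty.measurableE.
  apply/seteqP; split.
    apply: smallest_sub; first exact: smallest_sigma_algebra.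
    move=> _ [x ->]; rewrite -setCitvl.
    by apply: (@measurableC _ (g_sigma_algebraType G)); apply: sub_sigma_algebra; exists x.
  apply: smallest_sub; first exact: smallest_sigma_algebra.
  move=> _ [x ->]; rewrite -[X in _ X]setCK setCitvl.
  by apply: (@measurableC _ (g_sigma_algebraType (@RGenOInfty.G R))); apply: sub_sigma_algebra; exists x.
- move=> _ _ [x ->] [y ->]; exists (Num.min x y).
  apply/seteqP; split => z /=; rewrite !in_itv/= le_min.
    by move=> [-> ->].
  by move=> /andP[].
- by move=> n; exists n%:R.
- apply/seteqP; split => // x _; exists (Num.bound `|x|) => //=.
  by rewrite in_itv/= (le_trans (ler_norm x))// ltW// archi_boundP.
- by move=> _ [x ->].
Qed.

Context {d0 : measure_display} {W : measurableType d0} (P : probability W R).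

Lemma cdf_law (X Y : {RV P >-> R}) : (forall x, cdf X x = cdf Y x) ->
  forall A, measurable A -> P (X @^-1` A) = P (Y @^-1` A).
Proof.
move=> XY A mA; apply: (@measure_unique_rays (distribution P X) (distribution P Y)) => //.
by move=> x; rewrite (le_lt_trans (probability_le1 _ _))// ltry.
Qed.

End RealLaw.

Section VectorLaw.
Context {R : realType} {d0 : measure_display} {W : measurableType d0}
  (P : probability W R) {d : nat}.

Definition vec (X : 'I_d -> W -> R) (w : W) : d.-tuple R := [tuple X i w | i < d].

Lemma measurable_vec (X : 'I_d -> W -> R) : (forall i, measurable_fun setT (X i)) ->
  measurable_fun setT (vec X).
Proof.
move=> mX; apply/measurable_fun_tnthP => i.
by rewrite (_ : _ \o _ = X i)//; apply/funext => w /=; rewrite tnth_mktuple.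
Qed.

Definition box (A : 'I_d -> set R) : set (d.-tuple R) := [set v | forall i, A i (tnth v i)].

Lemma vec_box (X : 'I_d -> W -> R) A : vec X @^-1` box A = \bigcap_i (X i @^-1` A i).
Proof.
apply/seteqP; split => w /= H i; first by move=> _; have := H i; rewrite tnth_mktuple.
by rewrite tnth_mktuple; exact: H.
Qed.

Lemma measure_unique_boxes (m1 m2 : {measure set (d.-tuple R) -> \bar R}) :
  (forall A : 'I_d -> set R, (forall i, measurable (A i)) -> m1 (box A) = m2 (box A)) ->
  (m1 setT < +oo)%E -> forall A, measurable A -> m1 A = m2 A.
Proof.
move=> m12 m1oo A mA.
pose G : set (set (d.-tuple R)) := [set B | exists2 A, (forall i, measurable (A i)) & B = box A].
have GT : G setT.
  by exists (fun=> setT) => //; apply/seteqP; split.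
apply: (@measure_unique _ _ _ G (fun=> setT)) => //.
- apply/seteqP; split.
    apply: smallest_sub; first exact: smallest_sigma_algebra.
    rewrite -bigcup_seq => B [i _] [C mC <-]; rewrite setTI.
    apply: sub_sigma_algebra; exists (fun j => if j == i then C else setT).
      by move=> j; case: ifP.
    apply/seteqP; split => v /=; first by move=> Cv j; case: eqP => // ->.
    by move=> /(_ i); rewrite eqxx.
  apply: smallest_sub; first exact: sigma_algebra_measurable.
  move=> _ [C mC ->].
  have -> : box C = \big[setI/setT]_(i < d) ((@tnth _ R ^~ i) @^-1` C i).
    rewrite -bigcap_seq; apply/seteqP; split => v /=.
      by move=> H i _; exact: H.
    by move=> H i; apply: H; rewrite /= mem_index_enum.
  apply: bigsetI_measurable => i _.
  by rewrite -[X in measurable X]setTI; exact: measurable_tnth.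
- move=> _ _ [B mB ->] [C mC ->]; exists (fun i => B i `&` C i).
    by move=> i; exact: measurableI.
  by apply/seteqP; split => v /=; [move=> [Bv Cv] i; split|move=> H; split => i; have [] := H i].
- by rewrite bigcup_const//; exists 0%N.
- by move=> _ [B mB ->]; exact: m12.
Qed.

Definition iid_vec (mu : set R -> \bar R) (X : 'I_d -> W -> R) :=
  (forall i, measurable_fun setT (X i)) /\
  forall A : 'I_d -> set R, (forall i, measurable (A i)) ->
    P (\bigcap_i (X i @^-1` A i)) = (\prod_i mu (A i))%E.

Lemma iid_vec_law mu (X Y : 'I_d -> W -> R) : iid_vec mu X -> iid_vec mu Y ->
  forall A, measurable A -> P (vec X @^-1` A) = P (vec Y @^-1` A).
Proof.
move=> [mX muX] [mY muY] A mA.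
pose X' : {mfun W >-> d.-tuple R} := HB.pack (vec X)
  (isMeasurableFun.Build _ _ _ _ (vec X) (measurable_vec mX)).
pose Y' : {mfun W >-> d.-tuple R} := HB.pack (vec Y)
  (isMeasurableFun.Build _ _ _ _ (vec Y) (measurable_vec mY)).
apply: (@measure_unique_boxes (distribution P X') (distribution P Y')) => //.
  move=> B mB; rewrite -[LHS]/(P (vec X @^-1` box B)) -[RHS]/(P (vec Y @^-1` box B)).
  by rewrite !vec_box muX ?muY.
by rewrite (le_lt_trans (probability_le1 _ _))// ltry.
Qed.

(** Exchangeability: a permutation only reindexes the product over the coordinates. *)
Lemma iid_vec_perm mu X (s : 'S_d) : iid_vec mu X -> iid_vec mu (fun i => X (s i)).
Proof.
move=> [mX muX]; split=> [i|A mA]; first exact: mX.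
have -> : \bigcap_i (X (s i) @^-1` A i) = \bigcap_i (X i @^-1` A ((s^-1)%g i)).
  apply/seteqP; split => w /= H i _; have := H _ I.
    by move=> /(_ ((s^-1)%g i)); rewrite permKV.
  by move=> /(_ (s i)); rewrite permK.
rewrite muX; last by move=> i; exact: mA.
rewrite (reindex_inj (@perm_inj _ s))/=; apply: eq_bigr => i _.
by rewrite permK.
Qed.

End VectorLaw.

(** * Means of functions with values in [[0, 1]] *)

Section FiniteMeasurability.
Context {d0 : measure_display} {T : measurableType d0}.

Lemma measurable_bool (b : T -> bool) : measurable_fun setT b -> measurable [set x | b x].
Proof.
move=> mb; rewrite (_ : [set x | b x] = setT `&` b @^-1` [set true]); last first.
  by rewrite setTI; apply/seteqP; split.
exact: mb.
Qed.

(** There are finitely many Boolean patterns, so the event is a finite union of finite intersections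
    of the given events and their complements. *)
Lemma measurable_pattern (K : finType) (b : T -> K -> bool)
    (Q : {ffun K -> bool} -> bool) :
  (forall k, measurable [set x | b x k]) -> measurable [set x | Q [ffun k => b x k]].
Proof.
move=> mb.
rewrite (_ : [set x | _] = \bigcup_(t in [set t | Q t]) \bigcap_(k in setT) [set x | b x k = t k]).
  apply: fin_bigcup_measurable => // t _; apply: fin_bigcap_measurable => // k _.
  case: (t k); first exact: mb.
  rewrite (_ : [set x | _] = ~` [set x | b x k]); first exact/measurableC/mb.
  by apply/seteqP; split => x /=; [move=> ->|move/negP/negbTE].
apply/seteqP; split => x /=.
  by move=> Qx; exists [ffun k => b x k] => // k _ /=; rewrite ffunE.
move=> [t Qt bt]; suff -> : [ffun k => b x k] = t by [].
by apply/ffunP => k; rewrite ffunE; exact: bt.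
Qed.

Context {R : realType} {d : nat}.

Lemma measurable_beats (x : T -> 'I_d -> R) i j :
  (forall k, measurable_fun setT (x ^~ k)) -> measurable [set t | beats (x t) j i].
Proof.
move=> mx; apply: measurable_bool; apply: measurable_or.
  exact: measurable_fun_ltr.
apply: measurable_and; first exact: measurable_fun_eqr.
exact: measurable_cst.
Qed.

Lemma measurable_among_largest m (x : T -> 'I_d -> R) i :
  (forall k, measurable_fun setT (x ^~ k)) -> measurable [set t | among_largest m (x t) i].
Proof.
move=> mx; rewrite (_ : [set t | _] = [set t |
    (#|[set j | [ffun j => beats (x t) j i] j]%SET| < m)%N]).
  apply: (@measurable_pattern _ _ (fun f : {ffun 'I_d -> bool} => (#|[set j | f j]%SET| < m)%N)) => j.
  exact: measurable_beats.
apply/seteqP; split => t /=; rewrite /among_largest;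
  by congr (_ < _)%N; apply: eq_card => j; rewrite !inE ffunE.
Qed.

End FiniteMeasurability.

Section UnitMean.
Context {R : realType} {d0 : measure_display} {W : measurableType d0}
  (P : probability W R).
Implicit Types f g h : W -> R.

(** Such functions are integrable under a probability, which allows real-valued means and
    subtraction. *)
Definition unitf f := measurable_fun setT f /\ forall w, 0 <= f w <= 1.

Lemma bounded_integrable (M : R) f : measurable_fun setT f ->
  (forall w, `|f w| <= M) -> P.-integrable setT (EFin \o f).
Proof.
move=> mf fM; apply: measurable_bounded_integrable => //.
  by rewrite ltey_eq fin_num_measure.
exists M; split => [|x Mx w _ /=]; first exact: num_real.
by rewrite (le_trans (fM w))// ltW.
Qed.

Lemma unitf_comb_integrable (a b : R) f g : unitf f -> unitf g ->
  P.-integrable setT (EFin \o (fun w => a * f w + b * g w)).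
Proof.
move=> [mf f01] [mg g01]; apply: (@bounded_integrable (`|a| + `|b|)).
  by apply: measurable_funD; exact: measurable_funM.
move=> w; have /andP[f0 f1] := f01 w; have /andP[g0 g1] := g01 w.
rewrite (le_trans (ler_normD _ _))// !normrM.
by rewrite lerD// ler_piMr// ger0_norm.
Qed.

Lemma unitf_integrable f : unitf f -> P.-integrable setT (EFin \o f).
Proof.
move=> [mf f01]; apply: (@bounded_integrable 1) => // w.
by have /andP[f0 f1] := f01 w; rewrite ger0_norm.
Qed.

Definition mean f : R := \int[P]_w f w.

Lemma meanE f : unitf f -> (mean f)%:E = (\int[P]_w (f w)%:E)%E.
Proof. by move=> /unitf_integrable fi; rewrite fineK//; exact: integrable_fin_num. Qed.

Lemma mean_ge0 f : (forall w, 0 <= f w) -> 0 <= mean f.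
Proof. by move=> f0; exact: Rintegral_ge0. Qed.

Lemma mean_cst (c : R) : mean (fun=> c) = c.
Proof.
rewrite /mean Rintegral_cst// (_ : fine _ = 1) ?mulr1//.
by rewrite -[RHS]/(fine 1%E); congr fine; exact: probability_setT.
Qed.

Lemma le_mean f g : unitf f -> unitf g -> (forall w, f w <= g w) -> mean f <= mean g.
Proof. by move=> /unitf_integrable fi /unitf_integrable gi fg; exact: le_Rintegral. Qed.

Lemma mean_unit f : unitf f -> 0 <= mean f <= 1.
Proof.
move=> fu; have [mf f01] := fu; rewrite mean_ge0/=; last by move=> w; case/andP: (f01 w).
rewrite -[leRHS]mean_cst le_mean//; last by move=> w; case/andP: (f01 w).
by split => // w; rewrite lexx ler01.
Qed.

Lemma unitf_cst (c : R) : 0 <= c <= 1 -> unitf (fun=> c).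
Proof. by move=> c01; split. Qed.

Lemma unitfM f g : unitf f -> unitf g -> unitf (fun w => f w * g w).
Proof.
move=> [mf f01] [mg g01]; split => [|w]; first exact: measurable_funM.
by have /andP[? ?] := f01 w; have /andP[? ?] := g01 w; rewrite mulr_ge0//= mulr_ile1.
Qed.

Lemma unitf_onem f : unitf f -> unitf (fun w => 1 - f w).
Proof.
move=> [mf f01]; split => [|w]; first exact: measurable_funB.
by have := f01 w; lra.
Qed.

Lemma meanD (a b : R) f g : unitf f -> unitf g ->
  mean (fun w => a * f w + b * g w) = a * mean f + b * mean g.
Proof.
move=> fu gu; have fi := unitf_integrable fu; have gi := unitf_integrable gu.
have zi c h : unitf h -> P.-integrable setT (EFin \o (fun w => c * h w)).
  move=> hu; rewrite (_ : (fun w => _) = (fun w => c * h w + 0 * h w)).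
    exact: unitf_comb_integrable.
  by apply/funext => w; rewrite mul0r addr0.
by rewrite /mean RintegralD ?RintegralZl//; exact: zi.
Qed.

Lemma meanZ (c : R) f : unitf f -> mean (fun w => c * f w) = c * mean f.
Proof. by move=> /unitf_integrable fi; rewrite /mean RintegralZl. Qed.

(** The common shape of the pointwise comparisons below; shorter ones are padded with coefficients
    0. *)
Lemma le_meanD (a b c e : R) f f' g g' : unitf f -> unitf f' -> unitf g -> unitf g' ->
  (forall w, a * f w + b * f' w <= c * g w + e * g' w) ->
  a * mean f + b * mean f' <= c * mean g + e * mean g'.
Proof.
by move=> fu f'u gu g'u H; rewrite -!meanD// /mean; apply: le_Rintegral => //;
  exact: unitf_comb_integrable.
Qed.

Lemma mean_sum (I : Type) (s : seq I) (f : I -> W -> R) : (forall k, unitf (f k)) ->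
  mean (fun w => \sum_(k <- s) f k w) = \sum_(k <- s) mean (f k).
Proof.
move=> fu; elim: s => [|x s IH].
  rewrite big_nil -[RHS]mean_cst; congr mean.
  by apply/funext => w; rewrite big_nil.
rewrite big_cons -IH /mean -RintegralD//; last 2 first.
- exact: unitf_integrable.
- rewrite (_ : _ \o _ = fun w => (\sum_(k <- s) (f k w)%:E)%E).
    by apply: integrable_sum => // k _; exact: unitf_integrable.
  by apply/funext => w /=; rewrite sumEFin.
by congr Rintegral; apply/funext => w; rewrite big_cons.
Qed.

Lemma unitf_bool (b : W -> bool) : measurable [set w | b w] -> unitf (fun w => (b w)%:R).
Proof.
move=> mb; split => [|w]; last by case: (b w); rewrite ?lexx ?ler01.
rewrite (_ : (fun w => _) = \1_[set w | b w]); first exact: measurable_indic.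
by apply/funext => w; rewrite indicE; congr (_%:R); congr nat_of_bool;
  apply/idP/idP => [bw|/set_mem//]; exact/mem_set.
Qed.

Lemma mean_bool (b : W -> bool) : measurable [set w | b w] ->
  mean (fun w => (b w)%:R) = fine (P [set w | b w]).
Proof.
move=> mb; apply: EFin_inj; rewrite meanE; last exact: unitf_bool.
rewrite fineK ?fin_num_measure// -(setIT [set w | b w]) -integral_indic//.
apply: eq_integral => w _; rewrite indicE; congr (_%:R%:E).
by congr nat_of_bool; apply/idP/idP => [bw|/set_mem//]; exact/mem_set.
Qed.

End UnitMean.

Section UnitFubini.
Context {R : realType} {d0 : measure_display} {W : measurableType d0}
  (P : probability W R) {d1 d2 : measure_display}
  {T1 : measurableType d1} {T2 : measurableType d2}
  (X : W -> T1) (Y : W -> T2) (g : (T1 * T2)%type -> R).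
Hypotheses (mX : measurable_fun setT X) (mY : measurable_fun setT Y).
Hypotheses (mg : measurable_fun [set: (T1 * T2)%type] g) (g01 : forall z, 0 <= g z <= 1).

Let mgX x : unitf (fun w => g (x, Y w)).
Proof. by split => // ; apply: (measurableT_comp (measurable_fun_pair2 _ mg)). Qed.

Let mgY y : unitf (fun w => g (X w, y)).
Proof. by split => // ; apply: (measurableT_comp (measurable_fun_pair1 _ mg)). Qed.

Let mgXY : measurable_fun setT (fun z : W * W => (g (X z.1, Y z.2))%:E).
Proof.
apply/measurable_EFinP; apply: (measurableT_comp mg).
by apply: measurable_fun_pair; exact: measurableT_comp.
Qed.

Let gXY0 (z : W * W) : (0 <= (g (X z.1, Y z.2))%:E)%E.
Proof. by rewrite lee_fin; case/andP: (g01 (X z.1, Y z.2)). Qed.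

Lemma unitf_mean1 : unitf (fun w => mean P (fun w' => g (X w, Y w'))).
Proof.
split=> [|w]; last exact/mean_unit.
apply/measurable_EFinP; rewrite (_ : _ \o _ = fun w => (\int[P]_w' (g (X w, Y w'))%:E)%E); last first.
  by apply/funext => w /=; rewrite (meanE P (mgX _)).
exact: (@measurable_fun_fubini_tonelli_F _ _ _ _ _ P _ mgXY gXY0).
Qed.

Lemma unitf_mean2 : unitf (fun w' => mean P (fun w => g (X w, Y w'))).
Proof.
split=> [|w]; last exact/mean_unit.
apply/measurable_EFinP; rewrite (_ : _ \o _ = fun w' => (\int[P]_w (g (X w, Y w'))%:E)%E); last first.
  by apply/funext => w /=; rewrite (meanE P (mgY _)).
exact: (@measurable_fun_fubini_tonelli_G _ _ _ _ _ P _ mgXY gXY0).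
Qed.

Lemma mean_swap : mean P (fun w => mean P (fun w' => g (X w, Y w'))) =
  mean P (fun w' => mean P (fun w => g (X w, Y w'))).
Proof.
apply: EFin_inj; rewrite !meanE; [|exact: unitf_mean2|exact: unitf_mean1].
under eq_integral do rewrite (meanE P (mgX _)).
under [RHS]eq_integral do rewrite (meanE P (mgY _)).
exact: (@fubini_tonelli _ _ _ _ _ P P _ mgXY gXY0).
Qed.

Lemma mean_indep : (forall A B, measurable A -> measurable B ->
    indep_events P (X @^-1` A) (Y @^-1` B)) ->
  mean P (fun w => g (X w, Y w)) = mean P (fun w => mean P (fun w' => g (X w, Y w'))).
Proof.
move=> ind; apply: EFin_inj; rewrite !meanE; [|exact: unitf_mean1|].
  under [RHS]eq_integral do rewrite (meanE P (mgX _)).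
  apply: (@integral_indep _ _ _ P _ _ _ _ X Y (EFin \o g) mX mY ind _ _).1.
    exact/measurable_EFinP.
  by move=> z; rewrite lee_fin; case/andP: (g01 z).
split=> // ; apply: (measurableT_comp mg); exact: measurable_fun_pair.
Qed.

End UnitFubini.

Section Association.
Context {R : realType} {d0 : measure_display} {W : measurableType d0}
  (P : probability W R).

(* Chebyshev's association inequality, obtained by integrating the hypothesis
   over two independent copies. *)
Lemma mean_assoc (g g' q : W -> R) : unitf g -> unitf g' -> unitf q ->
  (forall w w', g w * g' w' * q w + g w' * g' w * q w' <=
                g w * g' w' * q w' + g w' * g' w * q w) ->
  mean P (fun w => g w * q w) * mean P g' <= mean P g * mean P (fun w => g' w * q w).
Proof.
move=> gu g'u qu H.
have gqu := unitfM gu qu; have g'qu := unitfM g'u qu.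
(* The hypothesis integrated over the first copy; the second copy is integrated afterwards, where
   both sides become twice the products to be compared. *)
have step w' : g' w' * mean P (fun w => g w * q w) + (g w' * q w') * mean P g' <=
    (g' w' * q w') * mean P g + g w' * mean P (fun w => g' w * q w).
  by apply: le_meanD => // w; have := H w w'; lra.
have := @le_meanD _ _ _ P (mean P (fun w => g w * q w)) (mean P g') (mean P g)
  (mean P (fun w => g' w * q w)) g' (fun w => g w * q w) (fun w => g' w * q w) g
  g'u gqu g'qu gu.
suff H' : forall w, mean P (fun w => g w * q w) * g' w + mean P g' * (g w * q w) <=
    mean P g * (g' w * q w) + mean P (fun w => g' w * q w) * g w by move=> /(_ H'); lra.
by move=> w; have := step w; lra.
Qed.

End Association.

(** * Binomial sums of a uniform variable *)

Section Bernstein.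
Context {R : realType} {I : finType}.

Lemma trials_cst (S : {set I}) (u p : R) k :
  (trials S (fun=> u) (fun=> p))`_k = 'C(#|S|, k)%:R * u ^+ (#|S| - k) * p ^+ k.
Proof.
rewrite /trials prodr_const exprDn_comm; last exact: mulrC.
rewrite coef_sum.
have termE j : (((u%:P ^+ (#|S| - j) * (p *: 'X) ^+ j) *+ 'C(#|S|, j))`_k : R) =
    (k == j)%:R * ('C(#|S|, k)%:R * u ^+ (#|S| - k) * p ^+ k).
  rewrite coefMn -rmorphXn/= mul_polyC coefZ exprZn coefZ coefXn.
  case: eqVneq => [->|_]; last by rewrite !(mulr0, mul0r) mul0rn.
  by rewrite -mulr_natl; ring.
have [kn|nk] := ltnP k #|S|.+1.
  rewrite (bigD1 (Ordinal kn))//= big1 ?addr0 ?termE ?eqxx ?mul1r// => -[j/= jn].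
  by rewrite -val_eqE/= termE eq_sym => /negbTE ->; rewrite mul0r.
rewrite bin_small// !mul0r big1// => -[j/= jn] _.
by rewrite termE bin_small// !mul0r mulr0.
Qed.

End Bernstein.

Section UniformCdf.
Context {R : realType} {d0 : measure_display} {W : measurableType d0}
  (P : probability W R) (D : law_family) (alpha : R) (halpha : 1 < alpha)
  (X : {RV P >-> R}) (XF : has_law D alpha X).
Local Notation F := (family_cdf D alpha).

Lemma measurable_family_cdf : measurable_fun setT F.
Proof. by apply: nondecreasing_measurable => // x y; exact: family_cdf_mono. Qed.

Let mpre (A : set R) : measurable A -> measurable (X @^-1` A).
Proof. exact: measurable_funPTI. Qed.

Lemma measurable_RV_le x : measurable [set w | X w <= x].
Proof.
rewrite (_ : [set w | _] = X @^-1` `]-oo, x]); first exact: mpre.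
by apply/seteqP; split => w /=; rewrite in_itv.
Qed.

Lemma measurable_RV_lt x : measurable [set w | X w < x].
Proof.
rewrite (_ : [set w | _] = X @^-1` `]-oo, x[); first exact: mpre.
by apply/seteqP; split => w /=; rewrite in_itv.
Qed.

Lemma measurable_RV_gt x : measurable [set w | x < X w].
Proof.
rewrite (_ : [set w | _] = ~` [set w | X w <= x]); first exact/measurableC/measurable_RV_le.
by apply/seteqP; split => w /=; rewrite ltNge => /negP.
Qed.

Lemma measurable_RV_ge x : measurable [set w | x <= X w].
Proof.
rewrite (_ : [set w | _] = ~` [set w | X w < x]); first exact/measurableC/measurable_RV_lt.
by apply/seteqP; split => w /=; rewrite leNgt => /negP.
Qed.

Lemma measurable_RV_eq x : measurable [set w | X w = x].
Proof. exact: (mpre (measurable_set1 x)). Qed.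

Lemma prob_le x : P [set w | X w <= x] = (F x)%:E.
Proof.
by rewrite -XF /cdf /distribution /pushforward; congr (P _);
  apply/seteqP; split => w /=; rewrite in_itv.
Qed.

(** By the Lipschitz bound, whose tail factor is at most 1, the interval between [x - h] and [x] has
    mass at most [C * h] for every [h > 0]. *)
Lemma prob_eq0 x : P [set w | X w = x] = 0%E.
Proof.
have [C C0 HC] := family_cdf_lipschitz D halpha.
have mE := measurable_RV_eq x; have mle := measurable_RV_le.
have PC h : 0 < h -> (P [set w | X w = x] <= (C * h)%:E)%E.
  move=> h0; have : (P [set w | X w = x] + P [set w | (X w <= x - h)%R] <= P [set w | (X w <= x)%R])%E.
    rewrite -measureU//; last first.
      by apply/seteqP; split => w //= [->]; rewrite lerBrDl gerDr leNgt h0.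
    apply: le_measure; rewrite ?inE//; first exact: measurableU.
    by move=> w [/= ->//|/= /le_trans]; apply; rewrite gerBl ltW.
  rewrite !prob_le -leeBrDr// -EFinB => /le_trans; apply; rewrite lee_fin.
  have := HC (x - h) h (ltW h0); rewrite subrK => /le_trans; apply.
  rewrite ler_piMr ?mulr_ge0 ?(ltW h0)//.
  have /andP[F0 F1] := family_cdf01 D halpha (x - h).
  rewrite -[leRHS](one_powR (1 + alpha^-1)) ge0_ler_powR ?nnegrE ?subr_ge0 ?gerBl//.
  by rewrite addr_ge0// invr_ge0 ltW// (lt_trans ltr01).
apply/eqP; rewrite eq_le measure_ge0 andbT.
apply/lee_addgt0Pr => e e0; rewrite add0e.
have [C0'|Cn0] := eqVneq C 0.
  by rewrite (le_trans (PC 1 ltr01))// C0' mul0r lee_fin ltW.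
have Cp : 0 < C by rewrite lt_neqAle eq_sym Cn0.
by rewrite (le_trans (PC (e / C) _)) ?divr_gt0// lee_fin mulrCA divff// mulr1.
Qed.

Lemma prob_lt x : P [set w | X w < x] = (F x)%:E.
Proof.
rewrite -prob_le (_ : [set w | X w <= x] = [set w | X w < x] `|` [set w | X w = x]).
  rewrite measureU; [|exact: measurable_RV_lt|exact: measurable_RV_eq|].
    by rewrite [X in (_ + X)%E](_ : _ = 0%E) ?adde0//; exact: prob_eq0.
  by apply/seteqP; split => w //= [] /[swap] ->; rewrite ltxx.
apply/seteqP; split => w /=; rewrite le_eqVlt; first by move=> /predU1P[|]; [right|left].
by case=> [->|->]; rewrite ?eqxx ?orbT.
Qed.

Let cdfX (w : W) : R := F (X w).

Let mcdfX : measurable_fun setT cdfX.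
Proof. exact: (measurableT_comp measurable_family_cdf). Qed.

Lemma prob_cdf_le u : 0 <= u <= 1 -> P [set w | cdfX w <= u] = u%:E.
Proof.
have pos v : 0 < v < 1 -> P [set w | cdfX w <= v] = v%:E.
  move=> v01; have [x [Fx Hx]] := family_quantile D halpha v01.
  rewrite -Fx -prob_le; congr (P _).
  by apply/seteqP; split => w /=; rewrite /cdfX Fx Hx.
have mle v : measurable [set w | cdfX w <= v].
  rewrite (_ : [set w | _] = cdfX @^-1` `]-oo, v]); last first.
    by apply/seteqP; split => w /=; rewrite in_itv.
  by rewrite -[X in measurable X]setTI; exact: mcdfX.
rewrite le_eqVlt => /andP[/predU1P[<- _|u0]]; last first.
  rewrite le_eqVlt => /predU1P[->|u1]; last by rewrite pos ?u0.
  rewrite -(probability_setT P); congr (P _).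
  by apply/seteqP; split => w //= _; have /andP[] := family_cdf01 D halpha (X w).
apply/eqP; rewrite eq_le measure_ge0 andbT; apply/lee_addgt0Pr => e e0; rewrite add0e.
pose e' := Num.min e 2^-1.
have e'0 : 0 < e' by rewrite /e' lt_min e0/=.
have e'1 : e' < 1 by rewrite /e' gt_min; apply/orP; right; lra.
apply: (@le_trans _ _ (P [set w | cdfX w <= e'])).
  apply: le_measure; rewrite ?inE//; move=> w /= /le_trans; apply; exact: ltW.
by rewrite pos ?e'0// lee_fin /e' ge_min lexx.
Qed.

(** [F (X w)] is uniform on the unit interval, which is checked on rays, so the mean is the Beta
    integral with parameters [a + 1] and [b + 1]. *)
Lemma mean_cdf_poly (a b : nat) :
  mean P (fun w => F (X w) ^+ a * (1 - F (X w)) ^+ b) =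
  (a`! * b`!)%:R / (a + b).+1`!%:R.
Proof.
pose U : {mfun W >-> R} := HB.pack cdfX (isMeasurableFun.Build _ _ _ _ cdfX mcdfX).
pose h (u : R) := if 0 <= u <= 1 then u ^+ a * (1 - u) ^+ b else 0.
have h0 u : 0 <= h u.
  rewrite /h; case: ifPn => // /andP[u0 u1].
  by rewrite mulr_ge0// exprn_ge0// subr_ge0.
have mh : measurable_fun setT h.
  apply: measurable_fun_if => //.
  - by apply: measurable_and; exact: measurable_fun_ler.
  - apply: (@measurable_funS _ _ _ _ setT) => //.
    apply: measurable_funM; first exact: exprn_measurable.
    apply: (measurableT_comp (exprn_measurable _)).
    exact: measurable_funB.
have mid : measurable_fun setT (idfun : measurableTypeR R -> R) by exact: measurable_id.
pose J : {mfun measurableTypeR R >-> R} :=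
  HB.pack (idfun : measurableTypeR R -> R) (isMeasurableFun.Build _ _ _ _ _ mid).
have unif (A : set R) : measurable A -> distribution (uniform_prob (@ltr01 R)) J A = distribution P U A.
  have ue u : uniform_prob (@ltr01 R) `]-oo, u]%classic = lebesgue_measure (`]-oo, u] `&` `[0, 1])%classic.
    have mi : measurable_fun setT (EFin \o \1_(`]-oo, u]%classic) : R -> \bar R).
      exact/measurable_EFinP/measurable_indic.
    have := @integral_uniform R 0 1 ltr01 (EFin \o \1_(`]-oo, u]%classic)) mi.
    rewrite subr0 invr1 mul1e integral_indic//= setIT => -> //.
    by rewrite integral_indic.
  have PU u : distribution P U `]-oo, u]%classic = P [set w | cdfX w <= u].
    by congr (P _); apply/seteqP; split => w /=; rewrite in_itv.
  apply: measure_unique_rays => u;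
    last by rewrite (le_lt_trans (probability_le1 _ _))// ltry.
  rewrite [LHS]ue [RHS]PU.
  have [u0|u0] := ltP u 0.
    rewrite (_ : _ `&` _ = set0) ?measure0; last first.
      apply/seteqP; split => x //=; rewrite !in_itv/= => -[xu /andP[x0 _]].
      by move: (le_lt_trans x0 (le_lt_trans xu u0)); rewrite ltxx.
    rewrite (_ : [set w | cdfX w <= u] = set0) ?measure0//.
    apply/seteqP; split => w //= wu; have /andP[F0 _] := family_cdf01 D halpha (X w).
    by move: (le_lt_trans F0 (le_lt_trans wu u0)); rewrite ltxx.
  have [u1|u1] := leP u 1.
    rewrite prob_cdf_le ?u0// (_ : _ `&` _ = `[0, u]%classic); last first.
      apply/seteqP; split => x /=; rewrite !in_itv/=.
        by move=> [-> /andP[-> _]].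
      by move=> /andP[-> xu]; rewrite xu (le_trans xu u1).
    rewrite lebesgue_measure_itv/= lte_fin; case: ltP => [_|u00]; first by rewrite EFinN sube0.
    by congr (_%:E); apply/eqP; rewrite eq_le u0 u00.
  rewrite (_ : [set w | cdfX w <= u] = setT) ?probability_setT; last first.
    apply/seteqP; split => w //= _; have /andP[_ F1] := family_cdf01 D halpha (X w).
    exact: le_trans (ltW u1).
  rewrite (_ : _ `&` _ = `[0, 1]%classic); last first.
    apply/seteqP; split => x /=; rewrite !in_itv/=; first by case.
    by move=> /andP[x0 x1]; rewrite x0 x1 (le_trans x1 (ltW u1)).
  by rewrite lebesgue_measure_itv/= lte01 EFinN sube0.
rewrite -beta_fun_fact; apply: EFin_inj.
rewrite EFin_beta_fun/=; transitivity (\int[P]_w (h (cdfX w))%:E)%E.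
  rewrite meanE.
    apply: eq_integral => w _; rewrite /h /cdfX.
    by have /andP[-> ->] := family_cdf01 D halpha (X w).
  split=> [|w].
    apply: measurable_funM; first exact: (measurableT_comp (exprn_measurable _) mcdfX).
    by apply: (measurableT_comp (exprn_measurable _)); exact: measurable_funB.
  have /andP[F0 F1] := family_cdf01 D halpha (X w).
  by rewrite mulr_ge0 ?exprn_ge0 ?subr_ge0//= mulr_ile1 ?exprn_ge0 ?exprn_ile1 ?subr_ge0// gerBl.
transitivity (\int[distribution P U]_x (h x)%:E)%E.
  by rewrite ge0_integral_distribution//; exact/measurable_EFinP.
transitivity (\int[distribution (uniform_prob (@ltr01 R)) J]_x (h x)%:E)%E.
  by apply: eq_measure_integral => A mA _; apply/esym/unif.
rewrite ge0_integral_distribution//; last exact/measurable_EFinP.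
rewrite integral_uniform//; last exact/measurable_EFinP.
rewrite subr0 invr1 mul1e integral_mkcond; apply: eq_integral => x _.
rewrite !patchE /h; case: ifPn => //; rewrite inE/= in_itv/= => ->.
by [].
Qed.

End UniformCdf.

Section BinomialMean.
Context {R : realType} {d0 : measure_display} {W : measurableType d0}
  (P : probability W R) (D : law_family) (alpha : R) (halpha : 1 < alpha)
  (X : {RV P >-> R}) (XF : has_law D alpha X).
Local Notation F := (family_cdf D alpha).

Lemma unitf_cdf : unitf (fun w => F (X w)).
Proof.
split=> [|w]; last exact: family_cdf01.
by apply: (measurableT_comp (measurable_family_cdf D halpha)).
Qed.

Lemma unitf_exp (f : W -> R) n : unitf f -> unitf (fun w => f w ^+ n).
Proof.
move=> fu; elim: n => [|n IH]; first by apply: (@unitf_cst _ _ _ 1); rewrite lexx ler01.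
rewrite (_ : (fun w => _) = (fun w => f w * f w ^+ n)); first exact: unitfM.
by apply/funext => w; rewrite exprS.
Qed.

Context {I : finType}.

Let term (S : {set I}) k w : R :=
  'C(#|S|, k)%:R * (F (X w) ^+ (#|S| - k) * (1 - F (X w)) ^+ k).

Lemma unitf_term (S : {set I}) k : unitf (term S k).
Proof.
have [mF F01] := unitf_cdf.
split=> [|w].
  apply: measurable_funM => //; apply: measurable_funM.
    exact: (measurableT_comp (exprn_measurable _) mF).
  by apply: (measurableT_comp (exprn_measurable _)); exact: measurable_funB.
have /andP[F0 F1] := F01 w.
have t0 j : 0 <= term S j w by rewrite /term !mulr_ge0 ?exprn_ge0 ?subr_ge0.
rewrite t0/=; have [kS|kS] := ltnP k #|S|.+1; last by rewrite /term bin_small// mul0r ler01.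
rewrite -[leRHS](expr1n R #|S|) -[X in X ^+ _](subrK (F (X w))) addrC exprDn.
rewrite (bigD1 (Ordinal kS))//= -mulr_natl lerDl sumr_ge0// => j _.
by rewrite -mulr_natl t0.
Qed.

Lemma few_cdfE m (S : {set I}) w : fewH m S (fun=> F (X w)) = \sum_(k < m) term S k w.
Proof. by apply: eq_bigr => k _; rewrite trials_cst /term mulrA. Qed.

Lemma unitf_fewH m (S : {set I}) : unitf (fun w => fewH m S (fun=> F (X w))).
Proof.
have [mF F01] := unitf_cdf.
split=> [|w].
  rewrite (_ : (fun w => _) = (fun w => \sum_(k < m) term S k w)); last first.
    by apply/funext => w; rewrite few_cdfE.
  by apply: measurable_sum => k; have [] := unitf_term S k.
rewrite fewH_ge0 /=; last by move=> j _; exact: F01.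
rewrite few_cdfE.
have sum1 : \sum_(k < #|S|.+1) term S k w = 1.
  have /andP[F0 F1] := F01 w; rewrite -(expr1n R #|S|) -[X in X ^+ _](subrK (F (X w))) addrC.
  by rewrite exprDn; apply: eq_bigr => k _; rewrite /term mulr_natl.
have t0 k : 0 <= term S k w.
  by have /andP[F0 F1] := F01 w; rewrite /term !mulr_ge0 ?exprn_ge0 ?subr_ge0.
have [mS|mS] := leqP m #|S|.+1.
  rewrite -sum1 (big_ord_widen #|S|.+1 (fun k => term S k w) mS) [leRHS](bigID (fun k : 'I_ _ => (k < m)%N))/=.
  by rewrite lerDl sumr_ge0.
rewrite -sum1 [leRHS](big_ord_widen m (fun k => term S k w) (ltnW mS)).
rewrite [leLHS](bigID (fun k : 'I_ _ => (k < #|S|.+1)%N))/= gerDl.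
rewrite big1// => k; rewrite -leqNgt => Sk.
by rewrite /term bin_small// mul0r.
Qed.

Lemma mean_term (S : {set I}) k (e : nat) : (k <= #|S|)%N ->
  mean P (fun w => 'C(#|S|, k)%:R * (F (X w) ^+ (#|S| - k) * (1 - F (X w)) ^+ (k + e))) =
  'C(#|S|, k)%:R * ((#|S| - k)`! * (k + e)`!)%:R / (#|S| + e).+1`!%:R.
Proof.
move=> kS; rewrite meanZ.
  by rewrite mean_cdf_poly// mulrA addnA subnK.
by apply: unitfM; apply: unitf_exp; [exact: unitf_cdf|apply: unitf_onem; exact: unitf_cdf].
Qed.

(** Among [#|S|.+1] i.i.d. variables all positions of a given one are equally likely. *)
Lemma mean_term0 (S : {set I}) k : (k <= #|S|)%N -> mean P (term S k) = #|S|.+1%:R^-1.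
Proof.
move=> kS; have := mean_term 0 kS; rewrite !addn0 /term => ->.
rewrite -natrM [X in ('C(_, _) * X)%N]mulnC bin_fact// factS natrM invfM.
by rewrite mulrCA mulfV ?mulr1// pnatr_eq0 -lt0n fact_gt0.
Qed.

Lemma mean_term1 (S : {set I}) k : (k <= #|S|)%N ->
  mean P (fun w => term S k w * (1 - F (X w))) = k.+1%:R / (#|S|.+1%:R * #|S|.+2%:R).
Proof.
move=> kS; have := mean_term 1 kS; rewrite !addn1 => H.
rewrite (_ : (fun w => _) = (fun w => 'C(#|S|, k)%:R * (F (X w) ^+ (#|S| - k) * (1 - F (X w)) ^+ k.+1))); last first.
  by apply/funext => w; rewrite /term -!mulrA -exprSr.
rewrite H (factS k) -natrM [X in ('C(_, _) * X)%N]mulnCA mulnCA.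
rewrite [X in (_ * ('C(_, _) * X))%N]mulnC bin_fact//.
rewrite !factS mulnA !natrM; field.
by rewrite !gt_eqF ?ltr_wpDr// ltr0n fact_gt0.
Qed.

Lemma mean_few m (S : {set I}) : (m <= #|S|.+1)%N ->
  mean P (fun w => fewH m S (fun=> F (X w))) = m%:R / #|S|.+1%:R.
Proof.
move=> mS; have -> : (fun w => fewH m S (fun=> F (X w))) = (fun w => \sum_(k < m) term S k w).
  by apply/funext => w; rewrite few_cdfE.
rewrite mean_sum => [|k]; last exact: unitf_term.
rewrite (eq_bigr (fun=> #|S|.+1%:R^-1)) => [|k _]; last by rewrite mean_term0// -ltnS (leq_trans (ltn_ord k)).
by rewrite sumr_const card_ord mulr_natl.
Qed.

Lemma mean_few_tail m (S : {set I}) : (m <= #|S|.+1)%N ->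
  mean P (fun w => fewH m S (fun=> F (X w)) * (1 - F (X w))) <=
  m%:R / #|S|.+1%:R * (m%:R / #|S|.+1%:R).
Proof.
move=> mS; have -> : (fun w => fewH m S (fun=> F (X w)) * (1 - F (X w))) =
    (fun w => \sum_(k < m) term S k w * (1 - F (X w))).
  by apply/funext => w; rewrite few_cdfE mulr_suml.
rewrite (mean_sum P _ (f := fun (k : 'I_m) w => term S k w * (1 - F (X w)))) => [|k]; last first.
  by apply: unitfM; [exact: unitf_term|exact/unitf_onem/unitf_cdf].
rewrite (@le_trans _ _ (\sum_(k < m) (m%:R / (#|S|.+1%:R * #|S|.+1%:R))))//.
  apply: ler_sum => k _; rewrite mean_term1; last by rewrite -ltnS (leq_trans (ltn_ord k)).
  rewrite ler_pM ?invr_ge0 ?mulr_ge0 ?ler_nat// lef_pV2 ?posrE ?mulr_gt0//.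
  by rewrite ler_wpM2l// ler_nat.
rewrite sumr_const card_ord -mulr_natl le_eqVlt; apply/orP; left; apply/eqP.
by rewrite invfM; ring.
Qed.

End BinomialMean.

(** * Selection probabilities *)

Section PreimageSystem.
Context {R : realType} {d0 d1 : measure_display} {W : measurableType d0}
  {T : measurableType d1} (f : W -> T).

Lemma preimage_systemT : preimage_set_system setT f measurable setT.
Proof. by exists setT => //; rewrite setTI preimage_setT. Qed.

Lemma preimage_systemI : setI_closed (preimage_set_system setT f measurable).
Proof.
move=> _ _ [A mA <-] [B mB <-]; exists (A `&` B); first exact: measurableI.
by rewrite !setTI preimage_setI.
Qed.

Lemma preimage_systemS : measurable_fun setT f ->
  preimage_set_system setT f measurable `<=` measurable.
Proof. by move=> mf _ [A mA <-]; exact: mf. Qed.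

Lemma preimage_systemP A : measurable A -> preimage_set_system setT f measurable (f @^-1` A).
Proof. by move=> mA; exists A => //; rewrite setTI. Qed.

End PreimageSystem.

Section OneDim.
Context {R : realType} {d0 : measure_display} {W : measurableType d0}
  (P : probability W R) (D : law_family) (alpha : R) (halpha : 1 < alpha)
  (X : {RV P >-> R}) (XF : has_law D alpha X).
Local Notation F := (family_cdf D alpha).

Lemma prob_gt x : P [set w | x < X w] = (1 - F x)%:E.
Proof.
rewrite (_ : [set w | _] = ~` [set w | X w <= x]); last first.
  by apply/seteqP; split => w /=; rewrite ltNge => /negP.
by rewrite probability_setC; [rewrite EFinB -(prob_le XF)|exact: measurable_RV_le].
Qed.

Lemma prob_ge x : P [set w | x <= X w] = (1 - F x)%:E.
Proof.
rewrite (_ : [set w | _] = ~` [set w | X w < x]); last first.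
  by apply/seteqP; split => w /=; rewrite leNgt => /negP.
by rewrite probability_setC; [rewrite EFinB -(prob_lt halpha XF)|exact: measurable_RV_lt].
Qed.

Lemma measurable_RV_upset (U : R -> bool) : (forall x y, x <= y -> U x -> U y) ->
  measurable [set w | U (X w)].
Proof.
move=> Uup; rewrite (_ : [set w | _] = X @^-1` [set x | U x])//.
apply: measurable_funPTI; apply: is_interval_measurable => x y /= Ux Uy z /andP[xz _].
exact: Uup xz Ux.
Qed.

(** An up-closed condition is a half-line, and its endpoint has probability 0, so its probability is
    [1 - F y] with [y] the infimum. The empty and the full condition, which have no infimum, are set
    aside. *)
Lemma mean_upset_diff (C h : R) (U : R -> bool) : 0 <= C -> 0 <= h ->
  (forall y h, 0 <= h -> F (y + h) - F y <= C * h * (1 - F y) `^ (1 + alpha^-1)) ->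
  (forall x y, x <= y -> U x -> U y) ->
  mean P (fun w => (U (X w))%:R) - mean P (fun w => (U (X w - h))%:R) <=
  C * h * mean P (fun w => (U (X w))%:R) `^ (1 + alpha^-1).
Proof.
move=> C0 h0 HC Uup.
have Uhup x y : x <= y -> U (x - h) -> U (y - h) by move=> xy; apply: Uup; rewrite lerD2r.
have mU := measurable_RV_upset Uup.
have mUh : measurable [set w | U (X w - h)] by exact: (@measurable_RV_upset (fun z => U (z - h))).
have rhs0 : 0 <= C * h * mean P (fun w => (U (X w))%:R) `^ (1 + alpha^-1).
  by rewrite !mulr_ge0 ?powR_ge0.
have [allU|] := pselect (forall x, U x).
  rewrite (_ : (fun w => (U (X w))%:R) = (fun w => (U (X w - h))%:R)) in rhs0 *.
    by rewrite subrr.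
  by apply/funext => w; rewrite !allU.
move=> /existsNP[b /negP Ub].
have [noU|] := pselect (forall x, ~~ U x).
  rewrite (_ : (fun w => (U (X w))%:R) = (fun w => (U (X w - h))%:R)) in rhs0 *.
    by rewrite subrr.
  by apply/funext => w; rewrite !(negbTE (noU _)).
move=> /existsNP[a /negP/negPn Ua].
have hasU : has_inf [set x | U x].
  split; first by exists a.
  exists b => x /= Ux; rewrite leNgt; apply/negP => xb.
  by move: Ub; rewrite (Uup _ _ (ltW xb) Ux).
pose y := inf [set x | U x].
have Uge x : U x -> y <= x by move=> Ux; apply: ge_inf => //; case: hasU.
have Ugt x : y < x -> U x.
  move=> yx; have xy0 : 0 < x - y by rewrite subr_gt0.
  have [z Uz zx] := inf_adherent xy0 hasU.
  by apply: (Uup z) => //; rewrite ltW// (lt_le_trans zx)// addrC subrK.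
have mgt x : measurable [set w | x < X w] by exact: measurable_RV_gt.
have mge x : measurable [set w | x <= X w] by exact: measurable_RV_ge.
have -> : mean P (fun w => (U (X w))%:R) = 1 - F y.
  rewrite mean_bool// (_ : P _ = (1 - F y)%:E)//.
  apply/eqP; rewrite eq_le; apply/andP; split.
    by rewrite -prob_ge; apply: le_measure; rewrite ?inE// => w /=; exact: Uge.
  by rewrite -prob_gt; apply: le_measure; rewrite ?inE// => w /=; exact: Ugt.
have : 1 - F (y + h) <= mean P (fun w => (U (X w - h))%:R).
  rewrite mean_bool// -lee_fin fineK ?fin_num_measure// -prob_gt.
  by apply: le_measure; rewrite ?inE// => w /= yw; apply: Ugt; rewrite ltrBrDr.
by have := HC y h h0; lra.
Qed.

(** For two independent copies, the product of the two indicators is at most the first one on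
    [X <= X'] plus the second one on [X' <= X]. These two parts have equal means, and integrating
    out the other copy produces [1 - F (X w)]. *)
Lemma mean_sqr_le (U : W -> bool) (V : R -> bool) : (forall w, U w = V (X w)) ->
  measurable [set x | V x] ->
  mean P (fun w => (U w)%:R) ^+ 2 <= 2 * mean P (fun w => (U w)%:R * (1 - F (X w))).
Proof.
move=> UV mV.
have mU : measurable [set w | U w].
  rewrite (_ : [set w | U w] = X @^-1` [set x | V x]); first exact: measurable_funPTI.
  by apply/seteqP; split => w /=; rewrite UV.
have uU : unitf (fun w => (U w)%:R : R) by exact: unitf_bool.
pose g (z : R * R) : R := (V z.1)%:R * ((z.1 <= z.2)%R)%:R.
have mX : measurable_fun setT X by exact: measurable_funP.
have mg : measurable_fun [set: R * R] g.
  apply: measurable_funM.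
    have [mV' _] : unitf (fun x : R => (V x)%:R : R) by exact: unitf_bool.
    exact: (measurableT_comp mV').
  have [] // : unitf (fun z : R * R => ((z.1 <= z.2)%R)%:R : R).
  apply: unitf_bool; apply: measurable_bool.
  exact: measurable_fun_ler.
have g01 z : 0 <= g z <= 1.
  by rewrite /g; case: (V z.1); case: (z.1 <= z.2); rewrite !(mulr0, mul0r, mulr1, lexx, ler01).
have tail w : mean P (fun w' => ((X w <= X w')%R)%:R) = 1 - F (X w).
  rewrite mean_bool ?prob_ge//.
  by apply: (@measurable_RV_upset (fun x => X w <= x)) => x y xy /le_trans; apply.
have uge (x : R) : unitf (fun w' => ((x <= X w')%R)%:R : R).
  by apply: unitf_bool; apply: (@measurable_RV_upset (fun y => x <= y)) => a b ab /le_trans; apply.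
have ule (x : R) : unitf (fun w' => ((X w' <= x)%R)%:R : R).
  by apply: unitf_bool; exact: measurable_RV_le.
have E1 w : mean P (fun w' => g (X w, X w')) = (U w)%:R * (1 - F (X w)).
  by rewrite UV -tail -(meanZ _ _ (uge _)).
have ug1 w : unitf (fun w' => g (X w, X w')).
  apply: unitfM; last exact: uge.
  by apply: (@unitf_cst _ _ _ ((V (X w))%:R)); case: (V _); rewrite ?lexx ler01.
have ug2 w : unitf (fun w' => g (X w', X w)).
  apply: unitfM; last exact: ule.
  rewrite (_ : (fun w0 => _) = fun w0 => (U w0)%:R : R); first exact: uU.
  by apply/funext => w'; rewrite UV.
have uE1 := @unitf_mean1 _ _ _ P _ _ _ _ X X g mX mX mg g01.
have uE2 := @unitf_mean2 _ _ _ P _ _ _ _ X X g mX mX mg g01.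
have swap := @mean_swap _ _ _ P _ _ _ _ X X g mX mX mg g01.
have comb w : (U w)%:R * mean P (fun w => (U w)%:R) + 0 * mean P (fun w => (U w)%:R) <=
    1 * mean P (fun w' => g (X w, X w')) + 1 * mean P (fun w' => g (X w', X w)).
  apply: (le_meanD _ uU uU (ug1 w) (ug2 w)) => w'; rewrite /g/= !UV !mul1r mul0r addr0.
  case: (V (X w)); case: (V (X w')); rewrite ?mul0r ?mul1r ?addr0 ?ler0n ?addr_ge0//.
  by have [|/ltW ->] := leP (X w) (X w'); rewrite ?lerDl ?lerDr ler0n.
have main := @le_meanD _ _ _ P (mean P (fun w => (U w)%:R)) 0 1 1 _ _ _ _
  uU uU uE1 uE2.
have /main : forall w, mean P (fun w => (U w)%:R) * (U w)%:R + 0 * (U w)%:R <=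
   1 * mean P (fun w' => g (X w, X w')) + 1 * mean P (fun w' => g (X w', X w)).
  by move=> w; apply: le_trans (comb w); rewrite !mul0r mulrC.
rewrite -swap !mul1r mul0r addr0 -expr2 mulrDl mul1r.
by under [X in mean _ X + mean _ X]eq_fun do rewrite E1.
Qed.

End OneDim.

Section Count.
Context {R : realType} {d0 : measure_display} {W : measurableType d0}
  (P : probability W R) {I : finType} (X : I -> {RV P >-> R}).
Let sys j := preimage_set_system setT (X j) measurable.
Hypothesis indX : mutually_independent P (fun=> True) sys.

Lemma sys_meas j : sys j `<=` measurable.
Proof. exact/preimage_systemS. Qed.

Lemma RV_indep (E E' : I -> Prop) : (forall x, E x -> ~ E' x) ->
  forall A A', <<s gen sys E >> A -> <<s gen sys E' >> A' -> indep_events P A A'.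
Proof.
move=> EE'; apply: (@gen_indep _ _ _ P _ sys (fun=> True)) => //.
- by move=> j; exact: preimage_systemT.
- by move=> j; exact: preimage_systemI.
- exact: sys_meas.
Qed.

Variables (E : I -> R -> bool) (H : I -> R).
Hypothesis mE : forall j, measurable [set x | E j x].
Hypothesis EH : forall j, P [set w | E j (X j w)] = (1 - H j)%:E.

Let cnt (J : {set I}) w := #|[set j in J | E j (X j w)]|.

Let sysE (D : I -> Prop) j : D j -> <<s gen sys D >> [set w | E j (X j w)].
Proof.
move=> Dj; apply: sub_sigma_algebra; exists j => //.
exact: (preimage_systemP (X j) (mE j)).
Qed.

Let cntE (J : {set I}) m (D : I -> Prop) : (forall j, j \in J -> D j) ->
  <<s gen sys D >> [set w | (cnt J w < m)%N].
Proof.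
move=> JD; pose b (w : g_sigma_algebraType (gen sys D)) j := (j \in J) && E j (X j w).
have := @measurable_pattern _ (g_sigma_algebraType (gen sys D)) I b
  (fun f => (#|[set j | f j]%SET| < m)%N).
rewrite (_ : [set w | (cnt J w < m)%N] =
  [set x | (#|[set j | [ffun k => b x k] j]%SET| < m)%N]) => [|]; first apply.
  move=> j; rewrite /b; have [jJ|_] := boolP (j \in J); last first.
    by rewrite [X in measurable X](_ : _ = set0)//; apply/seteqP; split.
  exact: (sysE (JD _ jJ)).
by apply/seteqP; split => w /=; rewrite /cnt;
  congr (_ < _)%N; apply: eq_card => j; rewrite !inE ffunE.
Qed.

Lemma mean_bool_indep (b b' : W -> bool) : measurable [set w | b w] ->
  measurable [set w | b' w] -> indep_events P [set w | b w] [set w | b' w] ->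
  mean P (fun w => (b w)%:R * (b' w)%:R) = mean P (fun w => (b w)%:R) * mean P (fun w => (b' w)%:R).
Proof.
move=> mb mb' ind; have mbb' : measurable [set w | b w && b' w].
  rewrite (_ : [set w | _] = [set w | b w] `&` [set w | b' w]); first exact: measurableI.
  by apply/seteqP; split => w /= => [/andP|] [] => [|->].
rewrite [LHS](_ : _ = mean P (fun w => (b w && b' w)%:R)); last first.
  by congr mean; apply/funext => w; rewrite -natrM mulnb.
rewrite !mean_bool// -fineM ?fin_num_measure//; congr fine.
rewrite -ind; congr (P _); apply/seteqP; split => w /= => [/andP|] [] => [|->] //.
Qed.

(** Splitting off one arm by independence reproduces the recursion [few_setU1] of the Poisson
    binomial law. *)
Lemma count_law m (J : {set I}) : mean P (fun w => (cnt J w < m)%:R) = fewH m J H.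
Proof.
have gm D : <<s gen sys D >> `<=` measurable by apply: gen_measurable; exact: sys_meas.
have mcnt K k : measurable [set w | (cnt K w < k)%N].
  by apply: (gm (fun j => j \in K)); exact: cntE.
have mEj j : measurable [set w | E j (X j w)] by apply: (gm (fun k => k = j)); exact: sysE.
have mNEj j : measurable [set w | ~~ E j (X j w)].
  rewrite (_ : [set w | _] = ~` [set w | E j (X j w)]); first exact: measurableC.
  by apply/seteqP; split => w /= /negP.
have mean_E j : mean P (fun w => (E j (X j w))%:R) = 1 - H j by rewrite mean_bool// EH.
have mean_NE j : mean P (fun w => (~~ E j (X j w))%:R) = H j.
  rewrite [LHS](_ : _ = mean P (fun w => 1 * 1 + -1 * (E j (X j w))%:R)).
    rewrite meanD ?mean_cst ?mean_E; [lra|by apply: unitf_cst; rewrite lexx ler01|exact: unitf_bool].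
  by congr mean; apply/funext => w; case: (E j _) => /=; lra.
move: {2}_.+1 (ltnSn #|J|) => n; elim: n J m => // n IH J m Jn.
have [J0|[j jJ]] := set_0Vmem J.
  rewrite J0 (_ : (fun w => _) = (fun=> (0 < m)%:R : R)); last first.
    apply/funext => w; congr ((_ < _)%N%:R); apply: eq_card0 => j; by rewrite !inE.
  rewrite mean_cst /fewH /few /trials; case: m => [|m]; first by rewrite big_ord0.
  rewrite big_ord_recl big_set0 coefC eqxx big1 ?addr0// => k _.
  by rewrite coef1.
case: m => [|m].
  rewrite (_ : (fun w => _) = (fun=> 0 : R)); last by apply/funext => w; rewrite ltn0.
  by rewrite mean_cst /fewH /few big_ord0.
pose K := J :\ j; have jK : j \notin K by rewrite !inE eqxx.
have JK : J = (j |: K)%SET by rewrite finset.setD1K.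
have Kn : (#|K| < n)%N by move: Jn; rewrite JK cardsU1 jK add1n ltnS.
have -> : fewH m.+1 J H = H j * fewH m.+1 K H + (1 - H j) * fewH m K H.
  by rewrite JK; exact: few_setU1.
rewrite JK -!IH// -(mean_E j) -(mean_NE j).
have ind b : <<s gen sys (fun k => k = j) >> b -> forall k, indep_events P b [set w | (cnt K w < k)%N].
  move=> gb k; apply: (@RV_indep (fun k => k = j) (fun k => k \in K)) => //.
  - by move=> x ->; exact/negP.
  - exact: cntE.
have sE : <<s gen sys (fun k => k = j) >> [set w | E j (X j w)] by exact: sysE.
rewrite -!mean_bool_indep//; [|exact: ind|apply: ind].
  rewrite -[X in _ = X + _]mul1r -[X in _ = _ + X]mul1r -meanD; last 2 first.
  - by apply: unitfM; apply: unitf_bool.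
  - by apply: unitfM; apply: unitf_bool.
  congr mean; apply/funext => w.
  have -> : cnt (j |: K)%SET w = (E j (X j w) + cnt K w)%N.
    rewrite /cnt; have [Ej|nEj] := boolP (E j (X j w)).
      rewrite (_ : [set k in _ | _]%SET = (j |: [set k in K | E k (X k w)])%SET).
        by rewrite cardsU1 !inE eqxx.
      by apply/setP => k; rewrite !inE; case: eqVneq => [->|//]; rewrite Ej.
    apply: eq_card => k; rewrite !inE; case: eqVneq => [->|//]; by rewrite (negbTE nEj).
  by case: (E j _) => /=; rewrite ?mul1r ?mul0r ?add0r ?addr0 ?add0n// add1n ltnS.
rewrite (_ : [set w | _] = ~` [set w | E j (X j w)]); last first.
  by apply/seteqP; split => w /= /negP.
exact: (@measurableC _ (g_sigma_algebraType (gen sys (fun k => k = j)))).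
Qed.

End Count.

(** * Decrease of a selection probability when the loss of one arm grows *)

Section Static.
Context {R : realType} {d0 : measure_display} {W : measurableType d0}
  (P : probability W R) (D : law_family) (alpha : R) (halpha : 1 < alpha)
  {d : nat} (X : 'I_d -> {RV P >-> R}).
Hypothesis XF : forall i, has_law D alpha (X i).
Let sys j := preimage_set_system setT (X j) measurable.
Hypothesis indX : mutually_independent P (fun=> True) sys.
Local Notation F := (family_cdf D alpha).
Variables (m : nat) (m0 : (0 < m)%N) (lam : 'I_d -> R) (i : 'I_d).

Let upd (x : R) (v : 'I_d -> R) k := if k == i then x else v k.

Let g (v : 'I_d -> R) (x : R) : bool := among_largest m (fun k => upd x v k - lam k) i.

Let g_up v x y : x <= y -> g v x -> g v y.
Proof.
move=> xy; apply: among_largest_up => [|j ji]; first by rewrite /upd eqxx lerD2r.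
by rewrite /upd (negbTE ji).
Qed.

(** Entry [i] is blanked out, so that the vector depends on the other arms only and is independent
    of [X i]. *)
Let Xo k : W -> R := if k == i then fun=> 0 else X k.

Let gX v x w : v = (fun k => Xo k w) -> g v x = among_largest m (fun k => upd x (fun k => X k w) k - lam k) i.
Proof.
move=> ->; rewrite /g; congr (among_largest _ _ _); apply/funext => k.
by rewrite /upd /Xo; case: eqVneq.
Qed.

Let mXo k : measurable_fun setT (Xo k).
Proof. by rewrite /Xo; case: eqP => _; [exact: measurable_cst|exact: measurable_funP]. Qed.

Let gg (z : d.-tuple R * R) : R := (g (tnth z.1) z.2)%:R.

Let mgg : measurable_fun [set: d.-tuple R * R] gg.
Proof.
have [] // := @unitf_bool R _ (d.-tuple R * R)%type (fun z => g (tnth z.1) z.2).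
apply: measurable_among_largest => k; apply: measurable_funB => //.
rewrite /upd; case: eqP => _; first exact: measurable_snd.
exact: (measurableT_comp (measurable_tnth k) measurable_fst).
Qed.

Let gg01 z : 0 <= gg z <= 1.
Proof. by rewrite /gg; case: (g _ _); rewrite ?lexx ler01. Qed.

Let Y := vec Xo.
Let mY : measurable_fun setT Y. Proof. exact: measurable_vec. Qed.
Let mX : measurable_fun setT (X i). Proof. exact: measurable_funP. Qed.

Let gY w x : g (tnth (Y w)) x = among_largest m (fun k => upd x (fun k => X k w) k - lam k) i.
Proof. by rewrite -(@gX _ x w erefl); congr g; apply/funext => k; rewrite tnth_mktuple. Qed.

Let indYX A B : measurable A -> measurable B -> indep_events P (Y @^-1` A) (X i @^-1` B).
Proof.
move=> mA mB; apply: (@RV_indep _ _ _ _ _ X indX (fun k => k != i) (fun k => k = i)).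
- by move=> k /eqP.
- have : measurable_fun [set: g_sigma_algebraType (gen sys (fun k => k != i))] Y.
    apply: measurable_vec => k; rewrite /Xo; have [_|ki] := eqVneq k i; first exact: measurable_cst.
    move=> _ B' mB'; rewrite setTI; apply: sub_sigma_algebra; exists k => //.
    exact: preimage_systemP.
  by move=> /(_ measurableT _ mA); rewrite setTI.
- by apply: sub_sigma_algebra; exists i => //; exact: preimage_systemP.
Qed.

Let G x := mean P (fun w => gg (Y w, x)).
Let hH x j := F (x - lam i + lam j).

(** Arm [j] fails to beat [i] with probability [F (x - lam i + lam j)]. Breaking ties by index makes
    the comparison strict or weak, with the same probability because the law has no atoms. *)
Let GE x : G x = fewH m (~: [set i])%SET (hH x).
Proof.
pose E k y : bool := (x - lam i < y - lam k) || ((y - lam k == x - lam i) && (k < i)%N).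
have mE k : measurable [set y : R | E k y].
  apply: measurable_bool; apply: measurable_or.
    by apply: measurable_fun_ltr => //; exact: measurable_funB.
  apply: measurable_and; first by apply: measurable_fun_eqr => //; exact: measurable_funB.
  exact: measurable_cst.
rewrite -(@count_law _ _ _ P _ X indX E (hH x) mE).
  rewrite /G; congr mean; apply/funext => w; rewrite /gg gY /among_largest; congr ((_ < _)%N%:R).
  apply: eq_card => k; rewrite !inE /beats /upd eqxx /E.
  by case: (eqVneq k i) => [->|_] //=; rewrite ltxx eqxx ltnn.
move=> k; rewrite /hH.
rewrite (_ : x - lam i + lam k = x - lam i + lam k)//.
have [ki|ik] := ltnP k i.
  rewrite -(prob_ge halpha (XF k)); congr (P _); apply/seteqP; split => w /=;
    rewrite /E ki andbT eq_sym orbC -le_eqVlt lerBrDr//.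
rewrite -(prob_gt (XF k)); congr (P _); apply/seteqP; split => w /=;
  by rewrite /E ltnNge ik andbF orbF ltrBrDr.
Qed.

Let Q w := mean P (fun w' => gg (Y w, X i w')).
Let uQ : unitf Q. Proof. exact: (unitf_mean1 P mY mX mgg gg01). Qed.

Definition pick_prob (l : 'I_d -> R) := mean P (fun w => (among_largest m (fun k => X k w - l k) i)%:R).

Let phiQ : pick_prob lam = mean P Q.
Proof.
rewrite -(mean_indep mY mX mgg gg01 indYX); congr mean; apply/funext => w.
rewrite /gg gY; congr (among_largest _ _ _)%:R.
by apply/funext => k; rewrite /upd; case: eqVneq => [->|].
Qed.

Let phiG : pick_prob lam = mean P (fun w => G (X i w)).
Proof. rewrite phiQ; exact: (mean_swap P mY mX mgg gg01). Qed.

Let shifted h (z : d.-tuple R * R) := gg (z.1, z.2 - h).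
Let Q' h w := mean P (fun w' => shifted h (Y w, X i w')).

Let mshifted h : measurable_fun [set: d.-tuple R * R] (shifted h).
Proof.
apply: (measurableT_comp mgg); apply: measurable_fun_pair; first exact: measurable_fst.
by apply: measurable_funB => //; exact: measurable_snd.
Qed.

Let uQ' h : unitf (Q' h).
Proof. by apply: (unitf_mean1 P mY mX (mshifted h)) => z; exact: gg01. Qed.

Let phi_shift h : pick_prob (fun k => lam k + (k == i)%:R * h) = mean P (Q' h).
Proof.
rewrite -(mean_indep mY mX (mshifted h) (fun z => gg01 _) indYX).
congr mean; apply/funext => w; rewrite /shifted /gg gY; congr (among_largest _ _ _)%:R.
apply/funext => k; rewrite /upd; case: eqVneq => [->|_]; last by rewrite mul0r addr0.
by rewrite mul1r opprD /= addrA addrAC.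
Qed.

Variables (C h : R).
Hypotheses (C0 : 0 <= C) (h0 : 0 <= h).
Hypothesis HC : forall y h, 0 <= h -> F (y + h) - F y <= C * h * (1 - F y) `^ (1 + alpha^-1).

Let Qdiff w : Q w - Q' h w <= C * h * Q w `^ (1 + alpha^-1).
Proof.
have gup x y : x <= y -> g (tnth (Y w)) x -> g (tnth (Y w)) y by exact: g_up.
exact: (mean_upset_diff halpha (XF i) C0 h0 HC gup).
Qed.

Let alphaV : 0 <= alpha^-1 <= 1.
Proof.
by rewrite invr_ge0 invf_le1 ?(ltW halpha)//= ?(le_trans ler01 (ltW halpha))// (lt_trans ltr01).
Qed.

Let powQ w : Q w `^ (1 + alpha^-1) = Q w * Q w `^ alpha^-1.
Proof.
case: uQ => _ /(_ w)/andP[Q0 _]; have /andP[a0 _] := alphaV.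
have [->|Qn0] := eqVneq (Q w) 0; last by rewrite powRD ?Qn0 ?implybT// powRr1.
by rewrite mul0r powR0// gt_eqF// ltr_wpDr.
Qed.

Lemma pick_prob_shift_le : pick_prob lam - pick_prob (fun k => lam k + (k == i)%:R * h) <= C * h * pick_prob lam.
Proof.
have Ch0 : 0 <= C * h by rewrite mulr_ge0.
rewrite phi_shift phiQ.
suff : 1 * mean P Q + -1 * mean P (Q' h) <= (C * h) * mean P Q + 0 * mean P Q.
  by move: (mean P Q) (mean P (Q' h)) => a b; lra.
apply: (le_meanD _ uQ (uQ' h) uQ uQ) => w; have := Qdiff w; rewrite powQ.
have /andP[a0 _] := alphaV; case: uQ => _ /(_ w)/andP[Q0 Q1] H.
suff : C * h * (Q w * Q w `^ alpha^-1) <= C * h * Q w by lra.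
rewrite ler_wpM2l// ler_piMr// -[leRHS](one_powR alpha^-1).
by rewrite ge0_ler_powR ?nnegrE.
Qed.

Let uq : unitf (fun w => 1 - F (X i w)). Proof. exact/unitf_onem/unitf_cdf. Qed.

Let uG : unitf (fun w => G (X i w)). Proof. exact: (unitf_mean2 P mY mX mgg gg01). Qed.

Let S := lower_arms 1%g lam i :\ i.
Let cardS : #|S|.+1 = rank 1%g lam i.
Proof. by rewrite -card_lower_arms [RHS](cardsD1 i) lower_armsxx. Qed.

Let G' x := fewH m S (fun=> F x).

Hypothesis m_rank : (m < rank 1%g lam i)%N.

(** [fewH_cross], with the arms ahead of [i] as [S] and log-concavity of [F] for its condition
    [K' * H j <= K * H' j], makes the ratio of [G] to [G'] nondecreasing. *)
Let cross x y : x <= y -> G x * G' y <= G y * G' x.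
Proof.
move=> xy; rewrite !GE /G'; case: m m0 m_rank => [//|n _ nS].
have F01 z : 0 <= F z <= 1 := family_cdf01 D halpha z.
have SJ : S \subset (~: [set i])%SET by apply/fintype.subsetP => j; rewrite !inE => /andP[].
have HH' j : hH x j <= hH y j by apply: family_cdf_mono => //; rewrite !lerD2r.
have SF z j : j \in S -> hH z j <= F z.
  move=> /setD1P[_ /lower_arms_le jl]; apply: family_cdf_mono => //.
  by move: jl; lra.
have [Fx0|Fx0] := eqVneq (F x) 0; last first.
  apply: fewH_cross => //.
  - by move=> j _; exact: F01.
  - by move=> j _; exact: F01.
  - by rewrite lt_neqAle eq_sym Fx0; case/andP: (F01 x).
  - exact: family_cdf_mono.
  - by case/andP: (F01 y).
  move=> j jS; split; last exact: SF.
  have lj : lam j - lam i <= 0 by case/setD1P: jS => _ /lower_arms_le; rewrite subr_le0.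
  by have := family_cdf_logconcave D halpha lj xy; rewrite /hH !addrA !(addrAC _ (- lam i)).
(* In the degenerate case [F x = 0] every arm of [S] beats [i] almost surely; there are at least [m]
   of them, so [G x = 0]. *)
have H0 j : j \in S -> hH x j = 0.
  move=> jS; apply/eqP; rewrite eq_le; case/andP: (F01 (x - lam i + lam j)) => -> _.
  by rewrite andbT -Fx0 SF.
have [+ _] := @fewH_drop _ _ n _ S (hH x) (hH y) SJ (fun j _ => F01 _) (fun j _ => F01 _) (fun j _ => HH' j).
have -> : fewH n.+1 S (hH x) = 0.
  rewrite (@eq_fewH _ _ _ _ _ (fun=> 0)) => [|j /H0 ->//].
  apply: big1 => k _; rewrite trials_cst expr0n subn_eq0 leqNgt.
  by rewrite (leq_trans (ltn_ord k)) ?mulr0 ?mul0r// -ltnS cardS.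
move=> Gx0; have -> : fewH n.+1 [set~ i]%SET (hH x) = 0.
  by apply/eqP; rewrite eq_le Gx0 fewH_ge0// => j _; exact: F01.
by rewrite mul0r mulr_ge0 ?fewH_ge0// => j _; exact: F01.
Qed.

Let uG' : unitf (fun w => G' (X i w)). Proof. exact: unitf_fewH. Qed.

Let sigma : R := (rank 1%g lam i)%:R.
Let sigma0 : 0 < sigma. Proof. by rewrite ltr0n rank_gt0. Qed.
Let mS : (m <= #|S|.+1)%N. Proof. by rewrite cardS ltnW. Qed.

Let mean_Gq : mean P (fun w => G (X i w) * (1 - F (X i w))) <= m%:R / sigma * mean P (fun w => G (X i w)).
Proof.
have assoc := @mean_assoc _ _ _ P (fun w => G (X i w)) (fun w => G' (X i w)) _ uG uG' uq.
have {assoc}/assoc : forall w w', G (X i w) * G' (X i w') * (1 - F (X i w)) + G (X i w') * G' (X i w) * (1 - F (X i w')) <=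
    G (X i w) * G' (X i w') * (1 - F (X i w')) + G (X i w') * G' (X i w) * (1 - F (X i w)).
  (* The ratio of [G] to [G'] and the function [F] are monotone in the same direction, so the two
     factors have equal signs. *)
  move=> w w'; rewrite -subr_ge0 (_ : _ - _ = (G (X i w') * G' (X i w) - G (X i w) * G' (X i w')) *
    (F (X i w') - F (X i w))); last by ring.
  have [xy|/ltW xy] := leP (X i w) (X i w').
    by rewrite mulr_ge0 ?subr_ge0 ?cross// family_cdf_mono.
  by rewrite mulr_le0// subr_le0 ?cross// family_cdf_mono.
have := mean_few_tail halpha (XF i) mS; have := mean_few halpha (XF i) mS.
rewrite cardS -/sigma -/(G' _) => E1 E2.
rewrite /G' E1 => H.
have p0 : 0 < m%:R / sigma by rewrite divr_gt0// ltr0n.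
rewrite -(ler_pM2r p0) (le_trans H)//.
rewrite [leRHS]mulrAC [leRHS]mulrC ler_wpM2l//.
by apply: mean_ge0 => w; case: uG => _ /(_ w)/andP[].
Qed.

Let mean_Q2 : mean P (fun w => Q w ^+ 2) <= 2 * (m%:R / sigma * pick_prob lam).
Proof.
pose gq (z : d.-tuple R * R) := gg z * (1 - F z.2).
have mgq : measurable_fun [set: d.-tuple R * R] gq.
  apply: measurable_funM => //; apply: measurable_funB => //.
  by apply: (measurableT_comp (measurable_family_cdf D halpha)); exact: measurable_snd.
have gq01 z : 0 <= gq z <= 1.
  have /andP[a b] := gg01 z; have /andP[a' b'] := family_cdf01 D halpha z.2.
  by rewrite mulr_ge0 ?subr_ge0//= mulr_ile1 ?subr_ge0// gerBl.
apply: (@le_trans _ _ (2 * mean P (fun w => G (X i w) * (1 - F (X i w))))); last first.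
  by rewrite ler_wpM2l// phiG mean_Gq.
have -> : mean P (fun w => G (X i w) * (1 - F (X i w))) = mean P (fun w => mean P (fun w' => gq (Y w', X i w))).
  congr mean; apply/funext => w; rewrite mulrC -meanZ.
    by congr mean; apply/funext => w'; rewrite mulrC.
  split => [|w']; last exact: gg01.
  exact: (measurableT_comp (measurable_fun_pair1 _ mgg)).
rewrite -(mean_swap P mY mX mgq gq01).
have uq1 := unitf_mean1 P mY mX mgq gq01; have uQ2 := unitf_exp 2 uQ.
suff : 1 * mean P (fun w => Q w ^+ 2) + 0 * mean P Q <=
    2 * mean P (fun w => mean P (fun w' => gq (Y w, X i w'))) + 0 * mean P Q.
  by move: (mean P _) (mean P _) (mean P Q) => a b e; lra.
apply: (le_meanD _ uQ2 uQ uq1 uQ) => w; rewrite !mul0r !addr0 mul1r.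
have mgw : measurable [set x | g (tnth (Y w)) x].
  apply: is_interval_measurable => x y /= Ux _ z /andP[xz _]; exact: g_up xz Ux.
exact: (mean_sqr_le halpha (XF i) (fun w => erefl) mgw).
Qed.

Lemma pick_prob_shift_rank : pick_prob lam - pick_prob (fun k => lam k + (k == i)%:R * h) <=
  3 * C * h * (m%:R / sigma) `^ alpha^-1 * pick_prob lam.
Proof.
have Ch0 : 0 <= C * h by rewrite mulr_ge0.
set kap := (_ / _) `^ _; have kap0 : 0 <= kap by exact: powR_ge0.
have m0' : 0 < m%:R :> R by rewrite ltr0n.
have := mean_Q2; rewrite phi_shift phiQ => HQ2; have uQ2 := unitf_exp 2 uQ.
have : 1 * mean P Q + -1 * mean P (Q' h) <=
    (C * h * kap) * mean P Q + (C * h * kap * (sigma / m%:R)) * mean P (fun w => Q w ^+ 2).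
  apply: (le_meanD _ uQ (uQ' h) uQ uQ2) => w; have := Qdiff w; rewrite powQ.
  case: uQ => _ /(_ w)/andP[Q0 Q1] H.
  (* The power is replaced by an affine bound scaled to the level [m / sigma]. Its constant part
     contributes 1 and its linear part, through [mean_Q2], contributes 2: together the factor 3. *)
  have : Q w `^ alpha^-1 <= kap * (1 + Q w * (sigma / m%:R)).
    have {1}-> : Q w = (m%:R / sigma) * (Q w * (sigma / m%:R)).
      by field; rewrite !gt_eqF.
    have Qs0 : 0 <= Q w * (sigma / m%:R) by rewrite mulr_ge0// divr_ge0// ltW.
    rewrite powRM ?divr_ge0 ?(ltW sigma0)// ler_wpM2l//.
    exact: powR_le_1D.
  move=> H'; have := ler_wpM2l (mulr_ge0 Ch0 Q0) H'; rewrite expr2; lra.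
have : C * h * kap * (sigma / m%:R) * mean P (fun w => Q w ^+ 2) <=
    C * h * kap * (sigma / m%:R) * (2 * (m%:R / sigma * mean P Q)).
  by rewrite ler_wpM2l// !mulr_ge0// divr_ge0 ?(ltW sigma0)// ltW.
have -> : C * h * kap * (sigma / m%:R) * (2 * (m%:R / sigma * mean P Q)) = 2 * (C * h * kap * mean P Q).
  by field; rewrite !gt_eqF.
move: (mean P Q) (mean P (Q' h)) (mean P _) => a b e; lra.
Qed.

End Static.

Section RankSum.
Context {R : realType} {d : nat}.

Lemma sum_rank (tie : 'S_d) (L : 'I_d -> R) (f : nat -> R) :
  \sum_i f (rank tie L i) = \sum_(k < d) f k.+1.
Proof.
have rd i : ((rank tie L i).-1 < d)%N by rewrite prednK ?rank_gt0// rank_led.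
pose r i := Ordinal (rd i).
have rinj : injective r.
  move=> i j /(congr1 val)/= ij; apply: (@rank_inj _ _ tie L).
  by rewrite -(prednK (rank_gt0 _ _ _)) ij prednK// rank_gt0.
rewrite [RHS](reindex r)/=; last by apply: onW_bij; exact: injF_bij.
by apply: eq_bigr => i _; rewrite prednK// rank_gt0.
Qed.

(** Reindexed by rank, this is [sum_powRN_le] with exponent [1 - alpha^-1], positive because
    [alpha > 1]. *)
Lemma sum_powR_rank_le (alpha : R) (tie : 'S_d) (L : 'I_d -> R) (m : nat) : 1 < alpha ->
  \sum_i (m%:R / (rank tie L i)%:R) `^ alpha^-1 <=
  m%:R `^ alpha^-1 * d%:R `^ (1 - alpha^-1) / (1 - alpha^-1).
Proof.
move=> alpha1; have alpha0 : 0 < alpha by rewrite (lt_trans ltr01).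
have b01 : 0 < 1 - alpha^-1 <= 1.
  by rewrite subr_gt0 invf_lt1// alpha1/= gerBl invr_ge0 ltW.
rewrite (sum_rank tie L (fun k => (m%:R / k%:R) `^ alpha^-1)) -mulrA.
apply: le_trans (ler_wpM2l (powR_ge0 _ _) (sum_powRN_le d b01)).
rewrite mulr_sumr; apply: ler_sum => k _.
rewrite powRM// ?invr_ge0// (_ : 1 - alpha^-1 - 1 = -1 * alpha^-1); last by lra.
by rewrite powRrM powR_inv1.
Qed.

End RankSum.

(** * Mean excess of the perturbations over a level *)

Section Excess.
Context {R : realType} {d0 : measure_display} {W : measurableType d0}
  (P : probability W R) (D : law_family) (alpha : R) (halpha : 1 < alpha).
Local Notation F := (family_cdf D alpha).

Let q : R := 2 `^ (1 - alpha).

Let q01 : 0 < q < 1.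
Proof.
rewrite powR_gt0//= /q -opprB powRN invf_lt1 ?powR_gt0//.
have a0 : 0 < alpha - 1 by rewrite subr_gt0.
have : 1 `^ (alpha - 1) < 2 `^ (alpha - 1) :> R.
  by apply: (gt0_ltr_powR a0); rewrite ?nnegrE ?ltr1n.
by rewrite one_powR.
Qed.

Let geom n : \sum_(0 <= k < n) q ^+ k <= (1 - q)^-1.
Proof.
have /andP[q0 q1] := q01.
rewrite -[leRHS]mul1r ler_pdivlMr ?subr_gt0//.
suff -> : (\sum_(0 <= k < n) q ^+ k) * (1 - q) = 1 - q ^+ n by rewrite gerBl exprn_ge0// ltW.
elim: n => [|n IH]; first by rewrite big_geq// mul0r expr0 subrr.
by rewrite big_nat_recr//= mulrDl IH exprS; ring.
Qed.

Let qX k : (2 ^+ k : R) `^ (1 - alpha) = q ^+ k.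
Proof. by elim: k => [|k IH]; rewrite ?one_powR// !exprS powRM ?exprn_ge0 ?ler0n ?IH. Qed.

Lemma excess_le (X : {RV P >-> R}) (tau : R) : has_law D alpha X -> 0 < tau ->
  (\int[P]_w (Num.max (X w - tau) 0)%:E <= ((1 - q)^-1 * tau `^ (1 - alpha))%:E)%E.
Proof.
move=> XF tau0.
pose a k : R := tau * 2 ^+ k.
have a0 k : 0 < a k by rewrite mulr_gt0// exprn_gt0.
pose f k w : \bar R := (a k * \1_[set w | a k < X w] w)%:E.
have mgt x : measurable [set w | x < X w] by exact: measurable_RV_gt.
have mf k : measurable_fun setT (f k).
  by apply/measurable_EFinP; apply: measurable_funM => //; exact: measurable_indic.
have f0 k w : (0 <= f k w)%E by rewrite lee_fin mulr_ge0// ltW.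
have dom w : ((Num.max (X w - tau) 0)%:E <= \sum_(0 <= k <oo) f k w)%E.
  have [n Xn] : exists n, X w <= a n.
    exists (Num.bound (X w / tau)); rewrite -ler_pdivrMl//.
    have [Xt|Xt] := ltP (X w / tau) 0; first by rewrite mulrC (le_trans (ltW Xt))// exprn_ge0.
    rewrite mulrC (le_trans (ltW (archi_boundP Xt)))//.
    by rewrite -natrX ler_nat ltnW// ltn_expl.
  apply: (@le_trans _ _ (\sum_(0 <= k < n) f k w)%E); last exact: nneseries_lim_ge.
  rewrite sumEFin lee_fin ge_max; apply/andP; split; last first.
    by apply: sumr_ge0 => k _; rewrite -lee_fin; exact: f0.
  elim: n Xn => [|n IH] Xn.
    by rewrite big_geq//; move: Xn; rewrite /a expr0 mulr1 subr_le0.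
  rewrite big_nat_recr//=; have [/IH/le_trans->//|aX] := leP (X w) (a n).
    by rewrite lerDl mulr_ge0// ltW.
  have -> : \sum_(0 <= i < n) a i * \1_[set w | a i < X w] w = \sum_(0 <= i < n) a i.
    apply: eq_big_nat => k /andP[_ kn]; rewrite indicE mem_set ?mulr1//=.
    by apply: le_lt_trans aX; rewrite /a ler_pM2l// ler_weXn2l ?ler1n// ltnW.
  rewrite indicE mem_set ?mulr1//.
  have -> : \sum_(0 <= i < n) a i = a n - tau.
    elim: n {IH Xn aX} => [|n IH]; first by rewrite big_geq// /a expr0 mulr1 subrr.
    by rewrite big_nat_recr//= IH /a exprS; ring.
  by move: Xn; rewrite /a exprS; lra.
apply: (@le_trans _ _ (\int[P]_w \sum_(0 <= k <oo) f k w)%E).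
  apply: ge0_le_integral => //.
  - by move=> w _; rewrite lee_fin le_max lexx orbT.
  - apply/measurable_EFinP; apply: measurable_maxr => //; apply: measurable_funB => //.
  - exact: ge0_emeasurable_sum.
rewrite integral_nneseries//.
apply: lime_le; first by apply: is_cvg_nneseries => k _ _; exact: integral_ge0.
apply: nearW => n.
have intf k : (\int[P]_w f k w <= (tau `^ (1 - alpha) * q ^+ k)%:E)%E.
  have -> : (\int[P]_w f k w = (a k)%:E * P [set w | (a k < X w)%R])%E.
    rewrite /f; under eq_integral do rewrite EFinM.
    by rewrite ge0_integralZl// ?integral_indic ?setIT ?lee_fin ?ltW//; exact/measurable_EFinP/measurable_indic.
  rewrite (prob_gt XF) -EFinM lee_fin.
  apply: (le_trans (ler_wpM2l (ltW (a0 k)) (family_tail_le D halpha (a0 k)))).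
  have -> : a k * a k `^ (- alpha) = a k `^ (1 - alpha).
    by rewrite powRD ?(gt_eqF (a0 k)) ?implybT// powRr1// ltW.
  rewrite /a powRM ?exprn_ge0// ?(ltW tau0)//.
  by rewrite qX.
apply: (@le_trans _ _ (\sum_(0 <= k < n) (tau `^ (1 - alpha) * q ^+ k)%:E)%E).
  exact: lee_sum.
by rewrite sumEFin lee_fin -mulr_sumr mulrC ler_wpM2r ?powR_ge0.
Qed.

Lemma deficit_eq0 (X : {RV P >-> R}) : has_law D alpha X ->
  (\int[P]_w (Num.max (- X w) 0)%:E = 0)%E.
Proof.
move=> XF; rewrite -[RHS](@integral0 _ _ R P setT); apply: ge0_ae_eq_integral => //.
- apply/measurable_EFinP; apply: measurable_maxr => //.
  exact: measurable_funN.
- by move=> w _; rewrite lee_fin le_max lexx orbT.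
exists [set w | X w <= 0]; split; first exact: measurable_RV_le.
  by transitivity ((F 0)%:E); [exact: (prob_le XF)|rewrite family_cdf_le0].
move=> w /=; apply: contra_notP => /negP; rewrite -ltNge => X0 _.
by congr (_%:E); apply/max_r; rewrite oppr_le0 ltW.
Qed.

(** The level [tau] balances the two costs: [m tau] and [d tau^(1 - alpha)] are both equal to
    [m^(1 - 1/alpha) d^(1/alpha)]. *)
Lemma excess_sum_le (d m : nat) (X : 'I_d -> {RV P >-> R}) : (0 < m <= d)%N ->
  (forall i, has_law D alpha (X i)) ->
  forall tau, tau = (d%:R / m%:R) `^ alpha^-1 ->
  (\int[P]_w (m%:R * tau + \sum_i Num.max (X i w - tau) 0 + \sum_i Num.max (- X i w) 0)%:E <=
   ((1 + (1 - q)^-1) * (m%:R `^ (1 - alpha^-1) * d%:R `^ alpha^-1))%:E)%E.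
Proof.
move=> /andP[m0 md] XF tau tauE; have d1 := leq_trans m0 md.
have m0' : 0 < m%:R :> R by rewrite ltr0n.
have d0' : 0 < d%:R :> R by rewrite ltr0n.
have tau0 : 0 < tau by rewrite tauE powR_gt0// divr_gt0.
have mmax (f : W -> R) : measurable_fun setT f -> measurable_fun setT (fun w => (Num.max (f w) 0)%:E).
  by move=> mf; apply/measurable_EFinP; exact: measurable_maxr.
have max0 (x : R) : (0 <= (Num.max x 0)%:E)%E by rewrite lee_fin le_max lexx orbT.
have mX i : measurable_fun setT (X i) by exact: measurable_funP.
have s0 (g : 'I_d -> W -> R) w : [set: W] w -> (0 <= \sum_i (Num.max (g i w) 0)%:E)%E.
  by move=> _; exact: sume_ge0.
have c0 w : [set: W] w -> (0 <= (m%:R * tau)%:E)%E by move=> _; rewrite lee_fin mulr_ge0// ltW.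
have mC (g : 'I_d -> W -> R) : (forall i, measurable_fun setT (g i)) ->
    measurable_fun setT (fun w => \sum_i (Num.max (g i w) 0)%:E)%E.
  by move=> mg; apply: emeasurable_sum => i; exact: mmax.
have mB i : measurable_fun setT (fun w => X i w - tau) by exact: measurable_funB.
have mN i : measurable_fun setT (fun w => - X i w) by exact: measurable_funN.
rewrite [leLHS](_ : _ = \int[P]_w ((m%:R * tau)%:E) + \int[P]_w (\sum_i (Num.max (X i w - tau) 0)%:E) +
    \int[P]_w (\sum_i (Num.max (- X i w) 0)%:E))%E; last first.
  rewrite -ge0_integralD//; [|exact: s0|exact: mC].
  rewrite -ge0_integralD//; try exact: s0; try exact: mC; try by move=> w _; apply: adde_ge0; [exact: c0|exact: s0].
    by apply: eq_integral => w _; rewrite !sumEFin -!EFinD.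
  by move=> w _; apply: adde_ge0; [exact: (c0 w)|exact: (s0 (fun i w => X i w - tau) w)].
  by apply: emeasurable_funD => //; exact: mC.
rewrite !ge0_integral_sum//; last 2 first.
- by move=> i; apply: mmax; exact: measurable_funN.
- by move=> i; apply: mmax; exact: measurable_funB.
rewrite [X in (_ + X)%E]big1 ?adde0; last by move=> i _; exact: deficit_eq0.
have -> : (\int[P]__ (m%:R * tau)%:E = (m%:R * tau)%:E)%E.
  rewrite integral_cst//; transitivity ((m%:R * tau)%:E * 1)%E; last by rewrite mule1.
  by congr (_ * _)%E; exact: probability_setT.
apply: (@le_trans _ _ ((m%:R * tau)%:E + \sum_(i < d) ((1 - q)^-1 * tau `^ (1 - alpha))%:E)%E).
  by rewrite leeD2l//; apply: lee_sum => i _; exact: excess_le.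
rewrite sumEFin -EFinD lee_fin sumr_const card_ord -[X in _ + X]mulr_natl.
rewrite [X in _ + X]mulrCA [leRHS]mulrDl mul1r.
have alpha0 : alpha != 0 by rewrite gt_eqF// (lt_trans ltr01).
have splitR (x : R) a : 0 < x -> x `^ (1 - a) = x * (x `^ a)^-1.
  by move=> x0; rewrite powRD ?(gt_eqF x0) ?implybT// powRr1 ?ltW// powRN.
have divp a : (d%:R / m%:R) `^ a = d%:R `^ a * (m%:R `^ a)^-1 :> R.
  by rewrite powRM ?invr_ge0// -powR_inv1// -powRrM mulN1r powRN.
rewrite le_eqVlt; apply/orP; left; apply/eqP; congr (_ + _ * _).
  by rewrite tauE divp splitR//; ring.
rewrite tauE -powRrM mulrBr mulr1 mulVf// divp -opprB !powRN invrK !splitR//.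
by rewrite !invfM !invrK; field; rewrite !gt_eqF ?powR_gt0.
Qed.

End Excess.

(** * Ties have probability zero *)

Section NoTies.
Context {R : realType} {d0 : measure_display} {W : measurableType d0}
  (P : probability W R) (D : law_family) (alpha : R) (halpha : 1 < alpha)
  {d : nat} (X : 'I_d -> {RV P >-> R}).
Hypothesis XF : forall i, has_law D alpha (X i).
Hypothesis indX : mutually_independent P (fun=> True)
  (fun j => preimage_set_system setT (X j) measurable).

Lemma prob_tie (i j : 'I_d) (a b : R) : i != j -> P [set w | X i w - a = X j w - b] = 0%E.
Proof.
move=> ij; pose g (z : R * R) : R := (z.1 - a == z.2 - b)%:R.
have mg0 : measurable [set z : R * R | z.1 - a == z.2 - b].
  apply: measurable_bool; apply: measurable_fun_eqr; apply: measurable_funB => //.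
have mX k : measurable_fun setT (X k) by exact: measurable_funP.
have [mg g01] : unitf g by exact: (@unitf_bool R _ (R * R)%type).
have ind A B : measurable A -> measurable B -> indep_events P (X i @^-1` A) (X j @^-1` B).
  move=> mA mB; apply: (@RV_indep _ _ _ _ _ X indX (fun k => k = i) (fun k => k = j)).
  - by move=> k -> /eqP; apply/negP.
  - by apply: sub_sigma_algebra; exists i => //; exact: preimage_systemP.
  - by apply: sub_sigma_algebra; exists j => //; exact: preimage_systemP.
have mE : measurable [set w | X i w - a == X j w - b].
  by apply: measurable_bool; apply: measurable_fun_eqr; exact: measurable_funB.
rewrite (_ : [set w | _] = [set w | X i w - a == X j w - b]); last first.
  by apply/seteqP; split => w /= /eqP.
have : mean P (fun w => (X i w - a == X j w - b)%:R) = 0.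
  rewrite (mean_indep (mX i) (mX j) mg g01 ind) (mean_swap P (mX i) (mX j) mg g01).
  rewrite -[RHS](mean_cst P 0); congr mean; apply/funext => w.
  rewrite /g/= mean_bool; last first.
    by apply: measurable_bool; apply: measurable_fun_eqr => //; exact: measurable_funB.
  rewrite (_ : [set w0 | _] = [set w0 | X i w0 = X j w - b + a]).
    by rewrite (prob_eq0 halpha (XF i)).
  by apply/seteqP; split => w' /=; rewrite subr_eq => /eqP.
by rewrite mean_bool// => /eqP; rewrite fine_eq0 ?fin_num_measure// => /eqP.
Qed.

Lemma ties_negligible (lam : 'I_d -> R) :
  P.-negligible [set w | ~ injective (fun i => X i w - lam i)].
Proof.
pose tie (p : 'I_d * 'I_d) := [set w | X p.1 w - lam p.1 = X p.2 w - lam p.2].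
apply: (@negligibleS _ _ _ P (\big[setU/set0]_(p : 'I_d * 'I_d | p.1 != p.2) tie p)).
  move=> w /= /existsNP[i /existsNP[j /not_implyP[ij /eqP nij]]].
  rewrite -bigcup_seq_cond; exists (i, j) => //=.
  by rewrite mem_index_enum.
elim/big_ind: _ => //; [exact: negligible_set0|exact: negligibleU|].
move=> [i j]/= ij; apply/negligibleP; last exact: prob_tie.
rewrite (_ : tie _ = [set w | X i w - lam i == X j w - lam j]).
  by apply: measurable_bool; apply: measurable_fun_eqr; exact: measurable_funB.
by apply/seteqP; split => w /= /eqP.
Qed.

End NoTies.

(** * Geometric resampling *)

Section GenericMeasurability.
Context {d0 : measure_display} {Z : measurableType d0}.

(** An event that depends on finitely many Boolean observations is a function of their pattern. That
    function is obtained classically, from the existence of a witness, so order statistics never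
    have to be written out. *)
Lemma measurable_factor (K : finType) (b : Z -> K -> bool) (e : Z -> bool) :
  (forall k, measurable [set z | b z k]) ->
  (forall z z', (forall k, b z k = b z' k) -> e z = e z') ->
  measurable [set z | e z].
Proof.
move=> mb be.
pose Q (t : {ffun K -> bool}) := `[< exists2 z, (forall k, t k = b z k) & e z >].
rewrite (_ : [set z | e z] = [set z | Q [ffun k => b z k]]); first exact: measurable_pattern.
apply/seteqP; split => z /=; first by move=> ez; apply/asboolP; exists z => // k; rewrite ffunE.
by move=> /asboolP[z' zz' ez']; rewrite (be z z')// => k; rewrite -zz' ffunE.
Qed.

Lemma measurable_nat (f : Z -> nat) : (forall n, measurable [set z | f z = n]) ->
  measurable_fun setT f.
Proof.
move=> mf _ B _; rewrite setTI (_ : f @^-1` B = \bigcup_(n in B) [set z | f z = n]).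
  by apply: bigcup_measurable => n _; exact: mf.
by apply/seteqP; split => z /=; [exists (f z)|case=> n Bn /= ->].
Qed.

Context {R : realType}.

Lemma measurable_natr (f : Z -> nat) (c : nat -> R) : (forall n, measurable [set z | f z = n]) ->
  measurable_fun setT (fun z => c (f z)).
Proof.
move=> /measurable_nat mf; have mc : measurable_fun [set: nat] c by [].
exact: (measurableT_comp mc mf).
Qed.

Lemma measurable_first_success (p : Z -> pred nat) : (forall s, measurable [set z | p z s]) ->
  forall n, measurable [set z | first_success (p z) = n].
Proof.
move=> mp n.
have succ k : measurable [set z | first_success (p z) = k.+1].
  rewrite (_ : [set z | _] = [set z | p z k] `&` \bigcap_(s in [set s | (s < k)%N]) ~` [set z | p z s]).
    apply: measurableI => //; apply: fin_bigcap_measurable => [|s _]; last exact: measurableC.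
    exact: finite_II.
  apply/seteqP; split => z /=; rewrite /first_success; case: pselect => [ex|nex] //.
  - case: ex_minnP => s ps smin [<-]; split=> // q /= qs pq; have := smin _ pq.
    by rewrite leqNgt qs.
  - move=> [pk kmin]; case: ex_minnP => s ps smin; congr _.+1.
    apply/eqP; rewrite eqn_leq smin//= leqNgt; apply/negP => sk; exact: (kmin s sk).
  - by move=> [pk _]; case: nex; exists k.
case: n => [|n]; last exact: succ.
rewrite (_ : [set z | _] = ~` \bigcup_k [set z | first_success (p z) = k.+1]).
  by apply: measurableC; apply: bigcupT_measurable.
apply/seteqP; split => z /=; first by move=> pz [k _ /=]; rewrite pz.
by move=> H; case E : (first_success (p z)) => [//|k]; case: H; exists k.
Qed.

Context {d : nat}.

Lemma eqE_lt (x y : R) : (x == y) = ~~ (x < y) && ~~ (y < x).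
Proof. by rewrite -!leNgt eq_le andbC. Qed.

Lemma measurable_argmin_action m (u : Z -> 'I_d -> R) (a : {set 'I_d}) :
  (forall i, measurable_fun setT (u ^~ i)) -> measurable [set z | argmin_action m (u z) = a].
Proof.
move=> mu; rewrite (_ : [set z | _] = [set z | argmin_action m (u z) == a]); last first.
  by apply/seteqP; split => z /= /eqP.
pose b z (p : {set 'I_d} * {set 'I_d}) := dot (u z) p.1 <= dot (u z) p.2.
apply: (@measurable_factor _ b) => [p|z z' bzz'].
  have mdot c : measurable_fun setT (fun z => dot (u z) c).
    by rewrite /dot; under eq_fun do rewrite -big_enum; exact: measurable_sum.
  by apply: measurable_bool; exact: measurable_fun_ler.
congr (_ == _); rewrite /argmin_action /Order.arg_min /extremum; congr odflt.
apply: eq_pick => c /=; congr (_ && _); apply: eq_forallb => c'; congr (_ ==> _).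
exact: (bzz' (c, c')).
Qed.

Lemma rank_lt (tie : 'S_d) (L L' : 'I_d -> R) i :
  (forall j k, (L j < L k) = (L' j < L' k)) -> rank tie L i = rank tie L' i.
Proof. by move=> LL'; apply: eq_card => j; rewrite !inE !eqE_lt !LL'. Qed.

Lemma measurable_rank tie (L : Z -> 'I_d -> R) i n :
  (forall i, measurable_fun setT (L ^~ i)) -> measurable [set z | rank tie (L z) i = n].
Proof.
move=> mL; rewrite (_ : [set z | _] = [set z | rank tie (L z) i == n]); last first.
  by apply/seteqP; split => z /= /eqP.
apply: (@measurable_factor _ (fun z (p : 'I_d * 'I_d) => L z p.1 < L z p.2)) => [p|z z' zz'].
  by apply: measurable_bool; exact: measurable_fun_ltr.
by congr (_ == _); apply: rank_lt => j k; exact: (zz' (j, k)).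
Qed.

Lemma measurable_correction m est (L : Z -> 'I_d -> R) i :
  (forall i, measurable_fun setT (L ^~ i)) -> measurable_fun setT (fun z => correction m est (L z) i).
Proof.
move=> mL; case: est => [|tie] /=; first exact: measurable_cst.
apply: (@measurable_natr (fun z => rank tie (L z) i) (fun q => if (q <= m)%N then 1 else q%:R / m%:R)) => n.
exact: measurable_rank.
Qed.

Lemma beats_lt (v v' : 'I_d -> R) j i : (v i < v j) = (v' i < v' j) -> (v j < v i) = (v' j < v' i) ->
  beats v j i = beats v' j i.
Proof. by move=> ij ji; rewrite /beats !eqE_lt ij ji. Qed.

Lemma kth_largest_lt (S : {set 'I_d}) (v v' : 'I_d -> R) k k' :
  (forall j l, (v j < v l) = (v' j < v' l)) ->
  (forall n, (n <= d)%N -> (k == n) = (k' == n)) ->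
  kth_largest S v k = kth_largest S v' k'.
Proof.
move=> vv' kk'; apply: eq_pick => j; have [jS|//] := boolP (j \in S).
rewrite /= ![_ == k]eq_sym ![_ == k']eq_sym.
rewrite (_ : #|[set l in S | beats v l j]%SET| = nbeat_in S v' j); last first.
  by apply: eq_card => l; rewrite !inE (@beats_lt v v').
by apply: kk'; apply: leq_trans (nbeat_in_ltS v' jS) _; rewrite -[X in (_ <= X)%N]card_ord max_card.
Qed.

Definition success m est (eta : R) (L r : 'I_d -> R) (k : nat) i :=
  among_largest m (fun j => resampled m est L r k i j - eta * L j) i.

Lemma measurable_success m est eta (L r : Z -> 'I_d -> R) (k : Z -> nat) i :
  (forall i, measurable_fun setT (L ^~ i)) -> (forall i, measurable_fun setT (r ^~ i)) ->
  (if est is CGR _ then measurable_fun setT k else True) ->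
  measurable [set z | success m est eta (L z) (r z) (k z) i].
Proof.
move=> mL mr mk.
(* Observations that decide success. The swap can pair the perturbation of one arm with the loss of
   another, hence two indices on each side of the first kind of comparison. The value of [k] matters
   only up to [d], as no position is larger. *)
pose K : finType := (('I_d * 'I_d) * ('I_d * 'I_d) + (bool * ('I_d * 'I_d) + 'I_d.+1))%type.
pose b z (x : K) : bool := match x with
  | inl (p, q) => r z p.1 - eta * L z p.2 < r z q.1 - eta * L z q.2
  | inr (inl (true, p)) => L z p.1 < L z p.2
  | inr (inl (false, p)) => r z p.1 < r z p.2
  | inr (inr q) => if est is CGR _ then k z == q else true
  end.
apply: (@measurable_factor _ b).
  case=> [[p q]|[[[] p]|q]] /=; apply: measurable_bool.
  - by apply: measurable_fun_ltr; apply: measurable_funB => //; exact: measurable_funM.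
  - exact: measurable_fun_ltr.
  - exact: measurable_fun_ltr.
  - case: est @b mk => [_ _|tie _ mk]; first exact: measurable_cst.
    by apply: (measurableT_comp (f := fun n : nat => n == q)) mk.
move=> z z' zz'.
have LL j l : (L z j < L z l) = (L z' j < L z' l) := zz' (inr (inl (true, (j, l)))).
have rr j l : (r z j < r z l) = (r z' j < r z' l) := zz' (inr (inl (false, (j, l)))).
have rL p q : (r z p.1 - eta * L z p.2 < r z q.1 - eta * L z q.2) =
  (r z' p.1 - eta * L z' p.2 < r z' q.1 - eta * L z' q.2) := zz' (inl (p, q)).
(* Equal observations lead to the same rearrangement [s] of the perturbations in both outcomes. *)
suff [s sE s'E] : exists2 s : 'I_d -> 'I_d,
    resampled m est (L z) (r z) (k z) i = r z \o s &
    resampled m est (L z') (r z') (k z') i = r z' \o s.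
  rewrite /success sE s'E /among_largest; congr (_ < _)%N.
  apply: eq_card => j; rewrite !inE; apply: beats_lt.
    exact: (rL (s i, i) (s j, j)).
  exact: (rL (s j, j) (s i, i)).
case: est @b zz' mk => [|tie] b zz' mk; first by exists id.
have rk j : rank tie (L z) j = rank tie (L z') j by exact: rank_lt.
rewrite /= -(rk i); case: ifPn => _; first by exists id.
have -> : [set j | (rank tie (L z') j <= rank tie (L z) i)%N]%SET =
    [set j | (rank tie (L z) j <= rank tie (L z) i)%N]%SET.
  by apply/setP => j; rewrite !inE (rk j).
rewrite (@kth_largest_lt _ (r z') (r z) (k z') (k z)) => [|j l //|n nd].
  by eexists.
by have := zz' (inr (inr (Ordinal (nd : (n < d.+1)%N)))) => /= ->.
Qed.

Lemma measurable_inv_prob_estimate m est eta (L : Z -> 'I_d -> R) (r : Z -> nat -> 'I_d -> R)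
    (k : Z -> nat -> nat) i :
  (forall i, measurable_fun setT (L ^~ i)) ->
  (forall s i, measurable_fun setT (fun z => r z s i)) ->
  (if est is CGR _ then forall s, measurable_fun setT (k ^~ s) else True) ->
  measurable_fun setT (fun z => inv_prob_estimate m est eta (L z) (r z) (k z) i).
Proof.
move=> mL mr mk; apply: measurable_funM; first exact: measurable_correction.
apply: measurable_natr => n; apply: measurable_first_success => s.
by apply: measurable_success => //; case: est mk.
Qed.

End GenericMeasurability.

Section MeanMore.
Context {R : realType} {d0 : measure_display} {W : measurableType d0}
  (P : probability W R).

Lemma mean_ae (f g : W -> R) : measurable_fun setT f -> measurable_fun setT g ->
  (forall w, 0 <= f w) -> (forall w, 0 <= g w) ->
  P.-negligible [set w | f w <> g w] -> mean P f = mean P g.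
Proof.
move=> mf mg f0 g0 nfg; congr fine; apply: ge0_ae_eq_integral => //.
- exact/measurable_EFinP.
- exact/measurable_EFinP.
- by move=> w _; rewrite lee_fin.
- by move=> w _; rewrite lee_fin.
apply: negligibleS nfg => w /= H fg; apply: H => _; exact: congr1.
Qed.

Lemma mutually_independent_comp (I I' : Type) (D : I -> Prop) (D' : I' -> Prop)
    (F : I -> set (set W)) (h : I' -> I) : injective h -> (forall x, D' x -> D (h x)) ->
  mutually_independent P D F -> mutually_independent P D' (F \o h).
Proof.
move=> hinj DD' ind n f A finj fD fA; apply: (ind n (h \o f)) => [||k].
- exact: inj_comp.
- by move=> k; exact/DD'/fD.
- exact: fA.
Qed.

Lemma iid_of_indep (D : law_family) (alpha : R) (d : nat) (X : 'I_d -> {RV P >-> R}) (Z : {RV P >-> R}) :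
  (forall i, has_law D alpha (X i)) -> has_law D alpha Z ->
  mutually_independent P (fun=> True) (fun j => preimage_set_system setT (X j) measurable) ->
  iid_vec P (fun A => P (Z @^-1` A)) X.
Proof.
move=> XF ZF ind; split=> [i|A mA]; first exact: measurable_funP.
rewrite (ind d id (fun i => X i @^-1` A i))//.
  by apply: eq_bigr => i _; apply: cdf_law => // x; rewrite XF ZF.
by move=> k; exact: preimage_systemP.
Qed.

Lemma mean_vec_law (d : nat) mu (X Y : 'I_d -> W -> R) (e : ('I_d -> R) -> bool) :
  iid_vec P mu X -> iid_vec P mu Y -> measurable [set t : d.-tuple R | e (tnth t)] ->
  mean P (fun w => (e (X ^~ w))%:R) = mean P (fun w => (e (Y ^~ w))%:R).
Proof.
move=> iX iY me.
have eqv (Z : 'I_d -> W -> R) : [set w | e (Z ^~ w)] = vec Z @^-1` [set t : d.-tuple R | e (tnth t)].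
  apply/seteqP; split => w /=; rewrite (_ : Z ^~ w = tnth (vec Z w))//;
    by apply/funext => k; rewrite tnth_mktuple.
have mE (Z : 'I_d -> W -> R) : iid_vec P mu Z -> measurable [set w | e (Z ^~ w)].
  move=> [mZ _]; rewrite eqv -[X in measurable X]setTI; exact: measurable_vec.
by rewrite !mean_bool; [|exact: mE|exact: mE]; congr fine; rewrite !eqv; exact: iid_vec_law iX iY _ me.
Qed.

End MeanMore.

Section Lower.
Context {R : realType} {d : nat}.

(* Subtracting the losses can only help [i] against the arms that are not
   better than it. *)
Lemma among_largest_lower m (tie : 'S_d) (eta : R) (L v : 'I_d -> R) i : 0 <= eta ->
  among_largest m (fun j => v j - eta * L j) i -> (nbeat_in (lower_arms tie L i) v i < m)%N.
Proof.
move=> eta0; apply: leq_ltn_trans; apply/subset_leq_card/fintype.subsetP => j.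
rewrite !inE rankE => /andP[ji]; rewrite /beats.
have : eta * L j <= eta * L i by rewrite ler_wpM2l// (lower_arms_le (tie := tie))// lower_armsE.
move=> H /orP[vij|/andP[/eqP vij ij]].
  by apply/orP; left; lra.
rewrite vij ij andbT; rewrite le_eqVlt in H; case/predU1P: H => [->|H].
  by rewrite eqxx orbT.
by apply/orP; left; lra.
Qed.

End Lower.

(** * Success probability of one resampling step *)

Section OneTrial.
Context {R : realType} {d0 : measure_display} {W : measurableType d0}
  (P : probability W R) (D : law_family) (alpha : R) (halpha : 1 < alpha)
  {d : nat} (r : 'I_d -> {RV P >-> R}) (th : {RV P >-> nat}).
Hypothesis rF : forall i, has_law D alpha (r i).
Let sys j := preimage_set_system setT (r j) measurable.
Hypothesis indr : mutually_independent P (fun=> True) sys.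
Variables (m : nat) (eta : R) (L : 'I_d -> R) (i : 'I_d).
Hypotheses (m0 : (0 < m)%N) (eta0 : 0 <= eta).

Let mr j : measurable_fun setT (r j). Proof. exact: measurable_funP. Qed.

Section Swapped.
Variable tie : 'S_d.
Hypothesis ind_th : forall A n, <<s gen sys (fun=> True) >> A -> indep_events P [set w | th w = n] A.
Hypothesis th_law : forall k, (1 <= k <= m)%N -> P [set w | th w = k] = (m%:R^-1)%:E.
Hypothesis m_rank : (m < rank tie L i)%N.

Let S := lower_arms tie L i.
Let iS : i \in S. Proof. exact: lower_armsxx. Qed.

Let ev (k : nat) (v : 'I_d -> R) : bool :=
  (nbeat_in S v i == k) && among_largest m (fun j => v j - eta * L j) i.

Let mev (d1 : measure_display) (Z : measurableType d1) k (v : Z -> 'I_d -> R) :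
  (forall j, measurable_fun setT (v ^~ j)) -> measurable [set z | ev k (v z)].
Proof.
move=> mv; rewrite (_ : [set z | _] = [set z | nbeat_in S (v z) i == k] `&`
    [set z | among_largest m (fun j => v z j - eta * L j) i]); last first.
  by apply/seteqP; split => z /= /andP.
apply: measurableI; last first.
  by apply: measurable_among_largest => j; apply: measurable_funB => //; exact: measurable_cst.
apply: (@measurable_factor _ _ _ (fun z (j : 'I_d) => beats (v z) j i)) => [j|z z' zz'].
  exact: measurable_beats.
by congr (_ == _); apply: eq_card => j; rewrite !inE zz'.
Qed.

Let swapped (j : 'I_d) w := fun l => r (tperm i j l) w.

Let ev_law k j : mean P (fun w => (ev k (swapped j w))%:R) = mean P (fun w => (ev k (r ^~ w))%:R).
Proof.
have ir := iid_of_indep rF (rF i) indr.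
apply: (mean_vec_law (X := fun l => r (tperm i j l)) (Y := r) (iid_vec_perm (tperm i j) ir) ir).
apply: (@mev _ _ k (fun t : d.-tuple R => tnth t)) => l; exact: measurable_tnth.
Qed.

Let mth n : measurable [set w | th w = n].
Proof. by have := measurable_funP th measurableT [set n] I; rewrite setTI. Qed.

(** Success is split by [th w = k.+1] and by the swapped index [j]. The index [i'] is [j] exactly
    when [i] has position [k] in [S] for the vector swapped at [j], and that vector has the law of
    [r]; each pair thus contributes [1 / m] times the mean of [ev k]. The sum over [j] in [S] gives
    the factor [rank / m]. The sum over [k < m] rebuilds the selection of [i], since an arm among
    the [m] largest has position below [m] in [S]. *)
Lemma swapped_trial_prob : mean P (fun w => (success m (CGR tie) eta L (r ^~ w) (th w) i)%:R) =
  (rank tie L i)%:R / m%:R * pick_prob r m i (fun j => eta * L j).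
Proof.
have msw j l : measurable_fun setT (fun w => swapped j w l) by exact: mr.
have gsw k j : <<s gen sys (fun=> True) >> [set w | ev k (swapped j w)].
  apply: (@mev _ (g_sigma_algebraType (gen sys (fun=> True))) k (swapped j)) => l.
  move=> _ B mB; rewrite setTI; apply: sub_sigma_algebra; exists (tperm i j l) => //.
  exact: preimage_systemP.
have mth' n : measurable [set w | th w == n].
  rewrite (_ : [set w | _] = [set w | th w = n]); first exact: mth.
  by apply/seteqP; split => w /= /eqP.
have uterm k j : unitf (fun w => (th w == k.+1)%:R * (ev k (swapped j w))%:R : R).
  by apply: unitfM; apply: unitf_bool => //; exact: mev.
have term k j : (k < m)%N -> mean P (fun w => (th w == k.+1)%:R * (ev k (swapped j w))%:R) =
    m%:R^-1 * mean P (fun w => (ev k (r ^~ w))%:R).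
  move=> km; rewrite mean_bool_indep//; [|exact: mev|].
    rewrite ev_law mean_bool//; congr (_ * _).
    rewrite (_ : [set w | _] = [set w | th w = k.+1]) ?th_law//.
    by apply/seteqP; split => w /= /eqP.
  rewrite (_ : [set w | th w == k.+1] = [set w | th w = k.+1]); first exact: ind_th.
  by apply/seteqP; split => w /= /eqP.
pose s : seq ('I_m * 'I_d) := [seq (k, j) | k <- enum 'I_m, j <- enum S].
have sumE (T : zmodType) (f : 'I_m -> 'I_d -> T) :
    \sum_(x <- s) f x.1 x.2 = \sum_(k < m) \sum_(j in S) f k j.
  rewrite big_allpairs_dep/= -[RHS]big_enum/=; apply: eq_bigr => k _.
  by rewrite big_enum.
transitivity (mean P (fun w => \sum_(x <- s) (th w == x.1.+1)%:R * (ev x.1 (swapped x.2 w))%:R)); last first.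
  rewrite mean_sum => [|x]; last exact: uterm.
  rewrite (sumE _ (fun k j => mean P (fun w => (th w == k.+1)%:R * (ev k (swapped j w))%:R))).
  transitivity (\sum_(k < m) (#|S|%:R * m%:R^-1) * mean P (fun w => (ev k (r ^~ w))%:R)).
    apply: eq_bigr => k _; rewrite -mulrA mulr_natl -sumr_const.
    by apply: eq_bigr => j _; exact: term.
  rewrite -mulr_sumr card_lower_arms; congr (_ * _).
  rewrite -mean_sum => [|k]; last by apply: unitf_bool; exact: mev.
  congr mean; apply/funext => w; rewrite /ev.
  have [al|nal] := boolP (among_largest m (fun k => r k w - eta * L k) i); last first.
    by rewrite big1// => k _; rewrite andbF.
  have nm : (nbeat_in S (r ^~ w) i < m)%N by exact: among_largest_lower al.
  rewrite (bigD1 (Ordinal nm))//= eqxx big1 ?addr0// => k kn.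
  by rewrite andbT; case: eqP => // nk; move: kn; rewrite -val_eqE/= nk eqxx.
apply: mean_ae.
- have [] // := @unitf_bool R _ _ (fun w => success m (CGR tie) eta L (r ^~ w) (th w) i).
  apply: measurable_success => [j|//|]; first exact: measurable_cst.
  exact: measurable_funP.
- by apply: measurable_sum => x; case: (uterm x.1 x.2).
- by move=> w; rewrite ler0n.
- by move=> w; apply: sumr_ge0 => x _; rewrite mulr_ge0.
(* The decomposition is exact outside two null events: a tie among the perturbations, or a value of
   [th] outside [1..m]. *)
apply: (@negligibleS _ _ _ P ([set w | ~ injective (fun j => r j w - 0)] `|` [set w | ~~ (1 <= th w <= m)%N])).
  move=> w /= H; apply: contrapT => /not_orP[/contrapT inj /negP/negPn thm]; apply: H.
  have rinj : injective (r ^~ w) by move=> j l jl; apply: inj; rewrite !subr0.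
  have thS : (0 < th w <= #|S|)%N.
    by move: thm => /andP[-> /leq_trans]; apply; rewrite card_lower_arms ltnW.
  have [j0 j0S kth] := kth_largest_ex (r ^~ w) thS.
  have [_ j0k] := (kth_largestP _ _ _ _).1 kth.
  have km : ((th w).-1 < m)%N by case/andP: thm => t0; rewrite -ltnS prednK.
  rewrite (sumE _ (fun k j => (th w == k.+1)%:R * (ev k (swapped j w))%:R)).
  rewrite (bigD1 (Ordinal km))//= [X in _ + X]big1 ?addr0 => [|k kn]; last first.
    apply: big1 => j _; case: eqP => [thk|_]; last by rewrite mul0r.
    by move: kn; rewrite -val_eqE/= thk eqxx.
  rewrite (bigD1 j0)//= [X in _ + X]big1 ?addr0 => [|j /andP[jS jj0]]; last first.
    rewrite /ev -(nbeat_in_tperm (v := swapped j w) _ iS jS); last first.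
      by move=> a b /rinj/perm_inj.
    rewrite (_ : (fun l => swapped j w (tperm i j l)) = r ^~ w); last first.
      by apply/funext => l; rewrite /swapped tpermK.
    rewrite (_ : (nbeat_in S (r ^~ w) j == (th w).-1) = false) ?andFb ?mulr0//.
    apply: contraNF jj0 => /eqP jk; apply/eqP/(nbeat_in_inj (v := r ^~ w) jS j0S).
    by rewrite jk -j0k.
  rewrite -j0k in kth *; rewrite /= eqxx mul1r /ev -(nbeat_in_tperm (v := swapped j0 w) _ iS j0S); last first.
    by move=> a b /rinj/perm_inj.
  rewrite (_ : (fun l => swapped j0 w (tperm i j0 l)) = r ^~ w); last first.
    by apply/funext => l; rewrite /swapped tpermK.
  by rewrite eqxx /success /= leqNgt m_rank/= [kth_largest _ _ _]kth.
apply: negligibleU; first exact: (ties_negligible halpha rF indr (fun=> 0)).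
have mk : forall k, measurable [set w | th w = k] by exact: mth.
have mge : measurable [set w | (1 <= th w <= m)%N].
  rewrite (_ : [set w | _] = \bigcup_(k in [set k | (1 <= k <= m)%N]) [set w | th w = k]).
    exact: bigcup_measurable.
  by apply/seteqP; split => w /=; [exists (th w)|case=> k km /= ->].
rewrite (_ : [set w | ~~ _] = ~` [set w | (1 <= th w <= m)%N]); last first.
  by apply/seteqP; split => w /negP.
apply/negligibleP; first exact: measurableC.
transitivity (1 - P [set w | (1 <= th w <= m)%N])%E; first exact: probability_setC.
transitivity (1 - 1 : \bar R)%E; last by rewrite subee.
have m0' : m%:R != 0 :> R by rewrite pnatr_eq0 -lt0n.
(* The [m] prescribed values have probability [1 / m] each, which exhausts the mass. *)
suff E1 : mean P (fun w => ((1 <= th w <= m)%N)%:R) = 1.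
  congr (1 - _)%E; rewrite -[LHS]fineK ?fin_num_measure//; congr (_%:E).
  by rewrite -E1 mean_bool.
rewrite [LHS](_ : _ = mean P (fun w => \sum_(k <- enum 'I_m) (th w == k.+1)%:R)).
  rewrite mean_sum => [|k]; last exact: unitf_bool.
  rewrite big_enum/= (eq_bigr (fun=> m%:R^-1)) => [|k _].
    by rewrite sumr_const card_ord -[LHS]mulr_natl mulfV.
  rewrite mean_bool// (_ : [set w | _] = [set w | th w = k.+1]) ?th_law//=.
  by apply/seteqP; split => w /= /eqP.
congr mean; apply/funext => w; rewrite big_enum/=; have [/andP[t0 tm]|nt] := boolP (1 <= th w <= m)%N.
  have km : ((th w).-1 < m)%N by rewrite -ltnS prednK.
  rewrite (bigD1 (Ordinal km))//= prednK// eqxx big1 ?addr0// => k kn.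
  by case: eqP => // thk; move: kn; rewrite -val_eqE/= thk eqxx.
rewrite big1// => k _; case: eqP => // thk; move: nt; rewrite thk/=.
by rewrite ltn_ord.
Qed.

End Swapped.

Lemma trial_prob (est : estimation d) :
  ((exists tie, est = CGR tie) ->
    forall A n, <<s gen sys (fun=> True) >> A -> indep_events P [set w | th w = n] A) ->
  ((exists tie, est = CGR tie) -> forall k, (1 <= k <= m)%N -> P [set w | th w = k] = (m%:R^-1)%:E) ->
  mean P (fun w => (success m est eta L (r ^~ w) (th w) i)%:R) =
  correction m est L i * pick_prob r m i (fun j => eta * L j).
Proof.
case: est => [_ _|tie ind_th th_law] /=; first by rewrite mul1r.
case: ifPn => [rm|]; last first.
  by rewrite -ltnNge => mr'; apply: swapped_trial_prob => //; [apply: ind_th|apply: th_law]; exists tie.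
by rewrite mul1r /pick_prob /success /= rm.
Qed.

End OneTrial.

(** * Moments of the number of trials *)

Section FirstSuccess.
Context {R : realType} {d0 : measure_display} {W : measurableType d0}
  (P : probability W R) (A : W -> pred nat) (p : R).
Hypothesis mA : forall s, measurable [set w | A w s].
Hypothesis p01 : 0 < p <= 1.
Hypothesis noA : forall n, P [set w | forall s, (s < n)%N -> ~~ A w s] = ((1 - p) ^+ n)%:E.
Let u := 1 - p.
Let M w := first_success (A w).

Let u01 : 0 <= u < 1. Proof. by rewrite /u; case/andP: p01 => ? ?; apply/andP; split; lra. Qed.

Let mM n : measurable [set w | M w = n]. Proof. exact: measurable_first_success. Qed.

Let mltM n : measurable [set w | (n < M w)%N].
Proof.
apply: measurable_bool; have mc : measurable_fun [set: nat] (fun k => (n < k)%N) by [].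
exact: (measurableT_comp mc (measurable_nat mM)).
Qed.

Let mno n : measurable [set w | forall s, (s < n)%N -> ~~ A w s].
Proof.
rewrite (_ : [set w | _] = \bigcap_(s in `I_n) ~` [set w | A w s]).
  by apply: fin_bigcap_measurable => [|s _]; [exact: finite_II|exact: measurableC].
by apply/seteqP; split => w /= H s sn; apply/negP; exact: H.
Qed.

(** [M w] is 0 when no trial succeeds, so this event can differ from the absence of success in [n]
    trials, but only on the null event where success never comes. *)
Let P_ltM n : P [set w | (n < M w)%N] = (u ^+ n)%:E.
Proof.
have never : P.-negligible [set w | forall s, ~~ A w s].
  have mnever : measurable [set w | forall s, ~~ A w s].
    rewrite (_ : [set w | _] = \bigcap_s ~` [set w | A w s]).
      by apply: bigcapT_measurable => s; exact: measurableC.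
    apply/seteqP; split => w /= H s; first by move=> _; exact/negP.
    by apply/negP; exact: H.
  apply/negligibleP => //; apply/eqP; rewrite eq_le measure_ge0 andbT.
  have le_u k : fine (P [set w | forall s, ~~ A w s]) <= u ^+ k.
    rewrite -lee_fin fineK ?fin_num_measure// -noA; apply: le_measure; rewrite ?inE//.
    by move=> w /= H s _.
  rewrite -[leLHS]fineK ?fin_num_measure// lee_fin.
  have cu : (fun k => u ^+ k) @ \oo --> (0 : R).
    by apply: cvg_expr; rewrite ger0_norm; case/andP: u01.
  by rewrite -(cvg_lim _ cu)//; apply: limr_ge; [exact: cvgP cu|exact: nearW].
rewrite -noA; apply/eqP; rewrite eq_le; apply/andP; split.
  apply: le_measure; rewrite ?inE// => w /=; rewrite /M /first_success.
  case: pselect => // ex; case: ex_minnP => s As smin ns k kn; apply/negP => Ak.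
  by have := smin _ Ak; rewrite leqNgt (leq_trans kn).
have [N [mN N0 HN]] := never.
rewrite -[leRHS]adde0 -N0; apply: (@le_trans _ _ (P ([set w | (n < M w)%N] `|` N))).
  apply: le_measure; rewrite ?inE//; first exact: measurableU.
  move=> w /= H; have [ex|nex] := pselect (exists s, A w s); last first.
    by right; apply: HN => s; apply/negP => As; apply: nex; exists s.
  left; rewrite /M /first_success; case: pselect => // ex'; case: ex_minnP => s As _.
  by rewrite ltnS leqNgt; apply/negP => /H; rewrite As.
exact: measureU2.
Qed.

(** Summation by tails. The weights [a n = 1] give the mean, and [a n = 2 n + 1], whose partial sums
    are squares, give the second moment. *)
Let integral_sum (a : nat -> R) : (forall n, 0 <= a n) ->
  (\int[P]_w (\sum_(0 <= n < M w) a n)%:E = \sum_(0 <= n <oo) (a n * u ^+ n)%:E)%E.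
Proof.
move=> a0; pose f n w : \bar R := (a n * \1_[set w | (n < M w)%N] w)%:E.
have f0 n w : (0 <= f n w)%E by rewrite lee_fin mulr_ge0.
have mf n : measurable_fun setT (f n).
  by apply/measurable_EFinP; apply: measurable_funM => //; exact: measurable_indic.
transitivity (\int[P]_w (\sum_(0 <= n <oo) f n w))%E.
  apply: eq_integral => w _; apply/esym/cvg_lim => //; apply: cvg_near_cst.
  exists (M w) => // N /= MN; rewrite sumEFin; congr (_%:E).
  rewrite (big_cat_nat _ MN)//= [X in _ + X]big_nat_cond [X in _ + X]big1 ?addr0; last first.
    move=> k /andP[/andP[Mk _] _]; rewrite indicE memNset ?mulr0//=.
    by apply/negP; rewrite -leqNgt.
  by apply: eq_big_nat => k /andP[_ kM]; rewrite indicE mem_set ?mulr1.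
rewrite integral_nneseries//; apply: eq_eseriesr => n _.
rewrite /f; under eq_integral do rewrite EFinM.
rewrite ge0_integralZl ?lee_fin//; last exact/measurable_EFinP/measurable_indic.
rewrite integral_indic// setIT EFinM; congr (_ * _)%E; exact: P_ltM.
Qed.

Lemma integral_first_success : (\int[P]_w ((M w)%:R)%:E = (p^-1)%:E)%E.
Proof.
have := integral_sum (fun=> ler01); under eq_integral do rewrite sumr_const_nat subn0 -mulr_natl mulr1.
move=> ->; apply/cvg_lim => //.
have : series (geometric 1 u) @ \oo --> (1 * (1 - u)^-1).
  by apply: cvg_geometric_series; rewrite ger0_norm; case/andP: u01.
rewrite mul1r (_ : 1 - u = p); last by rewrite /u; lra.
move=> H; rewrite (_ : (fun n => _) = EFin \o series (geometric 1 u)); last first.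
  by apply/funext => n /=; rewrite sumEFin.
by apply/fine_cvgP; split; [exact: nearW|exact: H].
Qed.

Lemma integral_first_success_sqr : (\int[P]_w ((M w)%:R ^+ 2)%:E <= (2 / p ^+ 2)%:E)%E.
Proof.
have a0 n : 0 <= (n.*2.+1)%:R :> R by [].
have sqrE n : \sum_(0 <= k < n) (k.*2.+1)%:R = n%:R ^+ 2 :> R.
  elim: n => [|n IH]; first by rewrite big_geq// expr0n.
  by rewrite big_nat_recr//= IH -muln2 -!natr1 natrM; ring.
have := integral_sum a0; under eq_integral do rewrite sqrE.
move=> ->; apply: lime_le.
  by apply: is_cvg_nneseries => n _ _; rewrite lee_fin mulr_ge0// exprn_ge0//; case/andP: u01.
apply: nearW => n; rewrite sumEFin lee_fin.
have /andP[p0 p1] := p01; have /andP[u0 u1] := u01.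
rewrite ler_pdivlMr ?exprn_gt0//.
(* Closed form of an arithmetic-geometric sum; the subtracted term is nonnegative and
   [1 + u <= 2]. *)
have -> : (\sum_(0 <= k < n) (k.*2.+1)%:R * u ^+ k) * p ^+ 2 =
    (1 + u) - u ^+ n * (n.*2.+1%:R - (n.*2%:R - 1) * u).
  have -> : p = 1 - u by rewrite /u; lra.
  elim: n => [|n IH]; first by rewrite big_geq// expr0 double0; ring.
  have E1 : n.+1.*2%:R = n.*2%:R + 2 :> R by rewrite doubleS -addn2 natrD.
  rewrite big_nat_recr//= mulrDl IH (exprS u n) -(natr1 n.+1.*2) E1 -(natr1 n.*2).
  by move: (n.*2%:R) (u ^+ n) u => x y z; ring.
have : 0 <= u ^+ n * (n.*2.+1%:R - (n.*2%:R - 1) * u).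
  rewrite mulr_ge0 ?exprn_ge0// -natr1.
  have : 0 <= (n.*2%:R : R) * (1 - u) by rewrite mulr_ge0// subr_ge0 ltW.
  by lra.
by rewrite /u; lra.
Qed.

End FirstSuccess.

(** * The game *)

Section Game.
Context {R : realType} {D : law_family} {alpha : R} (halpha : 1 < alpha)
  {d m : nat} {est : estimation d} {disp : measure_display} {W : measurableType disp}
  {P : probability W R} {disp' : measure_display} {E : measurableType disp'}
  {N : noise P E d}.
Hypotheses (m0 : (0 < m)%N) (hN : noise_law m D alpha est N).

(** Restricted to the sources used by the estimator, because [noise_law] asserts independence for
    these alone. *)
Definition sources (Q : source d -> Prop) : set (set W) :=
  gen (I := {classic (source d)}) (source_events N) (fun x => Q x /\ used est x).

Lemma source_eventsT x : source_events N x setT.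
Proof. by case: x => [|t i|t s i|t s] /=; exact: preimage_systemT. Qed.

Lemma source_eventsI x : setI_closed (source_events N x).
Proof. by case: x => [|t i|t s i|t s] /=; exact: preimage_systemI. Qed.

Lemma source_events_meas x : source_events N x `<=` measurable.
Proof. by case: x => [|t i|t s i|t s] /=; exact: preimage_systemS. Qed.

Lemma sources_meas Q : <<s sources Q >> `<=` measurable.
Proof. by apply: gen_measurable; exact: source_events_meas. Qed.

Lemma sources_sub Q Q' : (forall x, Q x -> Q' x) -> <<s sources Q >> `<=` <<s sources Q' >>.
Proof. by move=> QQ'; apply: gen_sub => x [/QQ' ? ?]. Qed.

Lemma sources_gen Q x : Q x -> used est x -> source_events N x `<=` <<s sources Q >>.
Proof. by move=> Qx ux A FA; apply: sub_sigma_algebra; exists x. Qed.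

Lemma sources_indep Q Q' : (forall x, Q x -> ~ Q' x) ->
  forall A A', <<s sources Q >> A -> <<s sources Q' >> A' -> indep_events P A A'.
Proof.
move=> QQ'; have [ind _ _ _] := hN.
apply: (@gen_indep _ _ _ P {classic (source d)} (source_events N) (used est)
  source_eventsT source_eventsI source_events_meas ind) => x [Qx ux] //.
by move=> [Q'x _]; exact: QQ' Qx Q'x.
Qed.

Lemma measurable_source d1 (T : measurableType d1) (f : W -> T) Q x : Q x -> used est x ->
  source_events N x = preimage_set_system setT f measurable ->
  measurable_fun [set: g_sigma_algebraType (sources Q)] f.
Proof.
move=> Qx ux xf _ B mB; rewrite setTI; apply: (sources_gen Qx ux).
by rewrite xf; exact: preimage_systemP.
Qed.

Let ind_family (h : 'I_d -> source d) : injective h -> (forall j, used est (h j)) ->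
  mutually_independent P (fun=> True) (source_events N \o h).
Proof.
by move=> hinj hu; have [ind _ _ _] := hN; apply: (mutually_independent_comp hinj _ ind).
Qed.

Lemma perturb_indep t : mutually_independent P (fun=> True)
  (fun j => preimage_set_system setT (perturb N t j) measurable).
Proof. by apply: (@ind_family (Perturb t)) => // i j []. Qed.

Lemma resample_indep t s : mutually_independent P (fun=> True)
  (fun j => preimage_set_system setT (resample N t s j) measurable).
Proof. by apply: (@ind_family (Resample t s)) => // i j []. Qed.

(** Round 0 is a reference copy: by [pick_prob_law] the perturbations of every round and all
    resampled vectors give the same function. *)
Definition phi i (l : 'I_d -> R) := pick_prob (perturb N 0) m i l.

Lemma pick_prob_law (X : 'I_d -> {RV P >-> R}) i l : (forall i, has_law D alpha (X i)) ->
  mutually_independent P (fun=> True) (fun j => preimage_set_system setT (X j) measurable) ->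
  pick_prob X m i l = phi i l.
Proof.
have [_ pF _ _] := hN; move=> XF indX.
have iX := iid_of_indep XF (pF 0%N i) indX.
have iY := iid_of_indep (pF 0%N) (pF 0%N i) (@perturb_indep 0%N).
apply: (mean_vec_law (e := fun v => among_largest m (fun k => v k - l k) i) iX iY).
apply: measurable_among_largest => k; apply: measurable_funB; last exact: measurable_cst.
exact: measurable_tnth.
Qed.

Section Estimate.
Variables (t : nat) (eta : R) (L : 'I_d -> R) (i : 'I_d).
Hypothesis eta0 : 0 <= eta.

Let A w s := success m est eta L (fun j => resample N t s j w) (theta N t s w) i.
Let q := phi i (fun j => eta * L j).
Let corr := correction m est L i.
Let p := corr * q.

Let at_step (s : nat) (x : source d) : Prop := match x with
  | Resample t' s' _ => t' = t /\ s' = s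
  | Theta t' s' => t' = t /\ s' = s
  | _ => False
  end.

Let A_event s : <<s sources (at_step s) >> [set w | A w s].
Proof.
apply: (@measurable_success _ (g_sigma_algebraType (sources (at_step s))) R d m est eta
  (fun=> L) (fun w j => resample N t s j w) (theta N t s) i).
- by move=> j; exact: measurable_cst.
- by move=> j; apply: (@measurable_source _ _ _ _ (Resample t s j)).
- case estE : est => [//|tie].
  by apply: (@measurable_source _ _ (theta N t s) _ (Theta d t s)); rewrite ?estE.
Qed.

Let A_meas s : measurable [set w | A w s].
Proof. exact: sources_meas (@A_event s). Qed.

Let A_prob s : mean P (fun w => (A w s)%:R) = p.
Proof.
have [ind _ rF thF] := hN.
rewrite /p /q -(pick_prob_law i (fun j => eta * L j) (rF t s) (@resample_indep t s)).
apply: (trial_prob halpha (rF t s) (@resample_indep t s) L i m0 eta0) => [estC|]; last first.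
  by move=> /thF; exact.
move=> B n gB.
apply: (@sources_indep (eq (Theta d t s)) (fun x => if x is Resample t' s' _ then t' = t /\ s' = s else False)).
- by move=> x <-.
- apply: (@sources_gen _ (Theta d t s)) => //; first by case: estC => tie ->.
  by exists [set n] => //; rewrite setTI.
move: gB; apply: sub_sigma_algebra2 => C [j _ FC]; exists (Resample t s j) => //.
Qed.

Let p01 : 0 <= p <= 1.
Proof. by rewrite -(A_prob 0%N); apply: mean_unit; exact: unitf_bool. Qed.

(** Step [n] reads sources disjoint from those of the steps before it, so each failure contributes
    an independent factor [1 - p]. *)
Let noA n : P [set w | forall s, (s < n)%N -> ~~ A w s] = ((1 - p) ^+ n)%:E.
Proof.
have PnA s : P [set w | ~~ A w s] = (1 - p)%:E.
  rewrite (_ : [set w | _] = ~` [set w | A w s]); last by apply/seteqP; split => w /= /negP.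
  transitivity (1 - P [set w | A w s])%E; first exact: probability_setC.
  rewrite EFinB; congr (1 - _)%E; rewrite -(A_prob s) mean_bool// fineK// fin_num_measure//.
pose before n x := exists2 s, (s < n)%N & at_step s x.
have no_event k : <<s sources (before k) >> [set w | forall s, (s < k)%N -> ~~ A w s].
  rewrite (_ : [set w | _] = \bigcap_(s in `I_k) ~` [set w | A w s]); last first.
    by apply/seteqP; split => w /= H s sn; apply/negP; exact: H.
  apply: (@fin_bigcap_measurable _ (g_sigma_algebraType (sources (before k)))) => [|s /= sk]; first exact: finite_II.
  apply: measurableC; move: (@A_event s); apply: sources_sub => x xs; by exists s.
elim: n => [|n IH].
  by rewrite expr0 -(probability_setT P); congr (P _); apply/seteqP; split.
rewrite (_ : [set w | _] = [set w | ~~ A w n] `&` [set w | forall s, (s < n)%N -> ~~ A w s]); last first.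
  apply/seteqP; split => w /=.
    by move=> H; split; [exact: H|move=> s sn; apply: H; exact: leqW].
  by move=> [An H] s; rewrite ltnS leq_eqVlt => /predU1P[->//|/H].
rewrite exprS EFinM -IH -(PnA n); apply: (@sources_indep (at_step n) (before n)).
- case=> [|t' i'|t' s' i'|t' s'] //= [_ ->] [k kn [_ nk]];
  by move: kn; rewrite nk ltnn.
- rewrite (_ : [set w | _] = ~` [set w | A w n]); last by apply/seteqP; split => w /= /negP.
  apply: (@measurableC _ (g_sigma_algebraType (sources (at_step n)))); exact: A_event.
- exact: no_event.
Qed.

Let corr_gt0 : 0 < corr.
Proof.
rewrite /corr; case: est => [|tie] /=; first exact: ltr01.
by case: ifPn => _; [exact: ltr01|rewrite divr_gt0// ltr0n// rank_gt0].
Qed.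

Definition estimate w := inv_prob_estimate m est eta L
  (fun s j => resample N t s j w) (fun s => theta N t s w) i.

Lemma estimate_ge0 w : 0 <= estimate w.
Proof. by rewrite mulr_ge0// ltW. Qed.

Let q_gt0 : 0 < q -> 0 < p <= 1.
Proof. by move=> q0; rewrite mulr_gt0//=; case/andP: p01. Qed.

Let estimateE : estimate = fun w => corr * (first_success (A w))%:R. Proof. by []. Qed.

Let mM : measurable_fun setT (fun w => (first_success (A w))%:R : R).
Proof. by apply: measurable_natr; exact: measurable_first_success. Qed.

Lemma integral_estimate : 0 < q -> (\int[P]_w (estimate w)%:E = (q^-1)%:E)%E.
Proof.
move=> q0; rewrite estimateE; under eq_integral do rewrite EFinM.
rewrite ge0_integralZl//; [|exact/measurable_EFinP|by rewrite lee_fin ltW].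
rewrite (integral_first_success A_meas (q_gt0 q0) noA) -EFinM; congr (_%:E).
by rewrite /p invfM mulrA mulfV ?mul1r// gt_eqF.
Qed.

Lemma integral_estimate_sqr : 0 < q -> (\int[P]_w (estimate w ^+ 2)%:E <= (2 / q ^+ 2)%:E)%E.
Proof.
move=> q0; rewrite estimateE; under eq_integral do rewrite exprMn EFinM.
rewrite ge0_integralZl//; last 2 first.
- by apply/measurable_EFinP; exact: (measurableT_comp (exprn_measurable 2)).
- by rewrite lee_fin exprn_ge0// ltW.
apply: (@le_trans _ _ ((corr ^+ 2)%:E * (2 / p ^+ 2)%:E)%E).
  rewrite lee_wpmul2l ?lee_fin ?exprn_ge0// ?(ltW corr_gt0)//.
  exact: (integral_first_success_sqr A_meas (q_gt0 q0) noA).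
rewrite -EFinM lee_fin /p exprMn le_eqVlt; apply/orP; left; apply/eqP.
by field; rewrite !gt_eqF.
Qed.

End Estimate.

End Game.

(** * Separation of the past from the noise of the current round *)

Section Dynamics.
Context {R : realType} {D : law_family} {alpha : R} (halpha : 1 < alpha)
  {d m : nat} {est : estimation d} {disp : measure_display} {W : measurableType disp}
  {P : probability W R} {disp' : measure_display} {E : measurableType disp'}
  {N : noise P E d}.
Hypotheses (md : (0 < m <= d)%N) (hN : noise_law m D alpha est N).
Variables (eta : nat -> R) (loss : nat -> W -> 'I_d -> R).
Hypothesis eta0 : forall t, 0 < eta t.
Let act := ftpl_action m eta est N loss.
Let Lh := ftpl_Lhat m eta est N loss.
Hypothesis adv : adversarial (source_events N (Seed d)) loss act.

Let m0 : (0 < m)%N. Proof. by case/andP: md. Qed.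

Definition past (t : nat) (x : source d) : Prop := match x with
  | Seed => True
  | Perturb s _ => (s < t)%N
  | Resample s _ _ => (s < t)%N
  | Theta s _ => (s < t)%N
  end.

Definition now (t : nat) (x : source d) : Prop := match x with
  | Seed => False
  | Perturb s _ => s = t
  | Resample s _ _ => s = t
  | Theta s _ => s = t
  end.

Local Notation srcs Q := (sources (est := est) (N := N) Q).
Local Notation sT Q := (g_sigma_algebraType (srcs Q)).

Lemma pastS t x : past t x -> past t.+1 x.
Proof. by case: x => [|s i|s s' i|s s'] //=; exact: ltnW. Qed.

Lemma now_pastS t x : now t x -> past t.+1 x.
Proof. by case: x => [|s i|s s' i|s s'] //= ->. Qed.

Lemma past_now t x : past t x -> ~ now t x.
Proof. by case: x => [_ []|s i|s s' i|s s'] /= + st; rewrite st ltnn. Qed.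

Lemma measurable_sub_sources d1 (T : measurableType d1) (f : W -> T) (Q Q' : source d -> Prop) :
  (forall x, Q x -> Q' x) ->
  measurable_fun [set: sT Q] f -> measurable_fun [set: sT Q'] f.
Proof.
move=> QQ' mf mD B mB; apply: (sources_sub QQ'); exact: (mf measurableT B mB).
Qed.

Lemma measurable_of_sources d1 (T : measurableType d1) (f : W -> T) (Q : source d -> Prop) :
  measurable_fun [set: sT Q] f -> measurable_fun setT f.
Proof. by move=> mf mD B mB; exact: sources_meas (mf measurableT B mB). Qed.

Section RoundInputs.
Context {d0 : measure_display} {Z : measurableType d0} (t : nat) (Q : source d -> Prop).
Variables (L l : Z -> 'I_d -> R) (w2 : Z -> W).
Hypotheses (mL : forall i, measurable_fun setT (L ^~ i)) (ml : forall i, measurable_fun setT (l ^~ i)).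
Hypothesis mw2 : measurable_fun setT (w2 : Z -> sT Q).
Hypothesis QP : forall j, Q (Perturb t j).
Hypothesis QR : forall s j, Q (Resample t s j).
Hypothesis QT : forall s, Q (Theta d t s).

(** The noise is read through [w2], apart from the argument carrying the estimated losses. The same
    lemma then serves a single outcome space ([w2] the identity) and the product of past and present
    ([w2] the second projection). *)
Lemma measurable_choice_in i :
  measurable [set z | i \in ftpl_choice m eta N t (w2 z) (L z)].
Proof using mL mw2 QP.
pose b z (a : {set 'I_d}) := ftpl_choice m eta N t (w2 z) (L z) == a.
apply: (@measurable_factor _ _ _ b) => [a|z z' zz']; last first.
  by have := zz' (ftpl_choice m eta N t (w2 z) (L z)); rewrite /b eqxx => /esym/eqP ->.
rewrite (_ : [set z | _] = [set z | ftpl_choice m eta N t (w2 z) (L z) = a]); last first.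
  by apply/seteqP; split => z /= /eqP.
apply: measurable_argmin_action => j; apply: measurable_funB; first exact: measurable_funM.
have mp : measurable_fun [set: sT Q] (perturb N t j).
  exact: (measurable_source (x := Perturb t j)).
exact: (measurableT_comp mp mw2).
Qed.

Lemma measurable_round_estimate i : measurable_fun setT (fun z => inv_prob_estimate m est (eta t) (L z)
  (fun s j => resample N t s j (w2 z)) (fun s => theta N t s (w2 z)) i).
Proof using mL mw2 QR QT.
apply: (@measurable_inv_prob_estimate _ Z R d m est (eta t) L
  (fun z s j => resample N t s j (w2 z)) (fun z s => theta N t s (w2 z))) => // [s j|].
  have mr : measurable_fun [set: sT Q] (resample N t s j).
    exact: (measurable_source (x := Resample t s j)).
  exact: (measurableT_comp mr mw2).
case estE : est => [//|tie] s.
have mth : measurable_fun [set: sT Q] (theta N t s).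
  by apply: (measurable_source (x := Theta d t s)); rewrite ?estE.
exact: (measurableT_comp mth mw2).
Qed.

End RoundInputs.

Section Increment.
Context {d0 : measure_display} {Z : measurableType d0} (t : nat) (Q : source d -> Prop).
Variables (L l : Z -> 'I_d -> R) (w2 : Z -> W).

Definition increment (z : Z) i := (i \in ftpl_choice m eta N t (w2 z) (L z))%:R * l z i *
  inv_prob_estimate m est (eta t) (L z)
    (fun s j => resample N t s j (w2 z)) (fun s => theta N t s (w2 z)) i.

Lemma measurable_increment i :
  (forall i, measurable_fun setT (L ^~ i)) -> (forall i, measurable_fun setT (l ^~ i)) ->
  measurable_fun setT (w2 : Z -> sT Q) -> (forall x, now t x -> Q x) ->
  measurable_fun setT (increment ^~ i).
Proof.
move=> mL ml mw2 nQ; apply: measurable_funM; last first.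
  by apply: (@measurable_round_estimate _ _ t Q) => // *; exact: nQ.
apply: measurable_funM => //.
have mc : measurable [set z | i \in ftpl_choice m eta N t (w2 z) (L z)].
  by apply: (@measurable_choice_in _ _ t Q) => // *; exact: nQ.
by have [] := @unitf_bool R _ _ _ mc.
Qed.

End Increment.

Lemma measurable_phi (d0 : measure_display) (Z : measurableType d0) (l : Z -> 'I_d -> R) i :
  (forall j, measurable_fun setT (l ^~ j)) ->
  measurable_fun setT (fun z => phi (m := m) (N := N) i (l z)).
Proof.
move=> ml; pose g (z : Z * W) : bool := among_largest m (fun k => perturb N 0 k z.2 - l z.1 k) i.
have mg : measurable [set z | g z].
  apply: measurable_among_largest => k; apply: measurable_funB.
    exact: (measurableT_comp (measurable_funP (perturb N 0 k)) measurable_snd).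
  exact: (measurableT_comp (ml k) measurable_fst).
apply/measurable_EFinP.
rewrite (_ : _ \o _ = fun z => (\int[P]_w (g (z, w))%:R%:E)%E); last first.
  apply/funext => z /=; rewrite -meanE//; apply: unitf_bool.
  change (measurable [set w | among_largest m (fun k => perturb N 0 k w - l z k) i]).
  apply: measurable_among_largest => k; apply: measurable_funB; last exact: measurable_cst.
  exact: measurable_funP.
apply: (@measurable_fun_fubini_tonelli_F _ _ _ _ _ P (fun z => (g z)%:R%:E)) => [|z]; last by rewrite lee_fin.
by apply/measurable_EFinP; case: (@unitf_bool R _ _ _ mg).
Qed.

Let history (t : nat) :=
  [/\ forall i, measurable_fun [set: sT (past t)] (fun w => Lh t w i),
      forall s i, (s < t)%N -> measurable_fun [set: sT (past t)] (fun w => loss s w i) &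
      forall s a, (s < t)%N -> <<s srcs (past t) >> [set w | act s w = a]].

(** The loss of round [t] is measurable for the seed and the earlier losses and actions; by
    [history] each of these generators depends on sources before [t] only. *)
Let history_loss t : history t -> forall i, measurable_fun [set: sT (past t)] (fun w => loss t w i).
Proof.
move=> [_ hl ha] i _ B mB; rewrite setTI; have [_ advm] := adv.
have : past_events (source_events N (Seed d)) loss act t ((fun w => loss t w i) @^-1` B).
  by apply: advm; exact: preimage_systemP.
apply: smallest_sub.
  exact: (@sigma_algebra_measurable _ (sT (past t))).
move=> A [SA|[s [j [st [C mC <-]]]]|[s [a [st ->]]]].
- exact: (@sources_gen _ _ _ _ _ _ _ _ _ (past t) (Seed d)).
- exact: (hl s j st measurableT C mC).
- exact: ha.
Qed.

Let choice_past t : history t -> forall i,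
  <<s srcs (past t.+1) >> [set w | i \in act t w].
Proof.
move=> ht i; have [hL _ _] := ht.
apply: (@measurable_choice_in _ (sT (past t.+1)) t (past t.+1) (Lh t) id) => [j||j].
- exact: measurable_sub_sources (@pastS t) (hL j).
- exact: measurable_id.
- exact: ltnSn.
Qed.

Lemma historyP t : history t.
Proof.
elim: t => [|t ht].
  by split => // i; exact: measurable_cst.
have [hL hl ha] := ht; have hlt := history_loss ht.
split=> [i|s i|s a].
- apply: measurable_funD; first exact: measurable_sub_sources (@pastS t) (hL i).
  apply: (@measurable_increment _ (sT (past t.+1)) t (past t.+1) (Lh t) (loss t) id) => [j|j||].
  + exact: measurable_sub_sources (@pastS t) (hL j).
  + exact: measurable_sub_sources (@pastS t) (hlt j).
  + exact: measurable_id.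
  + exact: now_pastS.
- rewrite ltnS leq_eqVlt => /predU1P[->|st].
    exact: measurable_sub_sources (@pastS t) (hlt i).
  exact: measurable_sub_sources (@pastS t) (hl s i st).
rewrite ltnS leq_eqVlt => /predU1P[->|st].
  rewrite (_ : [set w | _] = [set w | act t w == a]); last first.
    by apply/seteqP; split => w /= /eqP.
  apply: (@measurable_factor _ (sT (past t.+1)) _ (fun w i => i \in act t w)) => [i|w w' ww'].
    exact: choice_past.
  by congr (_ == _); apply/setP => i; exact: ww'.
exact: (sources_sub (@pastS t)) (ha s a st).
Qed.

Lemma Lhat_measurable t i : measurable_fun [set: sT (past t)] (fun w => Lh t w i).
Proof. by have [+ _ _] := historyP t; apply. Qed.

Lemma loss_measurable t i : measurable_fun [set: sT (past t)] (fun w => loss t w i).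
Proof. exact: history_loss (historyP t) i. Qed.

Lemma act_measurable t i : measurable [set w | i \in act t w].
Proof. exact: sources_meas (@choice_past t (historyP t) i). Qed.

(** The two random elements are both the identity of [W], seen with the sigma-algebra of the past
    and with that of the current round; independence of the sigma-algebras is independence of these
    maps. *)
Lemma round_decoupling t (g : sT (past t) * sT (now t) -> \bar R) :
  measurable_fun setT g -> (forall z, 0 <= g z)%E ->
  (\int[P]_w g (w, w) = \int[P]_w1 \int[P]_w2 g (w1, w2))%E.
Proof.
move=> mg g0.
have mid Q : measurable_fun [set: W] (id : W -> sT Q).
  by apply: measurable_of_sources; exact: measurable_id.
apply: (@integral_indep _ _ _ P _ _ (sT (past t)) (sT (now t)) id id g (mid _) (mid _) _ mg g0).1.
by move=> A B mA mB; apply: (sources_indep hN (@past_now t)).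
Qed.

Lemma integral_sources_prod Q Q' (f g : W -> \bar R) : (forall x, Q x -> ~ Q' x) ->
  measurable_fun [set: sT Q] f -> measurable_fun [set: sT Q'] g ->
  (forall w, 0 <= f w)%E -> (forall w, 0 <= g w)%E ->
  (\int[P]_w (f w * g w) = \int[P]_w f w * \int[P]_w g w)%E.
Proof.
move=> QQ' mf mg f0 g0.
have mid Q0 : measurable_fun [set: W] (id : W -> sT Q0).
  by apply: measurable_of_sources; exact: measurable_id.
have mfg : measurable_fun [set: sT Q * sT Q'] (fun z => f z.1 * g z.2)%E.
  apply: emeasurable_funM; first exact: (measurableT_comp mf measurable_fst).
  exact: (measurableT_comp mg measurable_snd).
rewrite (@integral_indep _ _ _ P _ _ (sT Q) (sT Q') id id (fun z => f z.1 * g z.2)%E (mid _) (mid _) _ mfg _).1/=.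
- have mgW : measurable_fun [set: W] g by exact: measurable_of_sources mg.
  have mfW : measurable_fun [set: W] f by exact: measurable_of_sources mf.
  under eq_integral do rewrite ge0_integralZl//.
  by rewrite ge0_integralZr// integral_ge0.
- by move=> A B mA mB; apply: (sources_indep hN QQ').
- by move=> z; rewrite mule_ge0.
Qed.

Section FixedLosses.
Variables (t : nat) (L : 'I_d -> R) (i : 'I_d).
Let ch w : bool := i \in ftpl_choice m eta N t w L.
Let q := phi (m := m) (N := N) i (fun j => eta t * L j).
Let es w := inv_prob_estimate m est (eta t) L
  (fun s j => resample N t s j w) (fun s => theta N t s w) i.

Let action_source (x : source d) := if x is Perturb s _ then s = t else False.
Let estimate_source (x : source d) := match x with
  | Resample s _ _ => s = t
  | Theta s _ => s = t
  | _ => False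
  end.

Let ch_sources : <<s srcs action_source >> [set w | ch w].
Proof.
apply: (@measurable_choice_in _ (sT action_source) t action_source (fun=> L) id) => //.
Qed.

Let ch_meas : measurable [set w | ch w].
Proof. exact: sources_meas ch_sources. Qed.

Let es_sources : measurable_fun [set: sT estimate_source] es.
Proof.
apply: (@measurable_round_estimate _ (sT estimate_source) t estimate_source (fun=> L) id) => //.
Qed.

Let es0 w : 0 <= es w.
Proof. exact: estimate_ge0. Qed.

Let q01 : 0 <= q <= 1.
Proof.
apply: mean_unit; apply: unitf_bool; apply: measurable_among_largest => k.
by apply: measurable_funB => //; exact: measurable_funP.
Qed.

Lemma mean_choice : mean P (fun w => (ch w)%:R) = q.
Proof.
have [_ pF _ _] := hN.
rewrite /q -(pick_prob_law hN i (fun j => eta t * L j) (pF t) (perturb_indep hN (t := t))).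
apply: mean_ae.
- by have [] := unitf_bool (R := R) ch_meas.
- have [] // := @unitf_bool R _ W (fun w => among_largest m (fun k => perturb N t k w - eta t * L k) i).
  apply: measurable_among_largest => k.
  by apply: measurable_funB => //; exact: measurable_funP.
- by move=> w; rewrite ler0n.
- by move=> w; rewrite ler0n.
apply: negligibleS (ties_negligible halpha (pF t) (perturb_indep hN (t := t)) (fun k => eta t * L k)).
move=> w /= neq inj; apply: neq; congr (_%:R); rewrite /ch /ftpl_choice.
rewrite (argmin_actionE (x := fun k => perturb N t k w - eta t * L k)) ?inE//.
  by case/andP: md.
by move=> k; rewrite opprB.
Qed.

Lemma integral_choice : (\int[P]_w ((ch w)%:R)%:E = q%:E)%E.
Proof. by rewrite -mean_choice meanE//; exact: unitf_bool. Qed.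

Let prodE (f : R -> R) : measurable_fun setT f -> (forall x, 0 <= x -> 0 <= f x) ->
  (\int[P]_w ((ch w)%:R * f (es w))%:E = q%:E * \int[P]_w (f (es w))%:E)%E.
Proof.
move=> mf f0; under eq_integral do rewrite EFinM.
rewrite (@integral_sources_prod action_source estimate_source) ?integral_choice//.
- by case=> [|s j|s s' j|s s'] //= _ [].
- apply/measurable_EFinP.
  by have [] := @unitf_bool R _ (sT action_source) _ ch_sources.
- by apply/measurable_EFinP; exact: (measurableT_comp mf).
- by move=> w; rewrite lee_fin f0.
Qed.

(** The choice reads the perturbations and the estimate reads the resampling noise, so the mean
    factors into [q] and [1 / q]. If [q = 0] the product is 0, hence the indicator. *)
Lemma integral_choice_estimate : (\int[P]_w ((ch w)%:R * es w)%:E = ((0 < q)%R%:R)%:E)%E.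
Proof.
have mid : measurable_fun setT (id : R -> R) by exact: measurable_id.
rewrite (prodE mid)//.
have /andP[q0 _] := q01; have [qp|qn] := ltP 0 q; last first.
  by rewrite (_ : q = 0) ?mul0e//; apply/eqP; rewrite eq_le qn.
rewrite (integral_estimate halpha (proj1 (andP md)) hN t (ltW (eta0 t)) qp) -EFinM.
by rewrite mulfV// gt_eqF.
Qed.

Lemma integral_choice_estimate_sqr : (\int[P]_w ((ch w)%:R * es w ^+ 2)%:E <= (2 / q)%:E)%E.
Proof.
have msq : measurable_fun setT (fun x : R => x ^+ 2) by exact: exprn_measurable.
rewrite (prodE msq) => [|x _]; last exact: sqr_ge0.
have /andP[q0 _] := q01; have [qp|qn] := ltP 0 q; last first.
  (* For [q = 0] both sides are 0, since division by 0 gives 0. *)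
  by rewrite (_ : q = 0) ?mul0e ?invr0 ?mulr0//; apply/eqP; rewrite eq_le qn.
apply: (@le_trans _ _ (q%:E * (2 / q ^+ 2)%:E)%E).
  rewrite lee_wpmul2l ?lee_fin//.
  exact: (integral_estimate_sqr halpha (proj1 (andP md)) hN t (ltW (eta0 t)) qp).
by rewrite -EFinM lee_fin le_eqVlt; apply/orP; left; apply/eqP; field; rewrite gt_eqF.
Qed.

End FixedLosses.

Definition est_loss t w i := increment t (Lh t) (loss t) id w i.
Definition choice_prob t w i := phi (m := m) (N := N) i (fun j => eta t * Lh t w j).

Lemma LhatS t w i : Lh t.+1 w i = Lh t w i + est_loss t w i.
Proof. by []. Qed.

Let l01 t w i : 0 <= loss t w i <= 1.
Proof. by have [+ _] := adv; apply. Qed.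

Lemma loss_ge0 t w i : 0 <= loss t w i. Proof. by case/andP: (l01 t w i). Qed.

Lemma est_loss_ge0 t w i : 0 <= est_loss t w i.
Proof. by rewrite mulr_ge0 ?estimate_ge0// mulr_ge0// loss_ge0. Qed.

Lemma choice_prob_ge0 t w i : 0 <= choice_prob t w i.
Proof. exact: mean_ge0. Qed.

Lemma measurable_choice_prob t i : measurable_fun [set: sT (past t)] (choice_prob t ^~ i).
Proof.
apply: (@measurable_phi _ (sT (past t)) (fun w j => eta t * Lh t w j) i) => j.
by apply: measurable_funM; [exact: measurable_cst|exact: Lhat_measurable].
Qed.

Let mfst t d1 (T : measurableType d1) (f : W -> T) : measurable_fun [set: sT (past t)] f ->
  measurable_fun [set: sT (past t) * sT (now t)] (fun z => f z.1).
Proof. by move=> mf; exact: (measurableT_comp mf measurable_fst). Qed.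

(** A weight known before the round is frozen with the past and leaves the inner integral. *)
Let decouple t (c : W -> R) (f : sT (past t) * sT (now t) -> R) :
  measurable_fun [set: sT (past t)] c -> measurable_fun setT f ->
  (forall w, 0 <= c w) -> (forall z, 0 <= f z) ->
  (\int[P]_w (c w * f (w, w))%:E = \int[P]_w1 ((c w1)%:E * \int[P]_w2 (f (w1, w2))%:E))%E.
Proof.
move=> mc mf c0 f0; pose g (z : sT (past t) * sT (now t)) := (c z.1 * f z)%:E.
have mg : measurable_fun setT g.
  by apply/measurable_EFinP; apply: measurable_funM => //; exact: mfst.
rewrite (round_decoupling mg) => [|z]; last by rewrite lee_fin mulr_ge0.
apply: eq_integral => w1 _; rewrite /g/=; under eq_integral do rewrite EFinM.
rewrite ge0_integralZl//; [|by move=> w _; rewrite lee_fin|by rewrite lee_fin].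
apply/measurable_EFinP; apply: (measurable_of_sources (Q := now t)).
exact: (measurableT_comp (measurable_fun_pair2 (w1 : sT (past t)) mf)).
Qed.

Let mchoice t i : measurable [set z : sT (past t) * sT (now t) |
  i \in ftpl_choice m eta N t z.2 (Lh t z.1)].
Proof.
apply: (@measurable_choice_in _ (sT (past t) * sT (now t))%type t (now t) (fun z => Lh t z.1) (fun z => z.2)) => [j||//].
  exact: (mfst (@Lhat_measurable t j)).
exact: measurable_snd.
Qed.

Let mestimate t i : measurable_fun [set: sT (past t) * sT (now t)]
  (fun z => inv_prob_estimate m est (eta t) (Lh t z.1)
    (fun s j => resample N t s j z.2) (fun s => theta N t s z.2) i).
Proof.
apply: (@measurable_round_estimate _ (sT (past t) * sT (now t))%type t (now t) (fun z => Lh t z.1) (fun z => z.2)) => [j||//|//].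
  exact: (mfst (@Lhat_measurable t j)).
exact: measurable_snd.
Qed.

Let chR t i (z : sT (past t) * sT (now t)) : R := (i \in ftpl_choice m eta N t z.2 (Lh t z.1))%:R.

Let esR t i (z : sT (past t) * sT (now t)) : R := inv_prob_estimate m est (eta t) (Lh t z.1)
    (fun s j => resample N t s j z.2) (fun s => theta N t s z.2) i.

Let mchR t i : measurable_fun setT (@chR t i).
Proof. by have [] := @unitf_bool R _ _ _ (@mchoice t i). Qed.

Let chR0 t i z : 0 <= @chR t i z. Proof. exact: ler0n. Qed.

Let esR0 t i z : 0 <= @esR t i z. Proof. exact: estimate_ge0. Qed.

Lemma integral_act t i (c : W -> R) : measurable_fun [set: sT (past t)] c -> (forall w, 0 <= c w) ->
  (\int[P]_w (c w * (i \in act t w)%:R)%:E = \int[P]_w (c w * choice_prob t w i)%:E)%E.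
Proof.
move=> mc c0; rewrite (@decouple t c (@chR t i) mc (@mchR t i) c0 (@chR0 t i)).
apply: eq_integral => w _; rewrite EFinM; congr (_ * _)%E.
exact: (integral_choice t (Lh t w) i).
Qed.

Lemma integral_est_loss t i (c : W -> R) : measurable_fun [set: sT (past t)] c -> (forall w, 0 <= c w) ->
  (\int[P]_w (c w * est_loss t w i)%:E =
   \int[P]_w (c w * (loss t w i * (0 < choice_prob t w i)%R%:R))%:E)%E.
Proof.
move=> mc c0.
have mcl : measurable_fun [set: sT (past t)] (fun w => c w * loss t w i).
  by apply: measurable_funM => //; exact: loss_measurable.
have cl0 w : 0 <= c w * loss t w i by rewrite mulr_ge0// loss_ge0.
pose f (z : sT (past t) * sT (now t)) := chR i z * esR i z.
have mf : measurable_fun setT f by apply: measurable_funM; [exact: mchR|exact: mestimate].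
have f0 z : 0 <= f z by rewrite mulr_ge0.
transitivity (\int[P]_w ((c w * loss t w i) * f (w, w))%:E)%E.
  by apply: eq_integral => w _; rewrite /est_loss /increment /f /chR /esR; congr (_%:E); ring.
rewrite (@decouple t _ f mcl mf cl0 f0); apply: eq_integral => w _.
rewrite mulrA [RHS]EFinM; congr (_ * _)%E.
exact: (integral_choice_estimate t (Lh t w) i).
Qed.

(** The factor [choice_prob] cancels the second moment [2 / q] of the chosen estimate, and the
    losses are at most 1. The weight [c] stands for the rank factor of the arm. *)
Lemma integral_est_loss_sqr t i (c : W -> R) : measurable_fun [set: sT (past t)] c -> (forall w, 0 <= c w) ->
  (\int[P]_w (c w * choice_prob t w i * est_loss t w i ^+ 2)%:E <= \int[P]_w (c w * 2)%:E)%E.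
Proof.
move=> mc c0.
have ml := @loss_measurable t i; have mq := @measurable_choice_prob t i.
pose a w := c w * choice_prob t w i * loss t w i ^+ 2.
have ma : measurable_fun [set: sT (past t)] a.
  apply: measurable_funM; first exact: measurable_funM.
  exact: (measurableT_comp (exprn_measurable 2) ml).
have a0 w : 0 <= a w by rewrite /a mulr_ge0 ?sqr_ge0// mulr_ge0// choice_prob_ge0.
pose f (z : sT (past t) * sT (now t)) := chR i z * esR i z ^+ 2.
have mf : measurable_fun setT f.
  apply: measurable_funM; [exact: mchR|apply: (measurableT_comp (exprn_measurable 2)); exact: mestimate].
have f0 z : 0 <= f z by rewrite mulr_ge0// sqr_ge0.
rewrite [leLHS](_ : _ = \int[P]_w (a w * f (w, w))%:E)%E; last first.
  apply: eq_integral => w _; rewrite /est_loss /increment /a /f /chR /esR; congr (_%:E).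
  by case: (i \in _); rewrite ?mul1r ?mul0r ?expr0n ?mulr0// exprMn !mulrA.
rewrite (@decouple t _ f ma mf a0 f0); apply: ge0_le_integral => //.
- by move=> w _; rewrite mule_ge0 ?lee_fin// integral_ge0// => w' _; rewrite lee_fin.
- apply: emeasurable_funM.
    by apply/measurable_EFinP; exact: measurable_of_sources ma.
  have mid Q : measurable_fun [set: W] (id : W -> sT Q).
    by apply: measurable_of_sources; exact: measurable_id.
  pose fW (z : W * W) := (f (z.1, z.2))%:E.
  have mfW : measurable_fun [set: W * W] fW.
    apply/measurable_EFinP; apply: (measurableT_comp mf).
    apply: measurable_fun_pair; first exact: (measurableT_comp (mid (past t)) measurable_fst).
    exact: (measurableT_comp (mid (now t)) measurable_snd).
  by apply: (@measurable_fun_fubini_tonelli_F _ _ _ _ _ P fW mfW) => z; rewrite lee_fin.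
- by apply/measurable_EFinP; apply: measurable_funM => //; exact: measurable_of_sources mc.
move=> w _; apply: (@le_trans _ _ ((a w)%:E * (2 / choice_prob t w i)%:E)%E).
  by apply: lee_wpmul2l; [rewrite lee_fin|exact: (integral_choice_estimate_sqr t (Lh t w) i)].
rewrite -EFinM lee_fin /a; have q0 := choice_prob_ge0 t w i; have /andP[l0 l1] := l01 t w i.
have [->|qn0] := eqVneq (choice_prob t w i) 0; first by rewrite mulr0 !mul0r mulr_ge0.
rewrite (_ : _ * (2 / _) = c w * (2 * loss t w i ^+ 2)); last by field.
by rewrite ler_wpM2l// ler_piMr// exprn_ile1.
Qed.

End Dynamics.

(** * Regret *)

Section Regret.
Context {R : realType} {D : law_family} {alpha : R} (halpha : 1 < alpha)
  {d m : nat} {est : estimation d} {disp : measure_display} {W : measurableType disp}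
  {P : probability W R} {disp' : measure_display} {E : measurableType disp'}
  {N : noise P E d}.
Hypotheses (md : (0 < m <= d)%N) (hN : noise_law m D alpha est N).
Variables (eta : nat -> R) (loss : nat -> W -> 'I_d -> R).
Hypothesis eta0 : forall t, 0 < eta t.
Hypothesis eta_dec : forall t, eta t.+1 <= eta t.
Let act := ftpl_action m eta est N loss.
Let Lh := ftpl_Lhat m eta est N loss.
Hypothesis adv : adversarial (source_events N (Seed d)) loss act.
Variable C : R.
Hypothesis C0 : 0 <= C.
Hypothesis HC : forall y h, 0 <= h -> family_cdf D alpha (y + h) - family_cdf D alpha y <=
  C * h * (1 - family_cdf D alpha y) `^ (1 + alpha^-1).

Let phi := phi (m := m) (N := N).
Let q := choice_prob (m := m) (est := est) (N := N) eta loss.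
Let lh := est_loss (m := m) (est := est) (N := N) eta loss.
Let v w i := perturb N 0 i w.

Let vF i : has_law D alpha (perturb N 0 i). Proof. by have [_ + _ _] := hN; apply. Qed.
Let vind := perturb_indep hN (t := 0%N).
Let m0 : (0 < m)%N. Proof. by case/andP: md. Qed.
Let lh0 t w i : 0 <= lh t w i. Proof. exact: (est_loss_ge0 md adv). Qed.
Let q0 t w i : 0 <= q t w i. Proof. exact: choice_prob_ge0. Qed.

Let mv (l : 'I_d -> R) i : measurable [set w | among_largest m (fun k => v w k - l k) i].
Proof.
apply: measurable_among_largest => k.
by apply: measurable_funB => //; exact: measurable_funP.
Qed.

Let phi_mono i (l l' : 'I_d -> R) : l i = l' i -> (forall j, l j <= l' j) -> phi i l <= phi i l'.
Proof.
move=> li ll'; apply: le_mean => [||w]; [exact: unitf_bool|exact: unitf_bool|].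
have imp : among_largest m (fun k => v w k - l k) i -> among_largest m (fun k => v w k - l' k) i.
  by apply: among_largest_mono => [|j _]; rewrite ?li// lerD2l lerN2.
move: imp; rewrite /v; case: (among_largest _ _ _) => [->//|_]; exact: ler0n.
Qed.

(** The ranks of the analysis break ties by index, whatever rule the estimator follows. *)
Definition arm_weight (l : 'I_d -> R) i : R := (m%:R / (rank 1%g l i)%:R) `^ alpha^-1.

(** One formula for two regimes: up to rank [m] the weight is at least 1 and the crude bound
    suffices. *)
Let phi_shift i (l : 'I_d -> R) h : 0 <= h ->
  phi i l - phi i (fun k => l k + (k == i)%:R * h) <= 3 * C * h * arm_weight l i * phi i l.
Proof.
move=> h0; have [rm|mr] := leqP (rank 1%g l i) m; last first.
  exact: (pick_prob_shift_rank halpha vF vind m0 C0 h0 HC mr).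
apply: le_trans (pick_prob_shift_le halpha vF vind m l i C0 h0 HC) _.
change (C * h * phi i l <= 3 * C * h * arm_weight l i * phi i l).
have p0 : 0 <= phi i l by exact: mean_ge0.
have k1 : 1 <= arm_weight l i.
  apply: powR_ge1; first by rewrite invr_ge0 ltW// (lt_trans ltr01).
  by rewrite ler_pdivlMr ?mul1r ?ler_nat// ltr0n rank_gt0.
have Chp : 0 <= C * h * phi i l by rewrite !mulr_ge0.
have : C * h * phi i l * 1 <= C * h * phi i l * arm_weight l i by rewrite ler_wpM2l.
have : 0 <= C * h * phi i l * arm_weight l i by rewrite mulr_ge0// (le_trans ler01).
by move: (phi i l) (arm_weight l i) => x y; lra.
Qed.

Let lam t w j := eta t * Lh t w j.
Let kap t w i := arm_weight (lam t w) i.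

(** The round also raises the losses of the other arms, which can only increase the probability of
    [i]; raising arm [i] alone is the worst case. *)
Let next_ge t w i : phi i (fun k => lam t w k + (k == i)%:R * (eta t * lh t w i)) <=
  phi i (fun k => eta t * Lh t.+1 w k).
Proof.
apply: phi_mono => [|j]; rewrite /lam /Lh LhatS -/lh mulrDr ?eqxx ?mul1r// lerD2l.
by case: eqVneq => [->|_]; rewrite ?mul1r// mul0r mulr_ge0// ltW.
Qed.

Let round_le t w i : lh t w i * q t w i <=
  lh t w i * phi i (fun k => eta t * Lh t.+1 w k) +
  3 * C * eta t * (kap t w i * q t w i * lh t w i ^+ 2).
Proof.
have h0 : 0 <= eta t * lh t w i by rewrite mulr_ge0// ltW.
have := phi_shift i (lam t w) h0; rewrite -/(q t w i) -/(kap t w i) => H.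
have := ler_wpM2l (lh0 t w i) (le_trans _ (next_ge t w i)).
move=> /(_ (q t w i - 3 * C * (eta t * lh t w i) * kap t w i * q t w i)) H'.
have : lh t w i * (q t w i - 3 * C * (eta t * lh t w i) * kap t w i * q t w i) <=
    lh t w i * phi i (fun k => eta t * Lh t.+1 w k).
  by apply: H'; move: H; rewrite -/(lam t w) /q /choice_prob -/(phi i _); lra.
by rewrite expr2; lra.
Qed.

Let integral_sumR (I : Type) (s : seq I) (f : I -> W -> R) :
  (forall k, measurable_fun setT (f k)) -> (forall k w, 0 <= f k w) ->
  (\int[P]_w (\sum_(k <- s) f k w)%:E = \sum_(k <- s) \int[P]_w (f k w)%:E)%E.
Proof.
move=> mf f0; under eq_integral do rewrite -sumEFin.
rewrite ge0_integral_sum// => [k|k w _]; last by rewrite lee_fin.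
exact/measurable_EFinP.
Qed.

Let integral_addR (f g : W -> R) : measurable_fun setT f -> measurable_fun setT g ->
  (forall w, 0 <= f w) -> (forall w, 0 <= g w) ->
  (\int[P]_w (f w + g w)%:E = \int[P]_w (f w)%:E + \int[P]_w (g w)%:E)%E.
Proof.
move=> mf mg f0 g0; under eq_integral do rewrite EFinD.
rewrite ge0_integralD//; try (by move=> w _; rewrite lee_fin); exact/measurable_EFinP.
Qed.

Let integral_scaleR (c : R) (f : W -> R) : measurable_fun setT f -> 0 <= c ->
  (forall w, 0 <= f w) -> (\int[P]_w (c * f w)%:E = c%:E * \int[P]_w (f w)%:E)%E.
Proof.
move=> mf c0 f0; under eq_integral do rewrite EFinM.
rewrite ge0_integralZl//; try (by move=> w _; rewrite lee_fin); try by rewrite lee_fin.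
exact/measurable_EFinP.
Qed.

Let integral_cstR (c : R) : (\int[P]_w c%:E = c%:E)%E.
Proof.
rewrite integral_cst//; transitivity (c%:E * 1)%E; last by rewrite mule1.
by congr (_ * _)%E; exact: probability_setT.
Qed.

Variables (T : nat) (a : {set 'I_d}) (B : R).
Hypothesis am : #|a| = m.

Let tau : R := (d%:R / m%:R) `^ alpha^-1.
Let excess w : R := m%:R * tau + \sum_i Num.max (v w i - tau) 0 + \sum_i Num.max (- v w i) 0.
Hypothesis HB : (\int[P]_w (excess w)%:E <= B%:E)%E.

Let excess0 w : 0 <= excess w.
Proof.
by rewrite !addr_ge0 ?mulr_ge0 ?powR_ge0// sumr_ge0// => i _; rewrite le_max lexx orbT.
Qed.

Let mexcess : measurable_fun setT excess.
Proof.
have mvi i : measurable_fun setT (v ^~ i) by exact: measurable_funP.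
apply: measurable_funD; last first.
  by apply: measurable_sum => i; apply: measurable_maxr => //; exact: measurable_funN.
apply: measurable_funD => //.
by apply: measurable_sum => i; apply: measurable_maxr => //; exact: measurable_funB.
Qed.

(* The be-the-leader bound holds for every value of a fresh perturbation, which
   is then averaged out with the history fixed. *)
Let leader_le w : \sum_(t < T.+1) \sum_i lh t w i * phi i (fun k => eta t * Lh t.+1 w k) <=
  \sum_(t < T.+1) dot (lh t w) a + B / eta T.
Proof.
pose top t w' i : R := (i \in topset m (fun k => v w' k - eta t * Lh t.+1 w k))%:R.
have top_meas t i : measurable_fun setT (fun w' => top t w' i).
  have [] // := @unitf_bool R _ W (fun w' => i \in topset m (fun k => v w' k - eta t * Lh t.+1 w k)).
  rewrite (_ : [set w' | _] = [set w' | among_largest m (fun k => v w' k - eta t * Lh t.+1 w k) i]).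
    exact: mv.
  by apply/seteqP; split => w' /=; rewrite inE.
have top_int t i : (\int[P]_w' (top t w' i)%:E = (phi i (fun k => eta t * Lh t.+1 w k))%:E)%E.
  rewrite /phi /pick_prob meanE; last by apply: unitf_bool; exact: mv.
  by apply: eq_integral => w' _; rewrite /top inE.
have pathw w' : \sum_(t < T.+1) \sum_i lh t w i * top t w' i <=
    \sum_(t < T.+1) dot (lh t w) a + (eta T)^-1 * excess w'.
  (* With this value of [B] the perturbation of the comparator cancels and only the excess is left
     to pay. *)
  have := @be_the_leader R d m (fun t => Lh t w) (fun t => lh t w) eta (v w') (dot (v w') a + excess w') T a.
  rewrite (addrC (dot (v w') a)) addrK [_ / _]mulrC => H.
  have {H} := H (proj2 (andP md)) (fun t i => LhatS eta loss t w i) erefl eta0 eta_dec.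
  move=> /(_ _ am) => H; apply: le_trans (H _); last first.
    move=> b bm; have tau0 : 0 <= tau by exact: powR_ge0.
    by have := dot_le_excess (v w') a tau0 bm; rewrite -/(excess w'); lra.
  apply: ler_sum => t _; rewrite /dot [leRHS]big_mkcond; apply: ler_sum => i _ /=.
  by rewrite /top; case: (i \in _); rewrite ?mulr1 ?mulr0.
rewrite -lee_fin.
have -> : ((\sum_(t < T.+1) \sum_i lh t w i * phi i (fun k => eta t * Lh t.+1 w k))%:E =
    \int[P]_w' (\sum_(t < T.+1) \sum_i lh t w i * top t w' i)%:E)%E.
  rewrite integral_sumR => [|t|t w']; last 2 first.
  - by apply: measurable_sum => i; exact: measurable_funM.
  - by apply: sumr_ge0 => i _; rewrite mulr_ge0 ?ler0n.
  rewrite -sumEFin; apply: eq_bigr => t _; rewrite integral_sumR => [|i|i w']; last 2 first.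
  - exact: measurable_funM.
  - by rewrite mulr_ge0 ?ler0n.
  rewrite -sumEFin; apply: eq_bigr => i _.
  by rewrite integral_scaleR ?top_int// => w'; rewrite ler0n.
have A0 : 0 <= \sum_(t < T.+1) dot (lh t w) a.
  by apply: sumr_ge0 => t _; apply: sumr_ge0.
have eV0 : 0 <= (eta T)^-1 by rewrite invr_ge0 ltW.
apply: (@le_trans _ _ (\int[P]_w' (\sum_(t < T.+1) dot (lh t w) a + (eta T)^-1 * excess w')%:E)%E).
  apply: ge0_le_integral => //.
  - move=> w' _; rewrite lee_fin; apply: sumr_ge0 => t _; apply: sumr_ge0 => i _.
    by rewrite mulr_ge0 ?ler0n.
  - apply/measurable_EFinP; apply: measurable_sum => t; apply: measurable_sum => i.
    exact: measurable_funM.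
  - apply/measurable_EFinP; apply: measurable_funD => //; exact: measurable_funM.
  - by move=> w' _; rewrite lee_fin; exact: pathw.
rewrite integral_addR//; last 2 first.
- exact: measurable_funM.
- by move=> w'; rewrite mulr_ge0.
rewrite integral_cstR integral_scaleR// EFinD leeD2l// [X in (_ <= X)%E](_ : _ = (eta T)^-1%:E * B%:E)%E.
  by rewrite lee_wpmul2l ?lee_fin.
by rewrite -EFinM mulrC.
Qed.

Let pathwise w : \sum_(t < T.+1) \sum_i q t w i * lh t w i <=
  \sum_(t < T.+1) dot (lh t w) a + B / eta T +
  \sum_(t < T.+1) \sum_i 3 * C * eta t * (kap t w i * q t w i * lh t w i ^+ 2).
Proof.
apply: le_trans (_ : _ <= \sum_(t < T.+1) \sum_i (lh t w i * phi i (fun k => eta t * Lh t.+1 w k) +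
  3 * C * eta t * (kap t w i * q t w i * lh t w i ^+ 2))) _.
  apply: ler_sum => t _; apply: ler_sum => i _; rewrite mulrC; exact: round_le.
under eq_bigr do rewrite big_split/=.
by rewrite big_split/= lerD2r; exact: leader_le.
Qed.

Let mLh t i : measurable_fun [set: W] (fun w => Lh t w i).
Proof. exact: measurable_of_sources (Lhat_measurable adv (t := t) i). Qed.

Let mlh t i : measurable_fun [set: W] (fun w => lh t w i).
Proof.
rewrite (_ : (fun w => _) = (fun w => Lh t.+1 w i - Lh t w i)); first exact: measurable_funB.
by apply/funext => w; rewrite /Lh LhatS addrC addKr.
Qed.

Let mqp t i : measurable_fun [set: g_sigma_algebraType (sources (N := N) (est := est) (past t))] (q t ^~ i).
Proof. exact: (measurable_choice_prob adv). Qed.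

Let mq t i : measurable_fun [set: W] (q t ^~ i).
Proof. exact: measurable_of_sources (@mqp t i). Qed.

Let mkapp t i : measurable_fun [set: g_sigma_algebraType (sources (N := N) (est := est) (past t))] (kap t ^~ i).
Proof.
pose Z := g_sigma_algebraType (sources (N := N) (est := est) (past t)).
apply: (@measurable_natr _ Z R (fun w => rank 1%g (lam t w) i) (fun r => (m%:R / r%:R) `^ alpha^-1)) => n.
apply: (@measurable_rank _ Z R d 1%g (lam t)) => j; rewrite /lam.
by apply: measurable_funM; [exact: measurable_cst|exact: (Lhat_measurable adv)].
Qed.

Let mkap t i : measurable_fun [set: W] (kap t ^~ i).
Proof. exact: measurable_of_sources (@mkapp t i). Qed.

Let kap0 t w i : 0 <= kap t w i. Proof. exact: powR_ge0. Qed.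

Let ml t i : measurable_fun [set: W] (fun w => loss t w i).
Proof. exact: measurable_of_sources (loss_measurable adv (t := t) i). Qed.

Let l01 t w i : 0 <= loss t w i <= 1.
Proof. by have [+ _] := adv; apply. Qed.


Let mact t i : measurable [set w | i \in act t w].
Proof. exact: (act_measurable adv). Qed.

Variable Kap : R.
Hypothesis HKap : forall l, \sum_i arm_weight l i <= Kap.

Let uact t i : unitf (fun w => loss t w i * (i \in act t w)%:R).
Proof. by apply: unitfM => //; exact: unitf_bool. Qed.

(** On the comparator side the indicator of a positive selection probability is bounded by 1. *)
Let int_lh t i : (\int[P]_w (lh t w i)%:E <= \int[P]_w (loss t w i)%:E)%E.
Proof.
have := integral_est_loss halpha md hN eta0 adv (t := t) i (c := fun=> 1) (measurable_cst _) (fun=> ler01).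
under eq_integral do rewrite mul1r; move=> ->; apply: ge0_le_integral => //.
- by move=> w _; rewrite lee_fin mul1r mulr_ge0// (loss_ge0 adv).
- apply/measurable_EFinP; apply: measurable_funM => //; apply: measurable_funM => //.
  have [] // := @unitf_bool R _ W (fun w => (0 < q t w i)%R).
  by apply: measurable_bool; exact: measurable_fun_ltr.
- exact/measurable_EFinP.
- move=> w _; rewrite lee_fin mul1r ler_piMr ?(loss_ge0 adv)//.
  by case: (0 < _).
Qed.

(** On the learner side the factor [q] absorbs that indicator, so the weighted estimate and the loss
    actually incurred have the same mean. *)
Let int_q_lh t i : (\int[P]_w (q t w i * lh t w i)%:E = (mean P (fun w => loss t w i * (i \in act t w)%:R))%:E)%E.
Proof.
rewrite meanE//.
rewrite (integral_act halpha md hN adv i (loss_measurable adv (t := t) i) (fun w => loss_ge0 adv t w i)).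
rewrite (integral_est_loss halpha md hN eta0 adv i (@mqp t i) (fun w => q0 t w i)).
apply: eq_integral => w _; congr (_%:E); rewrite -/(q t w i) mulrC -mulrA; congr (_ * _).
have := q0 t w i; rewrite le_eqVlt => /predU1P[<-|->]; last by rewrite mul1r.
by rewrite mulr0.
Qed.

Let int_kap t : (\sum_i \int[P]_w (kap t w i * q t w i * lh t w i ^+ 2)%:E <= (2 * Kap)%:E)%E.
Proof.
apply: (@le_trans _ _ (\sum_i \int[P]_w (kap t w i * 2)%:E)%E).
  by apply: lee_sum => i _; exact: (integral_est_loss_sqr halpha md hN eta0 adv _ (@mkapp t i)).
rewrite -integral_sumR; last 2 first.
- by move=> i; exact: measurable_funM.
- by move=> i w; rewrite mulr_ge0.
rewrite -(integral_cstR (2 * Kap)); apply: ge0_le_integral => //.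
- by move=> w _; rewrite lee_fin; apply: sumr_ge0 => i _; rewrite mulr_ge0.
- by apply/measurable_EFinP; apply: measurable_sum => i; exact: measurable_funM.
- by move=> w _; rewrite lee_fin -mulr_suml mulrC ler_wpM2l// HKap.
Qed.

Lemma regret_mean_le :
  \sum_(t < T.+1) \sum_i mean P (fun w => loss t w i * (i \in act t w)%:R) <=
  \sum_(t < T.+1) \sum_(i in a) mean P (fun w => loss t w i) + B / eta T +
  \sum_(t < T.+1) 3 * C * eta t * (2 * Kap).
Proof.
have B0 : 0 <= B.
  by rewrite -lee_fin (le_trans _ HB)// integral_ge0// => w _; rewrite lee_fin.
have Be0 : 0 <= B / eta T by rewrite mulr_ge0// invr_ge0 ltW.
have msq t i : measurable_fun [set: W] (fun w => kap t w i * q t w i * lh t w i ^+ 2).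
  apply: measurable_funM; first exact: measurable_funM.
  exact: (measurableT_comp (exprn_measurable 2)).
have sq0 t w i : 0 <= kap t w i * q t w i * lh t w i ^+ 2 by rewrite mulr_ge0 ?sqr_ge0// mulr_ge0.
have c0 t : 0 <= 3 * C * eta t by rewrite !mulr_ge0// ltW.
have mdot t : measurable_fun [set: W] (fun w => dot (lh t w) a).
  by rewrite /dot; under eq_fun do rewrite -big_enum; exact: measurable_sum.
have dot0 t w : 0 <= dot (lh t w) a by apply: sumr_ge0.
rewrite -lee_fin.
have -> : ((\sum_(t < T.+1) \sum_i mean P (fun w => loss t w i * (i \in act t w)%:R))%:E =
    \int[P]_w (\sum_(t < T.+1) \sum_i q t w i * lh t w i)%:E)%E.
  rewrite integral_sumR => [|t|t w]; last 2 first.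
  - by apply: measurable_sum => i; exact: measurable_funM.
  - by apply: sumr_ge0 => i _; rewrite mulr_ge0.
  rewrite -sumEFin; apply: eq_bigr => t _; rewrite integral_sumR => [|i|i w]; last 2 first.
  - exact: measurable_funM.
  - by rewrite mulr_ge0.
  by rewrite -sumEFin; apply: eq_bigr => i _; rewrite int_q_lh.
pose r1 w := \sum_(t < T.+1) dot (lh t w) a.
pose r2 w := \sum_(t < T.+1) \sum_i 3 * C * eta t * (kap t w i * q t w i * lh t w i ^+ 2).
have mr1 : measurable_fun [set: W] r1 by exact: measurable_sum.
have mr2 : measurable_fun [set: W] r2.
  by apply: measurable_sum => t; apply: measurable_sum => i; exact: measurable_funM.
have r10 w : 0 <= r1 w by apply: sumr_ge0.
have r20 w : 0 <= r2 w by apply: sumr_ge0 => t _; apply: sumr_ge0 => i _; rewrite mulr_ge0.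
apply: (@le_trans _ _ (\int[P]_w (r1 w + B / eta T + r2 w)%:E)%E).
  apply: ge0_le_integral => //.
  - move=> w _; rewrite lee_fin; apply: sumr_ge0 => t _; apply: sumr_ge0 => i _.
    by rewrite mulr_ge0.
  - apply/measurable_EFinP; apply: measurable_sum => t; apply: measurable_sum => i.
    exact: measurable_funM.
  - by apply/measurable_EFinP; apply: measurable_funD => //; exact: measurable_funD.
  - by move=> w _; rewrite lee_fin; exact: pathwise.
rewrite integral_addR//; last 2 first.
- exact: measurable_funD.
- by move=> w; rewrite addr_ge0.
rewrite integral_addR// integral_cstR 2!EFinD; apply: leeD; first apply: leeD => //.
  rewrite integral_sumR// -sumEFin; apply: lee_sum => t _.
  rewrite /dot [X in (X <= _)%E](_ : _ = \sum_(i in a) \int[P]_w (lh t w i)%:E)%E; last first.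
    under eq_integral do rewrite -big_enum.
    by rewrite integral_sumR// big_enum.
  rewrite -sumEFin; apply: lee_sum => i _; rewrite meanE//; exact: int_lh.
rewrite integral_sumR => [|t|t w]; last 2 first.
- by apply: measurable_sum => i; exact: measurable_funM.
- by apply: sumr_ge0 => i _; rewrite mulr_ge0.
rewrite -sumEFin; apply: lee_sum => t _; rewrite integral_sumR => [|i|i w]; last 2 first.
- exact: measurable_funM.
- by rewrite mulr_ge0.
rewrite (eq_bigr (fun i => (3 * C * eta t)%:E * \int[P]_w (kap t w i * q t w i * lh t w i ^+ 2)%:E)%E); last first.
  by move=> i _; rewrite integral_scaleR.
rewrite -ge0_sume_distrr => [|i _]; last by apply: integral_ge0 => w _; rewrite lee_fin.
rewrite [leRHS]EFinM; apply: lee_wpmul2l; first by rewrite lee_fin.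
exact: int_kap.
Qed.

Lemma pseudo_regretE : pseudo_regret P T.+1 loss act a =
  (\sum_(t < T.+1) \sum_i mean P (fun w => loss t w i * (i \in act t w)%:R) -
   \sum_(t < T.+1) \sum_(i in a) mean P (fun w => loss t w i))%:E.
Proof.
pose f1 w := \sum_(t < T.+1) dot (loss t w) (act t w).
pose f2 w := \sum_(t < T.+1) dot (loss t w) a.
(* The double sum over rounds and arms is flattened so that [mean_sum] applies once. *)
pose idx : seq (nat * 'I_d) := [seq (nat_of_ord t, i) | t <- enum 'I_T.+1, i <- enum 'I_d].
have idxE (V : nmodType) (g : nat -> 'I_d -> V) :
    \sum_(x <- idx) g x.1 x.2 = \sum_(t < T.+1) \sum_i g t i.
  rewrite big_allpairs_dep/= big_enum/=; apply: eq_bigr => t _.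
  by rewrite big_enum.
have dotE (b : {set 'I_d}) t w : dot (loss t w) b = \sum_i loss t w i * (i \in b)%:R.
  rewrite /dot big_mkcond; apply: eq_bigr => i _.
  by case: (i \in b); rewrite ?mulr1 ?mulr0.
have ua t i : unitf (fun w => loss t w i * (i \in a)%:R).
  by apply: unitfM => //; apply: (@unitf_cst _ _ _ (i \in a)%:R); case: (i \in a); rewrite ?lexx ler01.
have sumP (g : nat -> 'I_d -> W -> R) : (forall t i, unitf (g t i)) ->
    P.-integrable setT (EFin \o (fun w => \sum_(t < T.+1) \sum_i g t i w)) /\
    (\int[P]_w (\sum_(t < T.+1) \sum_i g t i w)%:E = (\sum_(t < T.+1) \sum_i mean P (g t i))%:E)%E.
  move=> gu.
  have gE : (fun w => \sum_(t < T.+1) \sum_i g t i w) = (fun w => \sum_(x <- idx) g x.1 x.2 w).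
    by apply/funext => w; rewrite (idxE _ (fun t i => g t i w)).
  have gi : P.-integrable setT (EFin \o (fun w => \sum_(t < T.+1) \sum_i g t i w)).
    rewrite gE (_ : _ \o _ = fun w => (\sum_(x <- idx) (g x.1 x.2 w)%:E)%E).
      by apply: integrable_sum => // x _; exact: unitf_integrable.
    by apply/funext => w /=; rewrite sumEFin.
  split => //; rewrite -[LHS]fineK; last exact: integrable_fin_num.
  congr (_%:E); rewrite -(idxE _ (fun t i => mean P (g t i))) -mean_sum//.
  by rewrite -gE.
have f1E : f1 = fun w => \sum_(t < T.+1) \sum_i loss t w i * (i \in act t w)%:R.
  by apply/funext => w; apply: eq_bigr => t _; rewrite dotE.
have f2E : f2 = fun w => \sum_(t < T.+1) \sum_i loss t w i * (i \in a)%:R.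
  by apply/funext => w; apply: eq_bigr => t _; rewrite dotE.
have [i1 e1] := sumP _ uact; have [i2 e2] := sumP _ ua.
rewrite /pseudo_regret unlock.
transitivity (\int[P]_w (f1 w)%:E - \int[P]_w (f2 w)%:E)%E.
  rewrite -integralB_EFin ?f1E ?f2E//.
  apply: eq_integral => w _; rewrite -EFinB; congr (_%:E).
  by rewrite sumrB; congr (_ - _); apply: eq_bigr => t _; rewrite dotE.
rewrite f1E f2E e1 e2 -EFinB; congr (_ - _)%:E.
apply: eq_bigr => t _; rewrite [RHS]big_mkcond; apply: eq_bigr => i _.
case: (i \in a); first by congr mean; apply/funext => w; rewrite mulr1.
by rewrite -[RHS](mean_cst P); congr mean; apply/funext => w; rewrite mulr0.
Qed.

End Regret.

(** * Tuning of the learning rate and conclusion *)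

Section LearningRate.
Context {R : realType} (alpha c : R).
Hypotheses (halpha : 1 < alpha) (hc : 0 < c).
Variables d m : nat.
Hypothesis hm : (1 <= m <= d)%N.
Local Notation eta := (learning_rate alpha c d m).

Let m0 : 0 < m%:R :> R. Proof. by rewrite ltr0n; case/andP: hm. Qed.
Let d0 : 0 < d%:R :> R. Proof. by rewrite ltr0n; case/andP: hm => m1; exact: leq_trans. Qed.

Let sqrtS t : 0 < Num.sqrt (t.+1%:R : R). Proof. by rewrite sqrtr_gt0. Qed.

Lemma learning_rate_gt0 t : 0 < eta t.
Proof. by rewrite /learning_rate !mulr_gt0 ?invr_gt0 ?powR_gt0. Qed.

Lemma learning_rate_dec t : eta t.+1 <= eta t.
Proof.
rewrite /learning_rate !ler_wpM2r ?powR_ge0// ler_wpM2l ?(ltW hc)// lef_pV2 ?posrE//.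
by rewrite ler_sqrt// ler_nat.
Qed.

(** Telescoping: with [x^2 = y^2 + 1], the inequality [1 <= 2 x (x - y)] is [0 <= (x - y)^2]. *)
Lemma sum_inv_sqrt_le n : \sum_(t < n) (Num.sqrt (t.+1%:R : R))^-1 <= 2 * Num.sqrt n%:R.
Proof.
elim: n => [|n IH]; first by rewrite big_ord0 mulr_ge0 ?sqrtr_ge0.
rewrite big_ord_recr/=; have s0 := sqrtS n.
have sq (k : nat) : Num.sqrt (k%:R : R) ^+ 2 = k%:R by rewrite sqr_sqrtr.
have : (Num.sqrt (n.+1%:R : R))^-1 <= 2 * (Num.sqrt n.+1%:R - Num.sqrt n%:R).
  rewrite -(ler_pM2r s0) mulVf ?gt_eqF//.
  have := sq n; have := sq n.+1; rewrite -natr1.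
  move: (Num.sqrt _) (Num.sqrt _) => x y; have := sqr_ge0 (x - y); rewrite !expr2; lra.
by move: IH; lra.
Qed.

Let powRB (x u v : R) : 0 < x -> x `^ u * (x `^ v)^-1 = x `^ (u - v).
Proof. by move=> x0; rewrite powRD ?(gt_eqF x0) ?implybT// powRN. Qed.

(** The exponents of [m] and [d] in the rate are those that leave [sqrt (m d)] both here and in
    [weight_times_rate]. *)
Lemma penalty_over_rate t :
  (m%:R `^ (1 - alpha^-1) * d%:R `^ alpha^-1) / eta t =
  c^-1 * (Num.sqrt m%:R * Num.sqrt d%:R * Num.sqrt t.+1%:R).
Proof.
rewrite /learning_rate !invfM invrK.
have -> : Num.sqrt (m%:R : R) = m%:R `^ (1 - alpha^-1) * (m%:R `^ (2^-1 - alpha^-1))^-1.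
  rewrite powRB// -powR12_sqrt//; congr (_ `^ _); lra.
have -> : Num.sqrt (d%:R : R) = d%:R `^ alpha^-1 * (d%:R `^ (alpha^-1 - 2^-1))^-1.
  rewrite powRB// -powR12_sqrt//; congr (_ `^ _); lra.
ring.
Qed.

Lemma weight_times_rate t :
  eta t * (m%:R `^ alpha^-1 * d%:R `^ (1 - alpha^-1)) =
  c * (Num.sqrt m%:R * Num.sqrt d%:R) * (Num.sqrt t.+1%:R)^-1.
Proof.
have -> : Num.sqrt (m%:R : R) = m%:R `^ (2^-1 - alpha^-1) * m%:R `^ alpha^-1.
  rewrite -powRD ?(gt_eqF m0) ?implybT// -powR12_sqrt//; congr (_ `^ _); lra.
have -> : Num.sqrt (d%:R : R) = d%:R `^ (alpha^-1 - 2^-1) * d%:R `^ (1 - alpha^-1).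
  rewrite -powRD ?(gt_eqF d0) ?implybT// -powR12_sqrt//; congr (_ `^ _); lra.
rewrite /learning_rate; ring.
Qed.

End LearningRate.

Theorem theorem3 (R : realType) (D : law_family) (alpha c : R)
    (halpha : 1 < alpha) (hc : 0 < c) :
  exists C : R,
  forall (d m T : nat) (hm : (1 <= m <= d)%N) (hT : (1 <= T)%N)
    (est : estimation d)
    (disp : measure_display) (W : measurableType disp) (P : probability W R)
    (disp' : measure_display) (E : measurableType disp')
    (N : noise P E d) (loss : nat -> W -> 'I_d -> R) (astar : {set 'I_d}),
  let act := ftpl_action m (learning_rate alpha c d m) est N loss in
  noise_law m D alpha est N ->
  adversarial (source_events N (Seed d)) loss act ->
  best_action P m T loss astar ->
  (pseudo_regret P T loss act astar <=
     (C * Num.sqrt (m%:R * d%:R * T%:R))%:E)%E.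
Proof.
have [C C0 HC] := family_cdf_lipschitz D halpha.
pose K1 : R := 1 + (1 - 2 `^ (1 - alpha))^-1.
pose K2 : R := (1 - alpha^-1)^-1.
(* [K1] is the constant of the mean excess and [K2] that of the sum over ranks. The factor 12 is 3
   from the stability bound, 2 from the second moment and 2 from the sum of inverse square roots. *)
exists (K1 / c + 12 * C * c * K2) => d m [//|T] hm _ est disp W P disp' E N loss a act hN adv [am _].
have eta0 := learning_rate_gt0 alpha hc hm.
have eta_dec : forall t, learning_rate alpha c d m t.+1 <= learning_rate alpha c d m t by exact: learning_rate_dec.
have [_ pF _ _] := hN.
pose B := K1 * (m%:R `^ (1 - alpha^-1) * d%:R `^ alpha^-1).
pose Kap := m%:R `^ alpha^-1 * d%:R `^ (1 - alpha^-1) * K2.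
have HB := excess_sum_le halpha hm (pF 0%N) erefl.
have HK (l : 'I_d -> R) : \sum_i arm_weight (alpha := alpha) (m := m) l i <= Kap.
  exact: sum_powR_rank_le.
rewrite (pseudo_regretE adv) lee_fin.
have := regret_mean_le halpha hm hN eta0 eta_dec adv C0 HC T am HB HK.
set S1 := \sum_(t < _) _; set S2 := \sum_(t < _) _ => H.
have sqrtE : Num.sqrt (m%:R * d%:R * T.+1%:R : R) = Num.sqrt m%:R * Num.sqrt d%:R * Num.sqrt T.+1%:R.
  by rewrite !sqrtrM// mulr_ge0.
have E1 : K1 * (m%:R `^ (1 - alpha^-1) * d%:R `^ alpha^-1) / learning_rate alpha c d m T =
    K1 / c * Num.sqrt (m%:R * d%:R * T.+1%:R).
  by rewrite -[LHS]mulrA penalty_over_rate// sqrtE mulrA.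
have E2 : \sum_(t < T.+1) 3 * C * learning_rate alpha c d m t * (2 * Kap) <=
    12 * C * c * K2 * Num.sqrt (m%:R * d%:R * T.+1%:R).
  have K20 : 0 <= K2.
    by rewrite invr_ge0 subr_ge0 invf_le1 ?(ltW halpha)// (lt_trans ltr01).
  rewrite (eq_bigr (fun t : 'I_T.+1 => 6 * C * c * K2 * (Num.sqrt m%:R * Num.sqrt d%:R) *
    (Num.sqrt t.+1%:R)^-1)) => [|t _]; last first.
    transitivity (6 * C * K2 * (learning_rate alpha c d m t *
      (m%:R `^ alpha^-1 * d%:R `^ (1 - alpha^-1)))); first by rewrite /Kap; ring.
    by rewrite weight_times_rate//; ring.
  rewrite -mulr_sumr sqrtE.
  have X0 : 0 <= 6 * C * c * K2 * (Num.sqrt m%:R * Num.sqrt d%:R).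
    by rewrite !mulr_ge0 ?sqrtr_ge0// ltW.
  apply: le_trans (ler_wpM2l X0 (sum_inv_sqrt_le _)) _.
  by rewrite le_eqVlt; apply/orP; left; apply/eqP; ring.
by move: H; rewrite E1 => H; move: E2 H; move: S1 S2 (\sum_(t < _) _) => x y z; lra.
Qed.
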